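(* Let $W$ be the Weyl group of a finite crystallographic root system. Then every element $w \in W$ is conjugate in $W$ to its inverse $w^{-1}$.
   Context: The Weyl group $W$ is the group generated by the reflections $s_\tau$, $\tau \in \Phi$, where $\Phi$ is a finite crystallographic root system. *)

(* Defs.v *)
From HB Require Import structures.
From mathcomp Require Import all_boot all_order all_algebra.
From mathcomp Require Import reals.

Set Implicit Arguments.
Unset Strict Implicit.
Unset Printing Implicit Defensive.

Import Order.TTheory GRing.Theory Num.Theory.

Local Open Scope ring_scope.

(* A Euclidean space is a finite-dimensional real vector space V with a
   positive definite symmetric bilinear form dot : {dot V for idfun}. *)
Section RootSystems.
Variables (R : realType) (V : vectType R) (dot : {dot V for idfun}).

Definition cartan_number (b a : V) : R := 2 * dot b a / dot a a.

Definition reflection_fun (a v : V) : V := v - cartan_number v a *: a.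

Lemma reflection_fun_is_linear a : linear (reflection_fun a).
Proof.
move=> k u v; rewrite /reflection_fun /cartan_number linearPl /=.
rewrite mulrDr mulrDl scalerDl scalerBr opprD addrACA; congr (_ - _ + _).
by rewrite scalerA mulrCA !mulrA.
Qed.

HB.instance Definition _ a :=
  GRing.isLinear.Build R V V *:%R (reflection_fun a)
    (reflection_fun_is_linear a).

Definition reflection (a : V) : 'End(V) := linfun (reflection_fun a).

Lemma reflectionE a v :
  reflection a v = v - (2 * dot v a / dot a a) *: a.
Proof. by rewrite lfunE. Qed.

(* Phi is read as the finite set of its members; order and multiplicity are
   irrelevant. As in Humphreys, "Reflection Groups and Coxeter Groups", a root
   system is reduced and is not required to span V. *)
Record root_system (Phi : seq V) : Prop := RootSystem {
  root_neq0 : 0 \notin Phi;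
  root_reduced : forall (a : V) (c : R), a \in Phi ->
    (c *: a \in Phi) = (c == 1) || (c == -1);
  root_reflection : forall a b : V, a \in Phi -> b \in Phi ->
    reflection a b \in Phi
}.

Definition crystallographic (Phi : seq V) : Prop :=
  forall a b : V, a \in Phi -> b \in Phi -> cartan_number b a \is a Num.int.

(* The subgroup of GL(V) generated by the reflections in the roots. On 'End(V),
   ^-1%VF is a priori only a partial inverse; weyl_group_lker0 shows that it is
   the inverse in GL(V) on every element of the group. *)
Inductive weyl_group (Phi : seq V) : 'End(V) -> Prop :=
| weyl_reflection a of a \in Phi : weyl_group Phi (reflection a)
| weyl_one : weyl_group Phi \1%VF
| weyl_mul f g of weyl_group Phi f & weyl_group Phi g :
    weyl_group Phi (f \o g)%VF
| weyl_inv f of weyl_group Phi f : weyl_group Phi (f^-1)%VF.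

Lemma reflectionK (a : V) : a != 0 -> (reflection a \o reflection a)%VF = \1%VF.
Proof.
move=> a0; have aa0 : dot a a != 0 by rewrite gt_eqF// neq0_dnorm_gt0.
apply/lfunP => v; rewrite !lfunE /= !lfunE /= /reflection_fun /cartan_number.
rewrite linearBl linearZl_LR /=.
set k := _ / _; have -> : 2 * (dot v a - k * dot a a) / dot a a = - k.
  rewrite /k divfK// [X in _ - X]mulr_natl mulr2n opprD addrA subrr sub0r.
  by rewrite mulrN mulNr.
by rewrite scaleNr opprK subrK.
Qed.

Lemma weyl_group_lker0 (Phi : seq V) (f : 'End(V)) :
  0 \notin Phi -> weyl_group Phi f -> lker f == 0%VS.
Proof.
move=> Phi0; elim=> {f} [a aPhi||f g _ kf _ kg|f _ kf].
- apply/lker0P => u v /(congr1 (reflection a)).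
  by rewrite -!comp_lfunE reflectionK ?id_lfunE//; apply: contraNneq Phi0 => <-.
- by apply/lker0P => u v; rewrite !id_lfunE.
- apply/lker0P => u v; rewrite !comp_lfunE.
  by move=> /(lker0P kf) /(lker0P kg).
- apply/lker0P => u v /(congr1 f).
  by rewrite -!comp_lfunE lker0_compfV ?id_lfunE.
Qed.

End RootSystems.

(* Main.v *)
Require Import Defs.
From Stdlib Require Import ZArith.
From mathcomp Require Import all_boot all_order all_algebra all_fingroup.
From mathcomp Require Import boolp reals.
From mathcomp Require Import zify ssrZ ring lra.

Set Implicit Arguments.
Unset Strict Implicit.
Unset Printing Implicit Defensive.

Import Order.TTheory GRing.Theory Num.Theory.

Local Open Scope ring_scope.

(* The element [g] conjugates [w] to its inverse iff [w g w = g]. This property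
   of all products of reflections in a set of roots depends only on the lines of
   the roots and passes to unions of two orthogonal sets, so it is enough to
   split off one nonempty set of roots that has it from every nonempty root
   system.

   Such a component is found by growing frames. A frame of type A is a family
   [f] whose differences [f i - f j] are roots of one length; a frame of type D
   is an orthonormal family [e] all of whose [e i + e j] and [e i - e j] are
   roots. The integrality of Cartan numbers leaves few ways in which another
   root can pair with a maximal frame, and they force the component to be of
   type A, B, D, E6, E7, E8, F4 or G2.

   In types A, B and D the products are (signed) permutations, which are
   inverted cycle by cycle; in type D the inverting element can be made even,
   because either some cycle of [w] reverses a sign and provides an odd element
   commuting with [w], or no sign is involved after a change of frame. In the
   exceptional types there is a list of representatives, each with an explicit
   element inverting it, that contains 1 and is stable, up to conjugacy, under
   multiplication by reflections; this is verified by computation. *)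

(** * Words in reflections *)

(** The relation [w g w = g] contains no inverse and is inherited by products of commuting factors,
    so it can be handled on words of reflections. No simple system or Dynkin diagram enters: what
    must be produced is a set of vectors on root lines such that every root lies on one of its lines
    or is orthogonal to all of it. Since only lines count, types B and C coincide, and so do the two
    orientations of F4 and of G2. This allows one root length to be singled out, namely one shared
    by two roots that are neither parallel nor orthogonal, and normalised to squared norm 2. If
    there is no such pair, a piece of type A1 or B2 splits off directly. The delicate points are the
    coincidences in small rank: A3 = D3; the triality of D4, which exchanges vector and spin
    weights; and the frame sizes 5, 6 and 8, the only ones for which a spin weight can be a root
    when the frame is maximal. In the exceptional types the elements have no description by cycles,
    and certificates over the integers take its place. *)

Section Words.
Variables (R : realType) (V : vectType R) (dot : {dot V for idfun}).
Implicit Types (a b u v x y : V) (s t : seq V) (f g : 'End(V)).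

Lemma dotC u v : dot u v = dot v u.
Proof. by rewrite hermC expr0 mul1r. Qed.

Lemma dotDl u v x : dot (u + v) x = dot u x + dot v x.
Proof. by rewrite linearDl. Qed.
Lemma dotDr u v x : dot x (u + v) = dot x u + dot x v.
Proof. by rewrite linearDr. Qed.
Lemma dotNl u x : dot (- u) x = - dot u x.
Proof. by rewrite linearNl. Qed.
Lemma dotNr u x : dot x (- u) = - dot x u.
Proof. by rewrite linearNr. Qed.
Lemma dotZl c u x : dot (c *: u) x = c * dot u x.
Proof. by rewrite linearZl_LR. Qed.
Lemma dotZr c u x : dot x (c *: u) = c * dot x u.
Proof. by rewrite dotC dotZl dotC. Qed.
Lemma dot0l x : dot 0 x = 0.
Proof. by rewrite linear0l. Qed.
Lemma dot0r x : dot x 0 = 0.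
Proof. by rewrite linear0r. Qed.
Definition dotE := (dotDl, dotDr, dotNl, dotNr, dotZl, dotZr, dot0l, dot0r).

Lemma dot_gt0 u : u != 0 -> 0 < dot u u.
Proof. exact: neq0_dnorm_gt0. Qed.
Lemma dot_eq0 u : (dot u u == 0) = (u == 0).
Proof.
by have [->|/dot_gt0/gt_eqF//] := eqVneq u 0; rewrite dot0l eqxx.
Qed.
Lemma dot_ge0 u : 0 <= dot u u.
Proof. by have [->|/dot_gt0/ltW//] := eqVneq u 0; rewrite dot0l. Qed.

Lemma dot_inj u v : (forall x, dot u x = dot v x) -> u = v.
Proof.
by move=> uv; apply/eqP; rewrite -subr_eq0 -dot_eq0 dotDl dotNl uv subrr.
Qed.

Lemma dot_suml I (r : seq I) P (F : I -> V) x :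
  dot (\sum_(i <- r | P i) F i) x = \sum_(i <- r | P i) dot (F i) x.
Proof. by elim/big_rec2: _ => [|i y z _ <-]; rewrite ?dot0l ?dotDl. Qed.

Local Notation rf := (reflection dot).

Lemma rfE a v : rf a v = v - (2 * dot v a / dot a a) *: a.
Proof. exact: reflectionE. Qed.

Lemma rfZ c a : c != 0 -> rf (c *: a) = rf a.
Proof.
move=> c0; apply/lfunP => v; rewrite !rfE; congr (v - _).
have [->|a0] := eqVneq a 0; first by rewrite !scaler0.
have aa : dot a a != 0 by rewrite dot_eq0.
by rewrite scalerA !dotE; congr (_ *: _); field; rewrite aa c0.
Qed.

Lemma rfN a : rf (- a) = rf a.
Proof. by rewrite -scaleN1r rfZ // oppr_eq0 oner_eq0. Qed.

Lemma rfK a v : a != 0 -> rf a (rf a v) = v.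
Proof. by move=> a0; rewrite -comp_lfunE reflectionK // id_lfunE. Qed.

Lemma dot_rf a u v : dot (rf a u) (rf a v) = dot u v.
Proof.
have [->|a0] := eqVneq a 0; first by rewrite !rfE !scaler0 !subr0.
have aa : dot a a != 0 by rewrite dot_eq0.
by rewrite !rfE !dotE (dotC a v); field.
Qed.

Lemma rf_ortho a v : dot v a = 0 -> rf a v = v.
Proof. by rewrite rfE => ->; rewrite mulr0 mul0r scale0r subr0. Qed.

Lemma rf_self a : a != 0 -> rf a a = - a.
Proof.
move=> a0; have aa : dot a a != 0 by rewrite dot_eq0.
rewrite rfE mulfK // -[X in X - _]scale1r -scalerBl -scaleN1r; congr (_ *: _).
by ring.
Qed.

Lemma rf_conj b a v : b != 0 -> rf b (rf a v) = rf (rf b a) (rf b v).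
Proof.
by move=> b0; rewrite [rf a v]rfE (rfE (rf b a)) !dot_rf linearB linearZ.
Qed.

Definition word s : 'End(V) := foldr (fun a f => rf a \o f)%VF \1%VF s.

Lemma word_nil v : word [::] v = v. Proof. exact: id_lfunE. Qed.
Lemma word_cons a s v : word (a :: s) v = rf a (word s v).
Proof. by rewrite /= comp_lfunE. Qed.
Lemma word_cat s t v : word (s ++ t) v = word s (word t v).
Proof.
by elim: s => [|a s IHs]; rewrite ?word_nil // cat_cons !word_cons IHs.
Qed.
Lemma word_catE s t : word (s ++ t) = (word s \o word t)%VF.
Proof. by apply/lfunP => v; rewrite word_cat comp_lfunE. Qed.

Lemma word_revK s v : 0 \notin s -> word (rev s) (word s v) = v.
Proof.
elim: s v => [|a s IHs] v; rewrite ?word_nil // inE negb_or eq_sym.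
case/andP=> a0 s0; rewrite rev_cons -cats1 word_cat !word_cons word_nil rfK //.
exact: IHs.
Qed.

Lemma word_revKV s v : 0 \notin s -> word s (word (rev s) v) = v.
Proof. by move=> s0; rewrite -{1}[s]revK word_revK // mem_rev. Qed.

Lemma dot_word s u v : dot (word s u) (word s v) = dot u v.
Proof.
by elim: s => [|a s IHs]; rewrite ?word_nil // !word_cons dot_rf.
Qed.

Lemma word_conj s a v : 0 \notin s ->
  word s (rf a v) = rf (word s a) (word s v).
Proof.
elim: s => [|b s IHs]; rewrite ?word_nil // inE negb_or eq_sym.
by case/andP=> b0 s0; rewrite !word_cons IHs // rf_conj.
Qed.

Lemma word_inv s : 0 \notin s -> (word s)^-1%VF = word (rev s).
Proof.
move=> s0; have k0 : lker (word s) == 0%VS.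
  by apply/lker0P => u v /(congr1 (word (rev s))); rewrite !word_revK.
apply/lfunP => v; rewrite -{1}(word_revKV v s0).
by rewrite -[LHS]comp_lfunE lker0_compVf // id_lfunE.
Qed.

Lemma subs_notin0 (s Phi : seq V) :
  0 \notin Phi -> {subset s <= Phi} -> 0 \notin s.
Proof. by move=> Phi0 sP; apply: contra Phi0 => /sP. Qed.

Lemma weyl_wordP (Phi : seq V) f : 0 \notin Phi ->
  weyl_group dot Phi f <-> exists2 s, {subset s <= Phi} & f = word s.
Proof.
move=> Phi0; split.
  elim=> {f} [a aPhi||f g _ [s sP ->] _ [t tP ->]|f _ [s sP ->]].
  - exists [:: a]; first by move=> x /[!inE] /eqP ->.
    by rewrite /= comp_lfun1r.
  - by exists [::].
  - exists (s ++ t); last by rewrite word_catE.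
    by move=> x; rewrite mem_cat => /orP[/sP|/tP].
  - exists (rev s); first by move=> x; rewrite mem_rev => /sP.
    by rewrite word_inv // (subs_notin0 Phi0 sP).
case=> s sP ->; elim: s sP => [|a s IHs] sP; first exact: weyl_one.
apply: weyl_mul; first by apply/weyl_reflection/sP; rewrite mem_head.
by apply: IHs => x xs; apply: sP; rewrite inE xs orbT.
Qed.

Lemma word_span (B : {vspace V}) s v :
  {subset s <= B} -> word s v - v \in B.
Proof.
elim: s => [|a s IHs] sB; first by rewrite word_nil subrr mem0v.
rewrite word_cons rfE addrAC rpredB //.
  by apply: IHs => x xs; rewrite sB // inE xs orbT.
by rewrite rpredZ // sB ?mem_head.
Qed.

(* The difference [word s v - word t v] lies in the span of [B] and is
   orthogonal to it. *)
Lemma eq_word_on (B s t : seq V) : 0 \notin s -> 0 \notin t ->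
  {subset s <= <<B>>%VS} -> {subset t <= <<B>>%VS} ->
  {in B, word s =1 word t} -> word s = word t.
Proof.
move=> s0 t0 sB tB eqB.
have eqS b : b \in <<B>>%VS -> word s b = word t b.
  move=> bB; rewrite (coord_span (bB : b \in <<in_tuple B>>%VS)).
  rewrite !linear_sum; apply: eq_bigr => i _.
  by rewrite !linearZ /= eqB ?mem_nth.
apply/lfunP => v; apply/eqP; rewrite -subr_eq0 -dot_eq0.
have xB : word s v - word t v \in <<B>>%VS.
  rewrite (_ : _ - _ = (word s v - v) - (word t v - v)).
    by rewrite rpredB // word_span.
  by rewrite opprB addrA subrK.
set x := word s v - word t v in xB *.
have rB : word (rev s) x \in <<B>>%VS.
  rewrite -[word (rev s) x](subrK x) rpredD // word_span // => y.
  by rewrite mem_rev => /sB.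
(* The reversed words are the adjoints of the two words. As they agree on [x], moving the words
   across [dot] makes [x] orthogonal to itself. *)
have e : word (rev s) x = word (rev t) x.
  by rewrite -{2}(word_revKV x s0) eqS // word_revK.
rewrite {1}/x dotDl dotNl.
rewrite -{1}(word_revKV x s0) -{2}(word_revKV x t0) !dot_word e subrr //.
Qed.

End Words.

(** Pairing with an arbitrary vector turns a vector identity into an identity of reals, which [ring]
    or [field] decides. *)
Ltac vec dot := apply: (@dot_inj _ _ dot) => ?; rewrite ?dotE; by [ring | field].

Lemma sub_cons (T : eqType) (a : T) (s A : seq T) :
  {subset a :: s <= A} <-> a \in A /\ {subset s <= A}.
Proof.
split=> [asA|[aA sA] x]; last by rewrite inE => /predU1P[->|/sA].
by split=> [|x xs]; apply: asA; rewrite inE ?eqxx // xs orbT.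
Qed.

Lemma sub_cat (T : eqType) (s t A : seq T) :
  {subset s ++ t <= A} <-> {subset s <= A} /\ {subset t <= A}.
Proof.
split=> [stA|[sA tA] x]; last by rewrite mem_cat => /orP[/sA|/tA].
by split=> x xs; apply: stA; rewrite mem_cat xs ?orbT.
Qed.

(** * Ambivalence, root lines and orthogonal splitting *)

Section Ambivalence.
Variables (R : realType) (V : vectType R) (dot : {dot V for idfun}).
Implicit Types (a b u v : V) (s t g A B M Phi : seq V).
Local Notation rf := (reflection dot).
Local Notation word := (word dot).

(* [w g w = g] says that [g] conjugates [w] to its inverse. *)
Definition ambivalent Phi := forall s, {subset s <= Phi} ->
  exists2 g, {subset g <= Phi} & forall v, word s (word g (word s v)) = word g v.

(** Components are built from rescaled roots, such as the halves of the longer roots of type C, and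
    a reflection depends only on the line of its root. *)
Definition on_line Phi a := exists2 c : R, c != 0 & c *: a \in Phi.

Lemma mem_on_line Phi a : a \in Phi -> on_line Phi a.
Proof. by exists 1; rewrite ?oner_eq0 // scale1r. Qed.

Lemma on_lineZ Phi c a : c != 0 -> on_line Phi a -> on_line Phi (c *: a).
Proof.
move=> c0 [d d0 da]; exists (d / c); first by rewrite mulf_neq0 ?invr_eq0.
by rewrite scalerA divfK.
Qed.

Lemma on_lineVZ Phi c a : c != 0 -> on_line Phi (c *: a) -> on_line Phi a.
Proof.
move=> c0 [d d0 da]; exists (d * c); first by rewrite mulf_neq0.
by rewrite -scalerA.
Qed.

Lemma word_lines A B s : (forall a, a \in A -> on_line B a) ->
  {subset s <= A} -> exists2 t, {subset t <= B} & word s = word t.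
Proof.
move=> AB; elim: s => [|a s IHs]; first by exists [::].
move=> /sub_cons[aA /IHs[t tB e]].
have [c c0 cB] := AB a aA; exists (c *: a :: t); first by apply/sub_cons.
by apply/lfunP => v; rewrite !word_cons e rfZ.
Qed.

Lemma rf_comm a b v : a != 0 -> dot a b = 0 -> rf a (rf b v) = rf b (rf a v).
Proof. by move=> a0 ab; rewrite rf_conj // [rf a b]rf_ortho // dotC. Qed.

Lemma word_comm A B s t v : 0 \notin A ->
  (forall a b, a \in A -> b \in B -> dot a b = 0) ->
  {subset s <= A} -> {subset t <= B} ->
  word s (word t v) = word t (word s v).
Proof.
move=> A0 AB; elim: s v => [|a s IHs] v; first by rewrite !word_nil.
move=> /sub_cons[aA sA] tB; rewrite !word_cons IHs //.
have a0 : a != 0 by apply: contraNneq A0 => <-.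
elim: t tB (word s v) {IHs} => [_ u|b t IHt]; first by rewrite !word_nil.
by move=> /sub_cons[bB tB] u; rewrite !word_cons rf_comm ?IHt // AB.
Qed.

Definition perp M Phi := [seq a <- Phi | all (fun m => dot a m == 0) M].

(** Reflections in [M] commute with those in roots orthogonal to [M]. A word therefore splits into a
    word over [M] followed by one over the orthogonal roots, and the product of two inverting
    elements, one for each factor, inverts the whole. *)
Lemma ambivalent_perp Phi M : 0 \notin Phi ->
  (forall m, m \in M -> on_line Phi m) ->
  (forall a, a \in Phi -> on_line M a \/ forall m, m \in M -> dot a m = 0) ->
  ambivalent M -> ambivalent (perp M Phi) -> ambivalent Phi.
Proof.
move=> Phi0 MPhi PhiM ambM ambP s sPhi.
have P0 : 0 \notin perp M Phi by rewrite mem_filter negb_and Phi0 orbT.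
have PM a m : a \in perp M Phi -> m \in M -> dot a m = 0.
  by rewrite mem_filter => /andP[/allP aM _] /aM/eqP.
have comm t1 t2 : {subset t1 <= perp M Phi} -> {subset t2 <= M} ->
    forall v, word t1 (word t2 v) = word t2 (word t1 v).
  by move=> t1P t2M v; apply: (word_comm _ P0 PM).
have [s1 [s2 [s1M s2P es]]] : exists s1 s2, [/\ {subset s1 <= M},
    {subset s2 <= perp M Phi} & forall v, word s v = word s1 (word s2 v)].
  elim: s sPhi => [|a s IHs]; first by exists [::], [::]; split=> // v; rewrite !word_nil.
  move=> /sub_cons[aPhi /IHs[s1 [s2 [s1M s2P e]]]].
  case: (PhiM a aPhi) => [[c c0 cM]|aM].
    exists (c *: a :: s1), s2; split=> // [|v]; first by apply/sub_cons.
    by rewrite !word_cons e rfZ.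
  have aP : a \in perp M Phi.
    by rewrite mem_filter aPhi andbT; apply/allP => m mM; rewrite aM.
  exists s1, (a :: s2); split=> // [|v]; first by apply/sub_cons.
  have /(comm [:: a])/(_ s1M) : {subset [:: a] <= perp M Phi} by apply/sub_cons.
  by move=> /(_ (word s2 v)); rewrite !word_cons !word_nil e => ->.
have [g1 g1M e1] := ambM s1 s1M; have [g2 g2P e2] := ambP s2 s2P.
have [h hPhi eh] := word_lines MPhi g1M.
exists (h ++ g2).
  by apply/sub_cat; split=> // x /g2P; rewrite mem_filter => /andP[].
move=> v; rewrite !word_cat !es -!eh.
by rewrite (comm g2) // (comm s2) // (comm s2) // e2 e1.
Qed.

End Ambivalence.

(** * Certificates for the exceptional types *)

Delimit Scope Z_scope with ZZ.

(* An integer vector [x] stands for [\sum_i x_i b_i], where [b] is an orthogonal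
   family whose squared norms are proportional to the weights [w]. *)
Fixpoint zdot (w x y : seq Z) : Z :=
  match w, x, y with
  | c :: w', a :: x', b :: y' => (c * (a * b) + zdot w' x' y')%ZZ
  | _, _, _ => 0%ZZ
  end.

Fixpoint zsub (q : Z) (x a : seq Z) : seq Z :=
  match x, a with
  | b :: x', c :: a' => (b - q * c)%ZZ :: zsub q x' a'
  | _, _ => [::]
  end.

Definition zneg : seq Z -> seq Z := map Z.opp.

Fixpoint zeqb (x y : seq Z) : bool :=
  match x, y with
  | a :: x', b :: y' => if Z.eqb a b then zeqb x' y' else false
  | [::], [::] => true
  | _, _ => false
  end.

(** The lists contain only one root of each opposite pair, so membership is taken up to sign. *)
Definition zmem (x : seq Z) (l : seq (seq Z)) : bool :=
  has (zeqb x) l || has (zeqb (zneg x)) l.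

Definition zrefl (w a x : seq Z) : seq Z :=
  zsub (2 * zdot w x a / zdot w a a)%ZZ x a.

Definition zword (w : seq Z) (l : seq (seq Z)) (x : seq Z) : seq Z :=
  foldr (zrefl w) x l.

Definition zcomb (n : nat) (c : seq Z) (l : seq (seq Z)) : seq Z :=
  foldr (fun p y => zsub (- p.1) y p.2) (nseq n 0%ZZ) (zip c l).

Fixpoint zunits (n : nat) : seq (seq Z) :=
  if n is k.+1 then (1%ZZ :: nseq k 0%ZZ) :: map (cons 0%ZZ) (zunits k) else [::].

Fixpoint zorbit (w : seq Z) (gens : seq (seq (seq Z))) (fuel : nat)
    (seen todo : seq (seq Z)) : seq (seq Z) :=
  if fuel is k.+1 then
    if todo is x :: td then
      if zmem x seen then zorbit w gens k seen td
      else zorbit w gens k (x :: seen) ([seq zword w g x | g <- gens] ++ td)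
    else seen
  else seen.

(* One record per conjugacy class, up to a sign when [-1] is in the group; roots
   are referred to by their index.  It holds a representative, an element
   inverting it, elements centralising it, and triples [(x, j, h)]: the product
   of the [x]-th reflection with the representative is conjugate by [h] to the
   representative of the [j]-th class. *)
Record class_data := ClassData {
  cd_rep : seq nat;
  cd_inv : seq nat;
  cd_cent : seq (seq nat);
  cd_step : seq (nat * nat * seq nat) }.

Definition no_class := ClassData [::] [::] [::] [::].

Section Checker.
Variables (w : seq Z) (roots basis : seq (seq Z)).

Definition zroots (l : seq nat) : seq (seq Z) := [seq nth [::] roots i | i <- l].

Definition zvalid (l : seq nat) := all (fun i => i < size roots)%N l.

Definition zeqw (s t : seq (seq Z)) :=
  all (fun b => zeqb (zword w s b) (zword w t b)) basis.

Definition zeqNw (s t : seq (seq Z)) :=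
  all (fun b => zeqb (zword w s b) (zneg (zword w t b))) basis.

Definition check_roots :=
  all (fun x => size x == size w) roots
  && all (fun a => let d := zdot w a a in ~~ Z.eqb d 0 &&
       all (fun x => Z.eqb ((2 * zdot w x a) mod d) 0 && zmem (zrefl w a x) roots)
         roots) roots.

Definition check_basis (coefs : seq (Z * seq Z)) :=
  [&& all (fun x => has (zeqb x) roots) basis,
      size coefs == size w
    & all (fun p => ~~ Z.eqb p.1.1 0 &&
         zeqb (zcomb (size w) p.1.2 basis) (map (Z.mul p.1.1) p.2))
       (zip coefs (zunits (size w)))].

(** Conjugacy of [s_x r] to a representative [r'] is tested in the form [s_x r h = h r'], or with a
    minus sign on one side, which avoids inverting [h]. *)
Definition check_step (minus : seq nat) (cl : seq class_data)
    (r : seq (seq Z)) (p : nat * nat * seq nat) :=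
  let h := zroots p.2 in
  let t1 := nth [::] roots p.1.1 :: r ++ h in
  let t2 := h ++ zroots (cd_rep (nth no_class cl p.1.2)) in
  [&& (p.1.1 < size roots)%N, (p.1.2 < size cl)%N, zvalid p.2
    & zeqw t1 t2 || [&& size minus != 0%N & zeqNw t1 t2]].

(** Steps are listed for a few roots only. Elements commuting with the representative transport a
    step from one root to another, and the last test says that every root is reached in this way. *)
Definition check_class (minus : seq nat) (cl : seq class_data) (c : class_data) :=
  let r := zroots (cd_rep c) in
  let i := zroots (cd_inv c) in
  let gens := r :: map zroots (cd_cent c) in
  let seeds := zroots [seq p.1.1 | p <- cd_step c] in
  let orb := zorbit w gens (size roots * (size gens).+2) [::] seeds in
  [&& zvalid (cd_rep c), zvalid (cd_inv c), all zvalid (cd_cent c),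
      zeqw (r ++ i ++ r) i,
      all (fun g => zeqw (g ++ r) (r ++ g)) gens,
      all (check_step minus cl r) (cd_step c)
    & all (fun x => zmem x orb) roots].

Definition check_classes (minus : seq nat) (cl : seq class_data) :=
  [&& size (cd_rep (nth no_class cl 0)) == 0%N, (0 < size cl)%N, zvalid minus,
      (size minus == 0%N) || zeqNw (zroots minus) [::]
    & all (check_class minus cl) cl].

End Checker.

(** * Soundness of the certificates *)

Section Soundness.
Variables (R : realType) (V : vectType R) (dot : {dot V for idfun}).

(** The certificates compute in the binary integers [Z], which [vm_compute] handles efficiently;
    this embeds the results into the reals. *)
Definition zR (z : Z) : R := (int_of_Z z)%:~R.

Lemma zRD a b : zR (Z.add a b) = zR a + zR b.
Proof. by rewrite /zR -intrD; congr _%:~R; lia. Qed.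
Lemma zRM a b : zR (Z.mul a b) = zR a * zR b.
Proof. by rewrite /zR -intrM; congr _%:~R; lia. Qed.
Lemma zRN a : zR (Z.opp a) = - zR a.
Proof. by rewrite /zR -intrN; congr _%:~R; lia. Qed.
Lemma zR_eq0 a : (zR a == 0) = Z.eqb a 0.
Proof. by rewrite /zR intr_eq0; apply/eqP/Z.eqb_spec; lia. Qed.

Lemma zeqbP x y : reflect (x = y) (zeqb x y).
Proof.
elim: x y => [|a x IHx] [|b y] /=; try by constructor.
case: (Z.eqb_spec a b) => [->|ab]; last by constructor=> -[].
by apply: (iffP (IHx y)) => [->|[]].
Qed.

Lemma has_zeqb x l : has (zeqb x) l = (x \in l).
Proof. by elim: l => //= y l ->; rewrite inE; congr (_ || _); apply/zeqbP/eqP. Qed.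

Lemma zmemP x l : reflect (x \in l \/ zneg x \in l) (zmem x l).
Proof. by rewrite /zmem !has_zeqb; apply: orP. Qed.

Lemma znegK : involutive zneg.
Proof. by elim=> [|a x IHx] //=; rewrite IHx Z.opp_involutive. Qed.

Fixpoint phi (bs : seq V) (x : seq Z) : V :=
  match bs, x with
  | b :: bs', a :: x' => zR a *: b + phi bs' x'
  | _, _ => 0
  end.

(** The common factor [k] lets the weights stay integral: it is 1/4 when the axes are halves of
    orthonormal vectors. *)
Fixpoint ortho_fam (k : R) (w : seq Z) (bs : seq V) : Prop :=
  match w, bs with
  | c :: w', b :: bs' => [/\ dot b b = k * zR c,
      forall b', b' \in bs' -> dot b b' = 0 & ortho_fam k w' bs']
  | [::], [::] => True
  | _, _ => False
  end.

Lemma phi_neg bs x : phi bs (zneg x) = - phi bs x.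
Proof.
elim: bs x => [|b bs IHbs] [|a x] /=; rewrite ?oppr0 //.
by rewrite IHbs zRN scaleNr opprD.
Qed.

Lemma phi_sub bs q x a : size x = size bs -> size a = size bs ->
  phi bs (zsub q x a) = phi bs x - zR q *: phi bs a.
Proof.
elim: bs x a => [|b bs IHbs] [|c x] [|d a] //=; first by rewrite scaler0 subr0.
move=> [sx] [sa]; rewrite IHbs // -[Z.sub _ _]/(Z.add c (Z.opp (Z.mul q d))).
rewrite zRD zRN zRM scalerDl scaleNr scalerDr opprD addrACA scalerA.
by [].
Qed.

Lemma dot_phi0 b bs x : (forall b', b' \in bs -> dot b b' = 0) ->
  dot b (phi bs x) = 0.
Proof.
elim: bs x => [|b' bs IHbs] [|a x] //= bb; rewrite ?dot0r //.
rewrite dotDr dotZr bb ?mem_head // mulr0 add0r IHbs // => c cb.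
by rewrite bb // inE cb orbT.
Qed.

Lemma dot_phi k w bs x y : ortho_fam k w bs ->
  size x = size w -> size y = size w ->
  dot (phi bs x) (phi bs y) = k * zR (zdot w x y).
Proof.
elim: w bs x y => [|c w IHw] [|b bs] [|a x] [|d y] //=.
  by rewrite dot0l /zR mulr0.
move=> [bb bbs ow] [sx] [sy]; rewrite zRD !zRM !dotE IHw // bb.
by rewrite (dotC dot _ b) !dot_phi0 //; ring.
Qed.

Lemma ortho_fam_size k w bs : ortho_fam k w bs -> size bs = size w.
Proof. by elim: w bs => [|c w IHw] [|b bs] //= [_ _ /IHw ->]. Qed.

Lemma map_phi_zunits bs : map (phi bs) (zunits (size bs)) = bs.
Proof.
elim: bs => //= b bs IHbs; congr (_ :: _).
  rewrite scale1r (_ : phi _ _ = 0) ?addr0 //.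
  by elim: bs {IHbs} => //= c bs ->; rewrite scale0r addr0.
rewrite -map_comp -[RHS]IHbs; apply: eq_map => x /=.
by rewrite scale0r add0r.
Qed.

Lemma phi_span bs x : phi bs x \in <<bs>>%VS.
Proof.
elim: bs x => [|b bs IHbs] [|a x] /=; rewrite ?mem0v //.
rewrite span_cons memv_add // memvZ ?memv_line //.
Qed.

Lemma phi_scale bs d x : phi bs (map (Z.mul d) x) = zR d *: phi bs x.
Proof.
elim: bs x => [|b bs IHbs] [|a x] /=; rewrite ?scaler0 //.
by rewrite IHbs zRM scalerDr scalerA.
Qed.

Lemma size_zsub q x a : size (zsub q x a) = minn (size x) (size a).
Proof. by elim: x a => [|b x IHx] [|c a] //=; rewrite IHx minnSS. Qed.

End Soundness.

Section SoundCheck.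
Variables (R : realType) (V : vectType R) (dot : {dot V for idfun}).
Variables (k : R) (w : seq Z) (bs : seq V) (roots basis : seq (seq Z)).
Variables (coefs : seq (Z * seq Z)) (minus : seq nat) (cl : seq class_data).
Hypotheses (k0 : k != 0) (ob : ortho_fam dot k w bs) (cR : check_roots w roots)
  (cB : check_basis w roots basis coefs) (cC : check_classes w roots basis minus cl).
Local Notation rf := (reflection dot).
Local Notation ph := (phi bs).
Local Notation W l := (word dot (map ph l)).
Implicit Types (l s t : seq (seq Z)) (a x : seq Z).

Lemma zmem_roots x : x \in roots -> zmem x roots.
Proof. by move=> xr; apply/zmemP; left. Qed.

Lemma zneg_zmem x l : zmem (zneg x) l = zmem x l.
Proof. by rewrite /zmem znegK orbC. Qed.

Lemma root_size x : zmem x roots -> size x = size w.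
Proof.
case/andP: cR => /allP sz _ /zmemP[/sz/eqP//|/sz/eqP <-].
by rewrite size_map.
Qed.

Lemma zroot_neq0 a : a \in roots -> zdot w a a <> Z0.
Proof. by case/andP: cR => _ /allP nz /nz/andP[/Z.eqb_spec]. Qed.

Lemma zdot_negl x a : zdot w (zneg x) a = Z.opp (zdot w x a).
Proof.
elim: w x a => [|c w' IHw] [|b x] [|d a] //=; rewrite IHw; lia.
Qed.

Lemma zneg_zsub q x a : zneg (zsub q x a) = zsub (- q) (zneg x) a.
Proof. by elim: x a => [|b x IHx] [|c a] //=; rewrite IHx; congr (_ :: _); lia. Qed.

(** [Z.div] rounds, so [zrefl] is a reflection only where the division is exact. Exactness is tested
    on the listed roots and passes to their negatives. *)
Lemma zrefl_root a x : a \in roots -> zmem x roots ->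
  ((2 * zdot w x a) mod zdot w a a = 0)%ZZ /\ zmem (zrefl w a x) roots.
Proof.
move=> ar; have nz := zroot_neq0 ar.
have h y : y \in roots ->
    ((2 * zdot w y a) mod zdot w a a = 0)%ZZ /\ zmem (zrefl w a y) roots.
  case/andP: cR => _ /allP/(_ a ar)/andP[_ /allP/(_ y)] + yr.
  by move=> /(_ yr)/andP[/Z.eqb_spec].
case/zmemP=> [/h//|/h[d m]].
have e : (2 * zdot w x a = - (2 * zdot w (zneg x) a))%ZZ by rewrite zdot_negl; lia.
split; first by rewrite e; apply: Z_mod_zero_opp_full.
rewrite -zneg_zmem /zrefl zneg_zsub e Z.div_opp_l_z // Z.opp_involutive //.
Qed.

Lemma ph_refl a x : a \in roots -> zmem x roots ->
  ph (zrefl w a x) = rf (ph a) (ph x).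
Proof.
move=> ar xr; have [e _] := zrefl_root ar xr.
have sa := root_size (zmem_roots ar); have sx := root_size xr.
have nz : zR R (zdot w a a) != 0 by rewrite zR_eq0; apply/Z.eqb_spec/(zroot_neq0 ar).
rewrite /zrefl phi_sub ?(ortho_fam_size ob) // rfE !(dot_phi ob) //.
congr (_ - _ *: _).
have /(congr1 (zR R)) := proj2 (Z.div_exact _ _ (zroot_neq0 ar)) e.
by rewrite !zRM mulrCA => ->; field; rewrite nz k0.
Qed.

Lemma ph_word l x : {subset l <= roots} -> zmem x roots ->
  zmem (zword w l x) roots /\ ph (zword w l x) = W l (ph x).
Proof.
move=> + xr; elim: l => [|a l IHl]; first by rewrite word_nil.
move=> /sub_cons[ar /IHl[m e]]; rewrite map_cons word_cons -e -ph_refl //.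
by split=> //; case: (zrefl_root ar m).
Qed.

Lemma ph_neq0 l : {subset l <= roots} -> 0 \notin map ph l.
Proof.
move=> lr; apply/mapP => -[x /lr xr e].
have sx := root_size (zmem_roots xr).
have /eqP := dot_phi ob sx sx; rewrite -e dot0l eq_sym mulf_eq0 (negPf k0) /=.
by rewrite zR_eq0 => /Z.eqb_spec; apply: zroot_neq0.
Qed.

Lemma basis_roots b : b \in basis -> b \in roots.
Proof. by case/and3P: cB => /allP h _ _ /h; rewrite has_zeqb. Qed.

Lemma phi_nseq0 (n : nat) : ph (nseq n 0%ZZ) = 0.
Proof. by elim: bs n => [|b bs' IHb] [|n] //=; rewrite IHb scale0r addr0. Qed.

Lemma zcomb_span c l : {subset l <= basis} ->
  ph (zcomb (size w) c l) \in <<map ph basis>>%VS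
  /\ size (zcomb (size w) c l) = size w.
Proof.
elim: l c => [|b l IHl] [|d c] lb;
  try by rewrite /zcomb /= phi_nseq0 mem0v size_nseq.
have [bb /(IHl c)[IH1 IH2]] := (sub_cons _ _ _).1 lb.
have sb := root_size (zmem_roots (basis_roots bb)).
rewrite /zcomb /= -/(zcomb (size w) c l) size_zsub IH2 sb minnn; split=> //.
rewrite phi_sub ?(ortho_fam_size ob) // rpredB // rpredZ // memv_span //.
exact: map_f.
Qed.

(** [coefs] writes a nonzero multiple of each coordinate axis in terms of [basis]. Hence all roots
    lie in the span of [basis], and words may be compared there. *)
Lemma ph_span x : ph x \in <<map ph basis>>%VS.
Proof.
apply: (subvP _ _ (phi_span bs x)); apply/span_subvP => b.
case/and3P: cB => _ /eqP sc /allP h.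
rewrite -{1}(map_phi_zunits bs) (ortho_fam_size ob) => /mapP[u uu ->].
have sz : size (zunits (size w)) = size w.
  by elim: (size w) => //= n; rewrite size_map => ->.
have iu : (index u (zunits (size w)) < size w)%N by rewrite -[X in (_ < X)%N]sz index_mem.
have := h (nth (Z0, [::], [::]) (zip coefs (zunits (size w))) (index u (zunits (size w)))).
rewrite mem_nth ?size_zip ?sc ?sz ?minnn // nth_zip ?sc ?sz // nth_index //.
set p := nth _ _ _; move=> /(_ isT)/andP[/= p0 /zeqbP e].
have [] := zcomb_span p.2 (fun x (xb : x \in basis) => xb); rewrite e phi_scale => + _.
by rewrite rpredZeq zR_eq0 (negPf p0).
Qed.

Lemma sub_span l : {subset map ph l <= <<map ph basis>>%VS}.
Proof. by move=> _ /mapP[x _ ->]; apply: ph_span. Qed.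

Lemma zeqw_sound s t : {subset s <= roots} -> {subset t <= roots} ->
  zeqw w basis s t -> W s = W t.
Proof.
move=> sr tr /allP e.
apply: (@eq_word_on _ _ dot (map ph basis));
  rewrite ?(ph_neq0 sr) ?(ph_neq0 tr) ?sub_span //; try exact: sub_span.
move=> _ /mapP[b bb ->]; have br := zmem_roots (basis_roots bb).
have [_ <-] := ph_word sr br; have [_ <-] := ph_word tr br.
by have /zeqbP -> := e b bb.
Qed.

(** Words acting as 1 and, when available, as -1 on the span of the roots; the classes are listed
    only up to these central factors. *)
Definition signs := if size minus == 0%N then [:: [::]] else [:: [::]; zroots roots minus].

Lemma zroots_sub (i : seq nat) : zvalid roots i -> {subset zroots roots i <= roots}.
Proof. by move=> /allP h _ /mapP[j /h jr ->]; rewrite mem_nth. Qed.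

Lemma minus_valid : {subset zroots roots minus <= roots}.
Proof. by case/and5P: cC => _ _ /zroots_sub. Qed.

Lemma signs_sub e : e \in signs -> {subset e <= roots}.
Proof.
rewrite /signs; case: ifP => _; rewrite !inE; first by move/eqP->.
by case/orP => /eqP -> //; apply: minus_valid.
Qed.

Lemma minusE v : size minus != 0%N -> v \in <<map ph basis>>%VS ->
  W (zroots roots minus) v = - v.
Proof.
move=> m0; case/and5P: cC => _ _ _ + _; rewrite (negPf m0) /= => /allP h.
move=> vB; rewrite (coord_span (vB : v \in <<in_tuple (map ph basis)>>%VS)).
rewrite linear_sum -sumrN; apply: eq_bigr => i _ /=.
rewrite linearZ /= -scalerN; congr (_ *: _).
have : (map ph basis)`_i \in map ph basis by rewrite mem_nth.
case/mapP=> b bb ->.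
have [_ <-] := ph_word minus_valid (zmem_roots (basis_roots bb)).
by have /zeqbP -> := h b bb; rewrite phi_neg.
Qed.

Lemma W_span l v : v \in <<map ph basis>>%VS -> W l v \in <<map ph basis>>%VS.
Proof.
move=> vB; rewrite -[W l v](subrK v) rpredD //.
by apply: word_span; apply: sub_span.
Qed.

Lemma signs_comm e l v : e \in signs -> {subset l <= roots} ->
  W e (W l v) = W l (W e v).
Proof.
move=> eS lr; rewrite -!word_cat; congr (fun_of_lfun _ _).
have er := signs_sub eS; rewrite -!map_cat.
apply: (@eq_word_on _ _ dot (map ph basis)); try exact: sub_span;
  try by apply: ph_neq0; apply/sub_cat.
move=> b /memv_span bB; rewrite !map_cat !word_cat.
move: eS; rewrite /signs; case: ifPn => m0; rewrite !inE.
  by move/eqP->; rewrite !word_nil.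
case/orP=> /eqP ->; first by rewrite !word_nil.
by rewrite !minusE ?W_span // linearN.
Qed.

Lemma signsK e v : e \in signs -> W e (W e v) = v.
Proof.
move=> eS; rewrite -word_cat -{2}[v](word_nil dot); congr (fun_of_lfun _ _).
have er := signs_sub eS; rewrite -!map_cat.
apply: (@eq_word_on _ _ dot (map ph basis)) => //; try exact: sub_span;
  try by apply: ph_neq0; apply/sub_cat.
move=> b /memv_span bB; rewrite !map_cat !word_cat.
move: eS; rewrite /signs; case: ifPn => m0; rewrite !inE.
  by move/eqP->; rewrite !word_nil.
case/orP=> /eqP ->; first by rewrite !word_nil.
by rewrite !minusE ?rpredN // opprK word_nil.
Qed.

Lemma zeqNw_sound s t v : size minus != 0%N ->
  {subset s <= roots} -> {subset t <= roots} ->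
  zeqNw w basis s t -> W s v = W (zroots roots minus) (W t v).
Proof.
move=> m0 sr tr /allP e; rewrite -word_cat; congr (fun_of_lfun _ _).
rewrite -map_cat; apply: (@eq_word_on _ _ dot (map ph basis));
  try exact: sub_span; try exact: ph_neq0.
  by apply: ph_neq0; apply/sub_cat; split=> //; apply: minus_valid.
move=> _ /mapP[b bb ->]; have br := zmem_roots (basis_roots bb).
rewrite map_cat word_cat minusE ?W_span ?ph_span //.
have [_ <-] := ph_word sr br; have [_ <-] := ph_word tr br.
by have /zeqbP -> := e b bb; rewrite phi_neg.
Qed.

Lemma nil_signs : [::] \in signs.
Proof. by rewrite /signs; case: ifP; rewrite inE eqxx. Qed.

Lemma minus_signs : size minus != 0%N -> zroots roots minus \in signs.
Proof. by rewrite /signs => /negPf ->; rewrite !inE eqxx orbT. Qed.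

Local Notation rep j := (zroots roots (cd_rep (nth no_class cl j))).

Definition step_ok s x := exists c' h e,
  [/\ (c' < size cl)%N, {subset h <= roots}, e \in signs
    & forall v, rf (ph x) (W s (W h v)) = W h (W (rep c') (W e v))].

Lemma class_checked c : (c < size cl)%N ->
  check_class w roots basis minus cl (nth no_class cl c).
Proof. by case/and5P: cC => _ _ _ _ /all_nthP; apply. Qed.

Lemma rep_valid c : (c < size cl)%N -> {subset rep c <= roots}.
Proof. by move=> /class_checked/and5P[/zroots_sub]. Qed.

(** If [g] commutes with [c], applying [g] to [s_x c h = h c'] gives the same relation for the root
    [g x], with [g h] in place of [h]. *)
Lemma zorbit_step_ok c gens : (forall g, g \in gens -> {subset g <= roots} /\
    forall v, W g (W c v) = W c (W g v)) ->
  forall fuel seen todo,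
  (forall x, x \in seen -> step_ok c x) ->
  (forall x, x \in todo -> zmem x roots /\ step_ok c x) ->
  forall x, x \in zorbit w gens fuel seen todo -> step_ok c x.
Proof.
move=> gensP; elim=> [|n IHn] seen [|x todo] //= sP tP.
have [xr xP] := tP x (mem_head x todo).
have tP' y : y \in todo -> zmem y roots /\ step_ok c y.
  by move=> yt; apply: tP; rewrite inE yt orbT.
case: ifP => _; apply: IHn => // y; first by rewrite inE => /predU1P[->|/sP].
rewrite mem_cat => /orP[/mapP[g gg ->]|/tP'//].
have [gr gc] := gensP g gg; have [m e] := ph_word gr xr; split=> //.
have [c' [h [s [c'P hr sS hP]]]] := xP.
exists c', (g ++ h), s; split=> // [|v]; first exact/sub_cat.
by rewrite e map_cat !word_cat -gc -word_conj ?ph_neq0 // hP.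
Qed.

Lemma class_step_ok c x : (c < size cl)%N -> x \in roots -> step_ok (rep c) x.
Proof.
move=> /class_checked; set d := nth no_class cl c => + xr.
case/and5P=> /zroots_sub rr iv /allP cv _ /and3P[/allP com /allP st /allP cov].
have gensP g : g \in zroots roots (cd_rep d) :: map (zroots roots) (cd_cent d) ->
    {subset g <= roots} /\ forall v, W g (W (zroots roots (cd_rep d)) v)
                                     = W (zroots roots (cd_rep d)) (W g v).
  move=> gg; have gr : {subset g <= roots}.
    by move: gg; rewrite inE => /predU1P[->//|/mapP[i /cv/zroots_sub ir ->]].
  split=> // v; rewrite -!word_cat -!map_cat.
  by rewrite (zeqw_sound _ _ (com g gg)) //; apply/sub_cat.
have seedP y : y \in zroots roots [seq p.1.1 | p <- cd_step d] ->
    zmem y roots /\ step_ok (zroots roots (cd_rep d)) y.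
  case/mapP=> _ /mapP[p pd ->] ->; case/and4P: (st p pd) => p1 c'P p3 p4.
  have hr := zroots_sub p3; have yr := mem_nth [::] p1.
  split; first exact: zmem_roots.
  have t1r : {subset nth [::] roots p.1.1 :: zroots roots (cd_rep d) ++ zroots roots p.2
                <= roots} by apply/sub_cons; split=> //; apply/sub_cat.
  have t2r : {subset zroots roots p.2 ++ zroots roots (cd_rep (nth no_class cl p.1.2))
                <= roots} by apply/sub_cat; split=> //; apply: rep_valid.
  have E v : rf (ph (nth [::] roots p.1.1))
      (W (zroots roots (cd_rep d)) (W (zroots roots p.2) v))
      = W (nth [::] roots p.1.1 :: zroots roots (cd_rep d) ++ zroots roots p.2) v.
    by rewrite map_cons word_cons map_cat word_cat.
  case/orP: p4 => [e|/andP[m0 e]].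
    exists p.1.2, (zroots roots p.2), [::].
    split; rewrite ?nil_signs // => v.
    by rewrite E (zeqw_sound _ _ e) // map_cat word_cat word_nil.
  exists p.1.2, (zroots roots p.2), (zroots roots minus).
  split; rewrite ?minus_signs // => v.
  rewrite E (zeqNw_sound _ _ _ _ e) // signs_comm ?minus_signs // map_cat word_cat.
  by [].
move: (cov x xr); set orb := zorbit _ _ _ _ _.
have orbP y : y \in orb -> step_ok (zroots roots (cd_rep d)) y.
  exact: zorbit_step_ok.
case/zmemP=> [/orbP//|/orbP[c' [h [e [? ? ? hP]]]]].
exists c', h, e; split=> // v.
by rewrite -hP phi_neg rfN.
Qed.

(** Induction on the word. If the shorter word is [h r h^-1] up to sign, then multiplying it by
    [s_a] gives [h (s_x r) h^-1] up to sign, where [x = h^-1 a], and the certificate conjugates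
    [s_x r] to a representative. That the list meets all classes up to sign is thus a consequence of
    its stability. *)
Lemma conj_rep l : {subset l <= roots} -> exists c h e,
  [/\ (c < size cl)%N, {subset h <= roots}, e \in signs
    & forall v, W l (W h v) = W h (W (rep c) (W e v))].
Proof.
elim: l => [_|a l IHl].
  case/and5P: cC => /nilP e0 cl0 _ _ _.
  by exists 0%N, [::], [::]; split; rewrite ?nil_signs // => v; rewrite e0 !word_nil.
move=> /sub_cons[ar /IHl[c [h [e [cP hr eS lP]]]]].
have rh : {subset rev h <= roots} by move=> x; rewrite mem_rev => /hr.
have [xr xE] := ph_word rh (zmem_roots ar).
have h0 := ph_neq0 hr.
have {xr xE}[x [xr xE]] : exists x, x \in roots /\ rf (ph x) = rf (W (rev h) (ph a)).
  case/zmemP: xr => xr; first by exists (zword w (rev h) a); rewrite xE.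
  by exists (zneg (zword w (rev h) a)); rewrite phi_neg rfN xE.
have [c' [h' [e' [c'P h'r e'S xP]]]] := class_step_ok cP xr.
have [e'' e''S eE] : exists2 e'', e'' \in signs &
    forall v, W e' (W e v) = W e'' v.
  move: eS e'S; rewrite /signs; case: ifPn => m0; rewrite !inE.
    by move=> /eqP-> /eqP->; exists [::]; rewrite ?inE // => v; rewrite word_nil.
  case/orP=> /eqP ->; case/orP=> /eqP ->.
  - by exists [::]; rewrite ?inE // => v; rewrite word_nil.
  - by exists (zroots roots minus); rewrite ?inE ?eqxx ?orbT // => v; rewrite word_nil.
  - by exists (zroots roots minus); rewrite ?inE ?eqxx ?orbT // => v; rewrite word_nil.
  - by exists [::]; rewrite ?inE // => v; rewrite word_nil signsK // minus_signs.
exists c', (h ++ h'), e''; split=> // [|v]; first exact/sub_cat.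
rewrite map_cons word_cons !map_cat !word_cat lP (signs_comm _ eS h'r).
rewrite -{1}(word_revKV dot (ph a) h0) -word_conj //.
by congr (W h _); rewrite -map_rev -xE xP -eE.
Qed.

Theorem ambivalent_check : ambivalent dot (map ph roots).
Proof.
move=> s sM.
have [l lr ->] : exists2 l, {subset l <= roots} & s = map ph l.
  elim: s sM => [|v s IHs]; first by exists [::].
  move=> /sub_cons[/mapP[x xr ->] /IHs[l lr ->]].
  by exists (x :: l) => //; apply/sub_cons.
have [c [h [e [cP hr eS lP]]]] := conj_rep lr.
have h0 := ph_neq0 hr; have cr := rep_valid cP.
have := class_checked cP; set d := nth no_class cl c in cr lP *.
case/and5P => _ /zroots_sub ir _ ie _.
have iP v : W (zroots roots (cd_rep d)) (W (zroots roots (cd_inv d))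
    (W (zroots roots (cd_rep d)) v))
    = W (zroots roots (cd_inv d)) v.
  have rir : {subset zroots roots (cd_rep d) ++ zroots roots (cd_inv d) ++
      zroots roots (cd_rep d) <= roots} by apply/sub_cat; split=> //; apply/sub_cat.
  by rewrite -[in RHS](zeqw_sound rir ir ie) !map_cat !word_cat.
have rh : {subset rev h <= roots} by move=> x; rewrite mem_rev => /hr.
(* The inverting element of the representative is conjugated by [h]. The sign [e] commutes with
   everything and has square one, so it cancels. *)
exists (map ph (h ++ zroots roots (cd_inv d) ++ rev h)).
  move=> _ /mapP[x + ->]; rewrite !mem_cat => /or3P[/hr|/ir|/rh] xr; exact: map_f.
move=> v; rewrite !map_cat !word_cat lP map_rev.
have -> : W l v = W h (W (zroots roots (cd_rep d)) (W e (word dot (rev (map ph h)) v))).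
  by rewrite -lP word_revKV.
rewrite word_revK //; congr (W h _).
by rewrite (signs_comm _ eS ir) (signs_comm _ eS cr) signsK // iP.
Qed.

End SoundCheck.

(** * Root lists and certificates of the exceptional types *)

Fixpoint zsigns (k : nat) : seq (seq Z) :=
  if k is k'.+1 then map (cons 1%ZZ) (zsigns k') ++ map (cons (-1)%ZZ) (zsigns k')
  else [:: [::]].

Definition zeven (s : seq Z) : bool := Z.eqb (foldr Z.mul 1%ZZ s) 1.

(** The roots [e i + e j] and [e i - e j] for [i < j]. Coordinates refer to halves of frame vectors,
    so that spin weights have coordinates 1 and -1; this explains the entries 2. *)
Fixpoint zpairs (k : nat) : seq (seq Z) :=
  if k is k'.+1 then
    [seq 2%ZZ :: map (Z.mul b) u | u <- zunits k', b <- [:: 2; -2]%ZZ]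
    ++ map (cons 0%ZZ) (zpairs k')
  else [::].

(* [coefs] expresses multiples of the unit vectors in the basis; [minus] is a word
   for -1, empty when -1 is not in the group. The class lists come from a computer
   search. *)
Definition weightsG2 : seq Z := [:: 1; 3]%ZZ.
Definition rootsG2 : seq (seq Z) :=
  [:: [:: 2; 0]; [:: 1; 1]; [:: 1; -1]; [:: 0; 2]; [:: 3; 1]; [:: 3; -1]]%ZZ.
Definition basisG2 : seq (seq Z) := zroots rootsG2 [:: 0; 1]%N.
Definition coefsG2 : seq (Z * seq Z) :=
  [:: (2, [:: 1; 0]); (2, [:: (-1); 2])]%ZZ.
Definition minusG2 : seq nat := [:: 0; 3]%N.
Definition classesG2 : seq class_data := [::
  ClassData [::] [:: 2] [:: [:: 2]; [:: 3]] [:: (0, 1, [::]); (3, 1, [::])];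
  ClassData [:: 0] [:: 3] [::] [:: (0, 0, [::]); (1, 2, [::]); (3, 0, [::]); (4, 2, [:: 4])];
  ClassData [:: 1; 0] [:: 1] [::] [:: (0, 1, [:: 1]); (3, 1, [:: 1])]]%N.
Lemma checkG2 :
  [&& check_roots weightsG2 rootsG2, check_basis weightsG2 rootsG2 basisG2 coefsG2
    & check_classes weightsG2 rootsG2 basisG2 minusG2 classesG2].
Proof. by vm_compute. Qed.

Definition weightsF4 : seq Z := [:: 1; 1; 1; 1]%ZZ.
Definition rootsF4 : seq (seq Z) :=
  zpairs 4 ++ map (map (Z.mul 2)) (zunits 4) ++ map (cons 1%ZZ) (zsigns 3).
Definition basisF4 : seq (seq Z) := zroots rootsF4 [:: 0; 1; 2; 4]%N.
Definition coefsF4 : seq (Z * seq Z) :=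
  [:: (4, [:: 1; 1; 0; 0]); (4, [:: 1; (-1); 0; 0]); (4, [:: (-1); (-1); 2; 0]); (4, [:: (-1);
  (-1); 0; 2])]%ZZ.
Definition minusF4 : seq nat := [:: 0; 1; 10; 11]%N.
Definition classesF4 : seq class_data := [::
  ClassData [::] [:: 15; 16] [:: [:: 0; 2; 13]; [:: 0; 6; 19]] [:: (0, 1, [::]); (12, 2, [::])];
  ClassData [:: 0] [:: 10; 15] [:: [:: 14]; [:: 20]; [:: 23]] [:: (0, 0, [::]); (1, 3, [::]);
  (2, 4, [::]); (12, 5, [::]); (14, 6, [::])];
  ClassData [:: 12] [:: 15] [:: [:: 8]; [:: 6; 10]] [:: (0, 5, [:: 1]); (6, 6, [:: 2; 8; 9]);
  (12, 0, [::]); (13, 3, [::]); (16, 7, [::])];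
  ClassData [:: 1; 0] [:: 0; 10; 15] [:: [:: 10; 15]; [:: 0; 4; 5]] [:: (0, 1, [:: 10; 12; 21]);
  (2, 8, [::]); (10, 1, [:: 13; 17]); (12, 2, [:: 0; 6; 15]); (14, 2, [:: 3; 4]); (16, 9, [::])];
  ClassData [:: 2; 0] [:: 2] [:: [:: 0; 4; 12; 17]] [:: (0, 1, [:: 1; 6; 20]); (1, 8, [:: 1;
  15]); (12, 10, [::]); (15, 10, [:: 0; 3])];
  ClassData [:: 12; 0] [:: 10; 13] [:: [:: 10; 14]] [:: (0, 2, [:: 0]); (2, 10, [:: 14]); (10,
  9, [:: 0; 11; 20]); (12, 1, [::]); (14, 8, [:: 0; 7]); (16, 11, [::])];
  ClassData [:: 14; 0] [:: 0] [:: [:: 14]; [:: 1]] [:: (0, 2, [:: 3; 9]); (1, 2, [:: 2; 4]); (2,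
  10, [::]); (4, 10, [:: 1; 3; 4]); (10, 9, [:: 13; 18]); (12, 8, [:: 6; 15]); (14, 1, [::]);
  (15, 1, [:: 10; 12]); (16, 11, [:: 1; 14; 21]); (20, 11, [:: 1; 10; 18])];
  ClassData [:: 16; 12] [:: 7; 12] [:: [:: 9; 12; 23]; [:: 0; 13; 20]] [:: (0, 11, [:: 12; 16]);
  (7, 11, [:: 6; 9]); (12, 2, [:: 1; 5; 19]); (13, 9, [:: 10; 12])];
  ClassData [:: 2; 1; 0] [:: 3; 13] [:: [:: 15]] [:: (0, 4, [:: 0; 13]); (2, 3, [::]); (4, 4,
  [:: 19]); (8, 12, [::]); (12, 6, [:: 7; 12]); (13, 5, [:: 6; 10; 11]); (15, 5, [:: 0; 3]);
  (16, 13, [::])];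
  ClassData [:: 16; 1; 0] [:: 0; 11] [:: [:: 1]] [:: (0, 6, [:: 13; 21]); (1, 5, [:: 14; 21]);
  (2, 13, [:: 1; 11]); (11, 5, [:: 0; 23]); (12, 7, [:: 0; 12]); (14, 7, [:: 6; 10; 21]); (16,
  3, [::]); (21, 12, [::])];
  ClassData [:: 12; 2; 0] [:: 1] [::] [:: (0, 5, [:: 3]); (1, 6, [:: 0; 7]); (4, 13, [:: 4; 5;
  18]); (12, 4, [::]); (15, 4, [:: 3; 5; 16]); (16, 14, [::]); (18, 15, [::])];
  ClassData [:: 16; 12; 0] [:: 12] [::] [:: (0, 7, [:: 11; 12; 19]); (2, 14, [:: 3; 5]); (6, 15,
  [:: 4; 18]); (11, 7, [:: 4; 14; 22]); (12, 6, [:: 10; 22]); (13, 5, [:: 15; 17]); (14, 13, [::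
  4; 14; 16])];
  ClassData [:: 8; 2; 1; 0] [:: 0; 4; 12; 22] [:: [:: 0; 6; 7; 10]; [:: 0; 9; 14; 23]] [:: (0,
  8, [:: 5; 17]); (12, 9, [:: 5; 14; 23])];
  ClassData [:: 16; 2; 1; 0] [:: 9; 21] [::] [:: (0, 10, [:: 7; 15; 16]); (2, 9, [:: 8; 9]); (5,
  10, [:: 0; 2; 20]); (12, 11, [:: 2; 5; 14]); (14, 11, [:: 7; 17]); (16, 8, [::])];
  ClassData [:: 16; 12; 2; 0] [:: 5; 14] [::] [:: (0, 11, [:: 0; 7]); (1, 11, [:: 6; 9]); (12,
  10, [:: 3; 11; 16]); (13, 10, [:: 15; 17])];
  ClassData [:: 18; 12; 2; 0] [:: 0; 14] [:: [:: 7; 10]; [:: 0; 1; 14; 19]] [:: (0, 11, [:: 2;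
  13]); (12, 10, [:: 0; 1; 20])]]%N.
Lemma checkF4 :
  [&& check_roots weightsF4 rootsF4, check_basis weightsF4 rootsF4 basisF4 coefsF4
    & check_classes weightsF4 rootsF4 basisF4 minusF4 classesF4].
Proof. by vm_compute. Qed.

(** The sixth axis is the part of a spin root orthogonal to the frame of five vectors. Its squared
    norm is 2 - 5/4 = 3/4, which is 3 in units of 1/4. *)
Definition weightsE6 : seq Z := [:: 1; 1; 1; 1; 1; 3]%ZZ.
Definition rootsE6 : seq (seq Z) :=
  map (rcons^~ 0%ZZ) (zpairs 5) ++ map (rcons^~ 1%ZZ) (filter zeven (zsigns 5)).
Definition basisE6 : seq (seq Z) := zroots rootsE6 [:: 0; 1; 2; 4; 6; 20]%N.
Definition coefsE6 : seq (Z * seq Z) :=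
  [:: (4, [:: 1; 1; 0; 0; 0; 0]); (4, [:: 1; (-1); 0; 0; 0; 0]); (4, [:: (-1); (-1); 2; 0; 0;
  0]); (4, [:: (-1); (-1); 0; 2; 0; 0]); (4, [:: (-1); (-1); 0; 0; 2; 0]); (4, [:: 1; 3; (-2);
  (-2); (-2); 4])]%ZZ.
Definition minusE6 : seq nat := [::]%N.
Definition classesE6 : seq class_data := [::
  ClassData [::] [:: 0; 1; 3; 19; 21] [:: [:: 3; 14; 19; 25]; [:: 2; 17; 26; 31]] [:: (0, 1,
  [::])];
  ClassData [:: 0] [:: 15; 16] [:: [:: 0; 1; 15; 27]; [:: 15; 24; 30]] [:: (0, 0, [::]); (1, 2,
  [::]); (2, 3, [::])];
  ClassData [:: 1; 0] [:: 1; 15; 17] [:: [:: 2; 3; 18]; [:: 8; 9; 15]; [:: 1; 18; 19]] [:: (0,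
  1, [:: 0; 8; 9; 15; 27]); (2, 4, [::]); (14, 5, [::]); (20, 6, [::])];
  ClassData [:: 2; 0] [:: 0] [:: [:: 18; 29]; [:: 0; 4; 5; 8; 19]] [:: (0, 1, [:: 1; 8; 14;
  29]); (1, 4, [:: 0; 4; 5]); (18, 6, [:: 0; 2; 27; 30])];
  ClassData [:: 2; 1; 0] [:: 2; 19] [:: [:: 10; 11; 18]] [:: (0, 3, [:: 0; 12; 13; 29]); (2, 2,
  [::]); (4, 7, [::]); (10, 8, [::]); (18, 9, [::]); (20, 10, [::])];
  ClassData [:: 14; 1; 0] [:: 20; 35] [:: [:: 15; 24; 31]; [:: 27; 28]; [:: 0; 12; 13; 24; 31]]
  [:: (0, 2, [:: 16; 22; 35]); (2, 7, [:: 18; 19; 22; 33]); (6, 9, [:: 17]); (15, 11, [::]);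
  (16, 12, [::])];
  ClassData [:: 20; 1; 0] [:: 0; 17] [:: [:: 15; 19]] [:: (0, 2, [:: 14; 15; 19; 22]); (1, 3,
  [:: 1; 30]); (2, 10, [:: 2; 3]); (14, 9, [:: 1; 15; 17; 26; 31]); (15, 12, [:: 17; 23; 34]);
  (27, 13, [::])];
  ClassData [:: 4; 2; 1; 0] [:: 2] [:: [:: 2; 5; 12; 13]; [:: 26; 29]] [:: (0, 4, [:: 1; 2; 24;
  31]); (2, 5, [:: 14; 16; 17]); (6, 14, [::]); (12, 15, [::])];
  ClassData [:: 10; 2; 1; 0] [:: 2; 10] [:: [:: 1; 25; 30]; [:: 2; 6; 7]] [:: (0, 4, [:: 1; 4;
  27; 28]); (6, 15, [:: 1; 6; 9; 11])];
  ClassData [:: 18; 2; 1; 0] [:: 2] [:: [:: 18; 19]; [:: 0; 1; 2]] [:: (0, 6, [:: 0; 5; 12; 21;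
  35]); (2, 5, [:: 17; 20; 35]); (4, 14, [:: 12; 13]); (10, 15, [:: 1; 3; 7]); (18, 4, [::]);
  (19, 16, [::]); (20, 17, [::]); (22, 18, [::])];
  ClassData [:: 20; 2; 1; 0] [:: 1; 32] [:: [:: 19]] [:: (0, 4, [:: 20]); (2, 6, [:: 2; 3]); (4,
  15, [:: 2; 14; 22; 33]); (5, 14, [:: 9; 16; 21; 32]); (18, 17, [:: 18; 19]); (19, 18, [:: 10;
  11; 19; 22])];
  ClassData [:: 15; 14; 1; 0] [:: 9; 26; 29] [:: [:: 1; 9; 26; 29]; [:: 1; 3; 27; 28]] [:: (0,
  5, [:: 12; 13; 25; 30]); (6, 16, [:: 11; 17])];
  ClassData [:: 16; 14; 1; 0] [:: 0; 14] [:: [:: 0; 8; 9; 15; 18]] [:: (0, 6, [:: 17; 21; 34]);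
  (2, 14, [:: 18; 19]); (14, 5, [:: 0; 16; 20; 35]); (15, 16, [:: 6; 9; 15]); (20, 18, [:: 0; 3;
  10; 17; 23]); (21, 19, [::])];
  ClassData [:: 27; 20; 1; 0] [:: 1; 32] [:: [:: 4; 25; 34]; [:: 15; 17]; [:: 0; 17; 20]] [::
  (0, 6, [:: 1; 9; 13; 21; 26]); (2, 17, [:: 1; 18; 31]); (15, 19, [:: 2; 10; 16; 32])];
  ClassData [:: 6; 4; 2; 1; 0] [:: 3; 18] [::] [:: (0, 10, [:: 1; 12; 25; 31]); (2, 12, [:: 15;
  18]); (3, 7, [:: 1; 12; 14; 21; 34]); (4, 9, [:: 10; 11]); (20, 20, [::]); (22, 21, [::])];
  ClassData [:: 12; 4; 2; 1; 0] [:: 13; 14] [::] [:: (0, 10, [:: 4; 17; 27; 28]); (2, 9, [:: 0;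
  15; 16]); (3, 8, [:: 7; 14; 21; 34]); (12, 7, [::]); (20, 21, [:: 9; 19; 24]); (22, 22, [::])];
  ClassData [:: 19; 18; 2; 1; 0] [:: 2; 11] [:: [:: 13]; [:: 18]; [:: 2; 14; 15]] [:: (0, 12,
  [:: 0; 5; 13]); (2, 11, [:: 2; 7; 25; 30]); (10, 9, [:: 12]); (20, 23, [::])];
  ClassData [:: 20; 18; 2; 1; 0] [:: 3; 20] [:: [:: 2; 3; 19; 20; 33]] [:: (0, 10, [:: 21]); (2,
  9, [:: 1; 2; 19; 31; 32]); (4, 21, [:: 12; 13; 33]); (8, 13, [:: 0; 1; 8; 18; 26]); (11, 22,
  [:: 1; 5; 9; 16]); (14, 20, [:: 2; 14; 15]); (19, 23, [::])];
  ClassData [:: 22; 18; 2; 1; 0] [:: 9; 18; 28] [::] [:: (0, 12, [:: 4; 9; 12; 26]); (1, 9, [::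
  1; 8; 34]); (4, 20, [:: 0; 8; 15; 18; 32]); (10, 21, [:: 2; 5; 20]); (18, 10, [:: 2; 16; 17]);
  (19, 23, [:: 12; 27])];
  ClassData [:: 21; 16; 14; 1; 0] [:: 16; 21] [:: [:: 0; 21]; [:: 15; 20; 35]] [:: (0, 12, [::
  0; 1; 14; 19; 33]); (1, 13, [:: 7; 9; 11; 22]); (2, 20, [:: 4; 16]); (15, 23, [:: 3; 6; 15]);
  (26, 24, [::])];
  ClassData [:: 20; 6; 4; 2; 1; 0] [:: 5; 12; 13] [::] [:: (0, 14, [:: 20]); (1, 17, [:: 0; 3;
  10; 11; 35]); (2, 18, [:: 14; 20; 33]); (7, 19, [:: 2; 7; 15])];
  ClassData [:: 22; 6; 4; 2; 1; 0] [:: 6; 14; 22] [::] [:: (0, 17, [:: 0; 12; 13; 29]); (1, 15,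
  [:: 6; 9; 25]); (2, 18, [:: 0; 2; 12; 14; 35]); (3, 14, [:: 7; 9; 11; 20; 35])];
  ClassData [:: 22; 12; 4; 2; 1; 0] [:: 7; 25; 34] [:: [:: 0; 2; 5; 25]; [:: 12; 13; 22; 29]]
  [:: (0, 17, [:: 1; 6; 29]); (1, 15, [:: 9; 19; 23])];
  ClassData [:: 20; 19; 18; 2; 1; 0] [:: 2; 13; 27] [:: [:: 13]; [:: 16; 28; 35]] [:: (0, 18,
  [:: 2; 6; 7; 23]); (2, 16, [:: 11; 13; 20; 33]); (8, 19, [:: 7; 11; 22; 32]); (11, 17, [:: 14;
  29; 34])];
  ClassData [:: 26; 21; 16; 14; 1; 0] [:: 1; 3; 5; 12; 24] [:: [:: 8; 10; 11; 12]; [:: 0; 2; 5;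
  12; 13; 26]] [:: (0, 19, [:: 2; 11; 12; 25])]]%N.
Lemma checkE6 :
  [&& check_roots weightsE6 rootsE6, check_basis weightsE6 rootsE6 basisE6 coefsE6
    & check_classes weightsE6 rootsE6 basisE6 minusE6 classesE6].
Proof. by vm_compute. Qed.

(** The last axis has squared norm 2 - 6/4 = 2/4, hence weight 2, and carries one further root
    orthogonal to the roots of type D6. *)
Definition weightsE7 : seq Z := [:: 1; 1; 1; 1; 1; 1; 2]%ZZ.
Definition rootsE7 : seq (seq Z) :=
  map (rcons^~ 0%ZZ) (zpairs 6) ++ map (rcons^~ 1%ZZ) (filter zeven (zsigns 6))
  ++ [:: rcons (nseq 6 0%ZZ) 2%ZZ].
Definition basisE7 : seq (seq Z) := zroots rootsE7 [:: 0; 1; 2; 4; 6; 8; 30]%N.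
Definition coefsE7 : seq (Z * seq Z) :=
  [:: (4, [:: 1; 1; 0; 0; 0; 0; 0]); (4, [:: 1; (-1); 0; 0; 0; 0; 0]); (4, [:: (-1); (-1); 2; 0;
  0; 0; 0]); (4, [:: (-1); (-1); 0; 2; 0; 0; 0]); (4, [:: (-1); (-1); 0; 0; 2; 0; 0]); (4, [::
  (-1); (-1); 0; 0; 0; 2; 0]); (2, [:: 1; 2; (-1); (-1); (-1); (-1); 2])]%ZZ.
Definition minusE7 : seq nat := [:: 0; 1; 18; 19; 28; 29; 62]%N.
Definition classesE7 : seq class_data := [::
  ClassData [::] [:: 12; 14; 22; 32; 35] [:: [:: 5; 21; 29; 44; 51]; [:: 13; 22; 23; 34; 55]]
  [:: (0, 1, [::])];
  ClassData [:: 0] [:: 24; 28; 39; 50] [:: [:: 24; 26; 41]; [:: 0; 22; 23; 43; 53]] [:: (0, 0,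
  [::]); (1, 2, [::]); (2, 3, [::])];
  ClassData [:: 1; 0] [:: 14; 15; 29] [:: [:: 1; 19; 20]; [:: 2; 3; 25; 27]] [:: (0, 1, [:: 8;
  9; 18; 21; 43]); (2, 4, [::]); (18, 5, [::]); (30, 6, [::]); (62, 7, [::])];
  ClassData [:: 2; 0] [:: 4; 9; 33; 59] [:: [:: 0; 11; 26; 27; 43]; [:: 0; 2; 24; 45; 49]] [::
  (0, 1, [:: 2; 28; 38; 45; 47]); (1, 4, [:: 0; 3; 25; 27]); (24, 6, [:: 3; 4; 15; 33; 59])];
  ClassData [:: 2; 1; 0] [:: 2; 25; 26] [:: [:: 0; 1; 3; 28]; [:: 24; 28; 29; 62]] [:: (0, 3,
  [:: 4; 5; 21; 29; 39; 51]); (2, 2, [::]); (4, 8, [::]); (12, 9, [::]); (24, 10, [::]); (30,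
  11, [::]); (62, 12, [::])];
  ClassData [:: 18; 1; 0] [:: 18; 28] [:: [:: 0; 6; 7; 18]; [:: 19; 29; 45; 47]] [:: (0, 2, [::
  0; 1; 20; 32; 55]); (2, 8, [:: 3; 18; 62]); (6, 10, [:: 0; 1; 2; 6]); (19, 7, [:: 7; 17; 62]);
  (20, 13, [::]); (28, 5, [:: 1; 3; 12; 46; 53])];
  ClassData [:: 30; 1; 0] [:: 19; 54] [:: [:: 21]; [:: 0; 25; 27; 30]] [:: (0, 2, [:: 18; 19;
  21; 29; 32]); (1, 3, [:: 25; 43; 49; 50]); (2, 11, [:: 1; 50]); (18, 10, [:: 0; 2; 4; 6; 30;
  45]); (19, 13, [:: 18; 24; 26; 35; 54]); (37, 12, [:: 11; 14; 35; 44]); (41, 14, [::])];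
  ClassData [:: 62; 1; 0] [:: 10; 11; 26; 27] [:: [:: 26; 48; 51]; [:: 0; 4; 5; 25; 62]] [:: (0,
  2, [:: 0; 25; 33; 34]); (2, 12, [::]); (18, 5, [:: 2; 3; 6; 16; 62])];
  ClassData [:: 4; 2; 1; 0] [:: 18; 35; 57] [:: [:: 1; 18; 33; 59]; [:: 2; 5; 14; 15; 28; 62]]
  [:: (0, 4, [:: 1; 2; 28; 39; 53]); (2, 5, [:: 1; 26; 27; 62]); (6, 15, [::]); (14, 16, [::]);
  (28, 13, [:: 7; 16; 49; 50])];
  ClassData [:: 12; 2; 1; 0] [:: 0; 1; 29; 62] [:: [:: 12; 24; 25; 28]; [:: 4; 28; 35; 57]] [::
  (0, 4, [:: 1; 4; 29; 45; 47]); (6, 16, [:: 25; 62]); (28, 17, [::])];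
  ClassData [:: 24; 2; 1; 0] [:: 2; 25] [:: [:: 16; 17; 62]; [:: 25; 62]] [:: (0, 6, [:: 10; 45;
  50]); (2, 5, [:: 0; 1; 21; 62]); (4, 15, [:: 3; 5; 7]); (8, 13, [:: 6; 10; 12; 54; 61]); (12,
  16, [:: 0; 18; 25]); (16, 17, [:: 0; 18; 22]); (24, 4, [::]); (25, 12, [:: 0; 1; 17; 24; 62]);
  (26, 18, [::]); (30, 19, [::]); (31, 20, [::]); (62, 10, [:: 16; 18; 19])];
  ClassData [:: 30; 2; 1; 0] [:: 10; 11] [:: [:: 25; 29]] [:: (0, 4, [:: 2; 3; 25; 29; 50]); (2,
  6, [:: 10; 11; 19; 21; 29; 30]); (4, 16, [:: 14; 17; 43; 56]); (5, 15, [:: 0; 6; 12; 33; 42]);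
  (24, 19, [:: 24; 25]); (25, 20, [:: 2; 18; 19; 43; 48]); (37, 21, [::])];
  ClassData [:: 62; 2; 1; 0] [:: 3; 26; 62] [:: [:: 16; 17; 25]; [:: 25; 27]] [:: (0, 6, [:: 10;
  23; 46; 53]); (2, 7, [::]); (4, 13, [:: 1; 8; 15]); (12, 17, [:: 0; 11; 26; 27; 43; 49]); (24,
  10, [:: 4; 5; 16]); (30, 21, [:: 1; 2; 20; 39; 44]); (62, 4, [::])];
  ClassData [:: 20; 18; 1; 0] [:: 19; 28; 29] [:: [:: 16; 17; 62]; [:: 0; 8; 9]] [:: (0, 6, [::
  1; 24; 26; 34; 55]); (2, 15, [:: 5; 21]); (8, 18, [:: 2; 8; 20; 21]); (18, 5, [:: 19; 24;
  62]); (19, 12, [:: 0; 1; 5; 10; 16; 20]); (22, 10, [:: 5; 15; 22; 42; 46]); (30, 20, [:: 4; 8;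
  15; 36; 39]); (33, 22, [::]); (62, 8, [:: 0; 7; 17; 43; 49])];
  ClassData [:: 41; 30; 1; 0] [:: 25; 27; 30; 41] [:: [:: 1; 27; 41]; [:: 0; 12; 13; 25; 26;
  49]] [:: (0, 6, [:: 0; 4; 40; 55]); (2, 21, [:: 0; 3; 30; 41]); (4, 19, [:: 1; 19; 24; 28;
  53]); (18, 18, [:: 23; 24; 45; 52]); (25, 22, [:: 0; 16; 17; 18; 38; 51])];
  ClassData [:: 6; 4; 2; 1; 0] [:: 8; 9; 21] [:: [:: 62]] [:: (0, 11, [:: 21; 28; 32; 58]); (2,
  13, [:: 0; 2; 3; 18; 20]); (3, 8, [:: 6; 29; 42; 48]); (4, 10, [:: 12; 13; 25; 62]); (8, 20,
  [:: 0; 4; 11; 30; 58]); (16, 23, [::]); (30, 24, [::]); (32, 25, [::]); (62, 15, [:: 4; 5;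
  17])];
  ClassData [:: 14; 4; 2; 1; 0] [:: 0; 1; 19] [:: [:: 14; 28; 29]] [:: (0, 11, [:: 2; 4; 21; 45;
  48]); (2, 10, [:: 1; 2; 5; 7]); (3, 9, [:: 6; 10; 13; 22; 23]); (8, 23, [:: 29; 62]); (14, 8,
  [::]); (16, 22, [:: 6; 7; 10; 13; 39; 44]); (30, 25, [:: 16; 17; 25; 31]); (34, 26, [::]);
  (62, 18, [:: 0; 3; 6; 13; 17])];
  ClassData [:: 28; 12; 2; 1; 0] [:: 0; 19] [:: [:: 1; 19; 62]; [:: 0; 1; 2; 12; 29]; [:: 0; 2;
  19; 45; 47]] [:: (0, 10, [:: 1; 4; 27; 43; 47]); (4, 12, [:: 0; 13; 24; 33; 60]); (6, 23, [::
  2; 20; 27; 62]); (28, 9, [::]); (29, 17, [:: 0; 42; 48]); (32, 18, [:: 10; 14; 18; 40; 59])];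
  ClassData [:: 26; 24; 2; 1; 0] [:: 3; 24] [:: [:: 62]] [:: (0, 14, [:: 2; 20; 27; 45; 47]);
  (2, 13, [:: 20; 21; 23; 62]); (4, 20, [:: 0; 5; 8; 24; 45; 49]); (12, 23, [:: 8; 10; 12; 13]);
  (24, 10, [:: 12; 13; 26]); (25, 17, [:: 0; 9; 11; 24; 30; 60]); (30, 27, [::]); (31, 28,
  [::]); (62, 16, [:: 0; 9; 10; 11; 19; 25])];
  ClassData [:: 30; 24; 2; 1; 0] [:: 2; 25; 45] [:: [:: 8; 34; 41]] [:: (0, 11, [:: 0; 10; 11;
  53; 54]); (2, 10, [:: 0; 30; 57]); (4, 25, [:: 0; 18; 28; 40; 50]); (8, 22, [:: 11; 29; 38;
  48]); (9, 20, [:: 4; 5; 10; 22; 48]); (10, 14, [:: 10; 37; 58]); (13, 26, [:: 0; 19; 30; 62]);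
  (16, 23, [:: 0; 5; 26; 33; 43]); (18, 24, [:: 0; 4; 14; 53; 54]); (25, 21, [:: 1; 2; 19; 28;
  47; 52]); (26, 27, [:: 24; 26])];
  ClassData [:: 31; 24; 2; 1; 0] [:: 1; 55] [::] [:: (0, 10, [:: 24; 25; 32]); (2, 13, [:: 0; 6;
  7; 22; 36; 59]); (4, 25, [:: 28; 29; 43; 48]); (5, 24, [:: 0; 8; 9; 18; 20; 50]); (8, 15, [::
  0; 9; 13; 21; 33; 46]); (9, 18, [:: 2; 7; 12; 22; 41; 42]); (24, 11, [:: 0; 10; 11; 28; 29;
  54]); (25, 21, [:: 0; 1; 12; 15; 17; 30]); (26, 28, [::]); (27, 27, [:: 2; 8; 15; 18; 31]);
  (36, 19, [:: 13; 28; 32; 39; 50])];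
  ClassData [:: 37; 30; 2; 1; 0] [:: 1; 54; 61] [:: [:: 25]; [:: 27]] [:: (0, 12, [:: 25; 26;
  32]); (1, 11, [:: 10; 17; 53; 58]); (2, 14, [:: 10; 11; 27; 30]); (4, 23, [:: 2; 8; 14; 49;
  50]); (5, 20, [:: 5; 11; 26; 36; 55]); (12, 22, [:: 10; 12; 36; 38; 47]); (25, 19, [:: 1; 10;
  17; 30; 41])];
  ClassData [:: 33; 20; 18; 1; 0] [:: 1; 25; 33] [:: [:: 1; 18; 25]; [:: 22; 31; 56]] [:: (0,
  13, [:: 2; 3; 18; 21; 50]); (1, 14, [:: 7; 13; 23; 33]); (2, 24, [:: 2; 3; 13; 33]); (8, 28,
  [:: 10; 11; 19; 20; 23; 62]); (19, 21, [:: 1; 28; 33; 43; 52]); (22, 19, [:: 3; 12; 17; 20;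
  58]); (23, 16, [:: 0; 1; 11; 18; 53; 56]); (42, 29, [::])];
  ClassData [:: 16; 6; 4; 2; 1; 0] [:: 12; 13; 20] [:: [:: 16; 17]] [:: (0, 21, [:: 2; 4; 7; 34;
  55]); (2, 18, [:: 1; 20; 21; 23]); (3, 16, [:: 2; 5; 21; 29]); (4, 17, [:: 2; 6; 7; 27; 62]);
  (8, 19, [:: 3; 8; 14; 18; 31; 59]); (16, 15, [::]); (30, 27, [:: 0; 2; 17; 20; 32; 42]); (32,
  28, [:: 4; 7; 10; 23; 54]); (62, 23, [:: 4; 5; 16])];
  ClassData [:: 30; 6; 4; 2; 1; 0] [:: 0; 25; 50] [::] [:: (0, 15, [:: 2; 3; 24; 25; 53]); (1,
  19, [:: 13; 16; 37; 46; 60]); (2, 20, [:: 1; 26; 27; 37; 58]); (7, 22, [:: 2; 7; 30; 60]); (8,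
  27, [:: 1; 4; 8; 20; 21; 49]); (9, 25, [:: 3; 21; 37; 38; 50]); (22, 24, [:: 1; 7; 12; 32;
  60])];
  ClassData [:: 32; 6; 4; 2; 1; 0] [:: 6; 18; 43] [::] [:: (0, 16, [:: 9; 18; 33; 42; 52]); (2,
  20, [:: 3; 15; 19; 32; 55]); (4, 19, [:: 2; 18; 19; 25; 45; 46]); (8, 27, [:: 1; 6; 16; 46;
  53]); (9, 28, [:: 15; 17; 19; 39; 53]); (13, 15, [:: 0; 2; 22; 23; 30]); (23, 24, [:: 3; 8;
  14; 18; 51])];
  ClassData [:: 34; 14; 4; 2; 1; 0] [:: 4; 20; 41] [:: [:: 2; 18; 21; 44]; [:: 1; 3; 25; 31]]
  [:: (0, 16, [:: 2; 18; 21; 44]); (2, 19, [:: 0; 16; 17; 18; 20; 30; 57]); (8, 28, [:: 1; 11;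
  13; 27; 43; 54]); (17, 29, [:: 0; 3; 12; 32; 60])];
  ClassData [:: 30; 26; 24; 2; 1; 0] [:: 1; 33; 54] [::] [:: (0, 19, [:: 32]); (2, 20, [:: 0;
  25; 28; 33; 54]); (4, 27, [:: 10; 17; 19; 24; 38; 50]); (5, 24, [:: 0; 1; 16; 61]); (6, 28,
  [:: 3; 15; 22; 45; 47]); (9, 27, [:: 36; 39; 58]); (10, 18, [:: 4; 14; 22; 48]); (18, 25, [::
  15; 18; 36; 51]); (25, 23, [:: 11; 21; 44; 48])];
  ClassData [:: 31; 26; 24; 2; 1; 0] [:: 10; 11; 26] [::] [:: (0, 18, [:: 0; 1; 3; 43]); (2, 22,
  [:: 12; 13; 22; 57]); (4, 27, [:: 11; 16; 18; 20; 37; 50]); (5, 25, [:: 24; 26; 36; 38; 51]);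
  (24, 20, [:: 26]); (25, 23, [:: 0; 3; 41; 48]); (36, 26, [:: 0; 10; 14; 15; 29; 60])];
  ClassData [:: 42; 33; 20; 18; 1; 0] [:: 0; 2; 25; 30; 60] [:: [:: 1; 4; 10; 60]; [:: 2; 18;
  25; 39]] [:: (0, 22, [:: 3; 4; 30; 53]); (8, 26, [:: 1; 2; 4; 7; 16; 56])]]%N.
Lemma checkE7 :
  [&& check_roots weightsE7 rootsE7, check_basis weightsE7 rootsE7 basisE7 coefsE7
    & check_classes weightsE7 rootsE7 basisE7 minusE7 classesE7].
Proof. by vm_compute. Qed.

(** Eight frame vectors already span the spin roots, so there is no extra axis. Fixing the first
    sign to be 1 keeps one spin root of each opposite pair. *)
Definition weightsE8 : seq Z := [:: 1; 1; 1; 1; 1; 1; 1; 1]%ZZ.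
Definition rootsE8 : seq (seq Z) :=
  zpairs 8 ++ map (cons 1%ZZ) (filter zeven (zsigns 7)).
Definition basisE8 : seq (seq Z) := zroots rootsE8 [:: 0; 1; 2; 4; 6; 8; 10; 12]%N.
Definition coefsE8 : seq (Z * seq Z) :=
  [:: (4, [:: 1; 1; 0; 0; 0; 0; 0; 0]); (4, [:: 1; (-1); 0; 0; 0; 0; 0; 0]); (4, [:: (-1); (-1);
  2; 0; 0; 0; 0; 0]); (4, [:: (-1); (-1); 0; 2; 0; 0; 0; 0]); (4, [:: (-1); (-1); 0; 0; 2; 0; 0;
  0]); (4, [:: (-1); (-1); 0; 0; 0; 2; 0; 0]); (4, [:: (-1); (-1); 0; 0; 0; 0; 2; 0]); (4, [::
  (-1); (-1); 0; 0; 0; 0; 0; 2])]%ZZ.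
Definition minusE8 : seq nat := [:: 0; 1; 26; 27; 44; 45; 54; 55]%N.
Definition classesE8 : seq class_data := [::
  ClassData [::] [:: 7; 15; 22; 90] [:: [:: 16; 32; 45; 72; 86; 113]; [:: 7; 12; 17; 47; 56;
  116]] [:: (0, 1, [::])];
  ClassData [:: 0] [:: 29; 32; 93; 110; 115] [:: [:: 44; 46; 47; 54; 97]; [:: 0; 32; 39; 48;
  110]] [:: (0, 0, [::]); (1, 2, [::]); (2, 3, [::])];
  ClassData [:: 1; 0] [:: 24; 25; 27; 28; 31] [:: [:: 8; 9; 36; 51]; [:: 1; 27; 29; 47; 49]] [::
  (0, 1, [:: 2; 3; 39; 43; 98; 110; 113]); (2, 4, [::]); (26, 5, [::]); (56, 6, [::])];
  ClassData [:: 2; 0] [:: 2; 44; 50; 109; 115] [:: [:: 39; 43; 108; 113]; [:: 36; 37; 43; 45;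
  105]] [:: (0, 1, [:: 1; 13; 50; 73; 86; 96]); (1, 4, [:: 1; 37; 44; 55]); (36, 6, [:: 1; 33;
  37; 39; 89; 112])];
  ClassData [:: 2; 1; 0] [:: 6; 7; 41; 43; 45] [:: [:: 22; 23; 36; 38; 49]; [:: 36; 38; 39; 46;
  55]] [:: (0, 3, [:: 12; 13; 20; 22; 74; 87]); (2, 2, [::]); (4, 7, [::]); (16, 8, [::]); (36,
  9, [::]); (56, 10, [::])];
  ClassData [:: 26; 1; 0] [:: 8; 9; 26; 46] [:: [:: 0; 8; 9; 49]; [:: 27; 45; 46; 58; 61]] [::
  (0, 2, [:: 10; 11; 31; 93; 104]); (2, 7, [:: 1; 4; 45; 48; 112; 119]); (6, 9, [:: 2; 7; 42;
  43; 50]); (27, 11, [::]); (28, 12, [::]); (44, 13, [::])];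
  ClassData [:: 56; 1; 0] [:: 1; 39; 51; 55; 87] [:: [:: 27; 41; 55]; [:: 0; 26; 28; 45; 48;
  50]] [:: (0, 2, [:: 28; 30; 41; 43; 76]); (1, 3, [:: 1; 39; 47; 103; 105; 114]); (2, 10, [::
  24; 25; 36; 50]); (26, 9, [:: 3; 7; 8; 50; 86; 90]); (27, 12, [:: 8; 9; 29; 93; 110]); (91,
  14, [::])];
  ClassData [:: 4; 2; 1; 0] [:: 17; 47; 49; 114; 117] [:: [:: 2; 26; 44; 107; 108]; [:: 20; 21;
  46; 49]] [:: (0, 4, [:: 0; 41; 54; 77; 82]); (2, 5, [:: 36; 37; 45; 47; 54]); (6, 15, [::]);
  (18, 16, [::]); (44, 17, [::])];
  ClassData [:: 16; 2; 1; 0] [:: 4; 5; 52] [:: [:: 0; 10; 11; 14; 27; 44; 54]; [:: 0; 1; 14; 47;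
  48; 72; 79]] [:: (0, 4, [:: 2; 27; 37; 52; 108; 119]); (6, 16, [:: 16; 36; 38; 39; 54]); (44,
  18, [::])];
  ClassData [:: 36; 2; 1; 0] [:: 32; 33; 53] [:: [:: 36; 50]; [:: 20; 21; 53]] [:: (0, 6, [:: 0;
  3; 29; 44; 49; 90; 93]); (2, 5, [:: 26; 36; 51]); (4, 15, [:: 4; 10; 11; 28]); (8, 17, [:: 3;
  18; 19; 26; 31; 55]); (16, 16, [:: 1; 14; 27; 36; 54]); (20, 18, [:: 5; 8; 28; 29; 74; 77]);
  (36, 4, [::]); (37, 19, [::]); (38, 20, [::]); (50, 21, [::]); (56, 22, [::]); (60, 23, [::])];
  ClassData [:: 56; 2; 1; 0] [:: 14; 15; 39; 55] [:: [:: 53]; [:: 0; 1; 34; 35; 36; 50]; [:: 39;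
  41]] [:: (0, 4, [:: 2; 3; 37; 40; 42; 94]); (2, 6, [:: 14; 15; 27; 41; 55; 87]); (4, 16, [::
  44; 45; 47; 72; 79]); (5, 15, [:: 4; 28; 35; 99; 112]); (36, 22, [:: 0; 1; 2; 53; 56]); (37,
  23, [:: 2; 26; 27; 50; 51; 108])];
  ClassData [:: 27; 26; 1; 0] [:: 3; 45; 49; 75; 76] [:: [:: 3; 20; 21; 115; 116]; [:: 14; 34;
  35; 44; 51]] [:: (0, 5, [:: 44; 45; 72; 79]); (6, 19, [:: 16; 24; 25; 29]); (44, 5, [:: 2; 12;
  22; 28; 39])];
  ClassData [:: 28; 26; 1; 0] [:: 29; 38; 39; 54] [:: [:: 0; 26; 28; 51; 52]; [:: 8; 9; 26; 37;
  54]] [:: (0, 6, [:: 27; 31; 33; 66; 75]); (2, 15, [:: 0; 1; 2; 4; 7]); (8, 20, [:: 2; 6; 7;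
  9]); (26, 5, [:: 28; 46; 52; 114; 117]); (27, 19, [:: 2; 5; 28; 30; 31; 53]); (30, 21, [:: 6;
  16; 51; 54; 60; 67]); (50, 17, [:: 2; 21; 24; 26; 37; 105; 110]); (56, 23, [:: 0; 2; 16; 28;
  50; 112]); (68, 24, [::])];
  ClassData [:: 44; 26; 1; 0] [:: 12; 13] [:: [:: 12; 13; 26]; [:: 0; 27; 82; 85]; [:: 82; 85;
  97; 104]] [:: (0, 5, [:: 45; 71; 78]); (2, 17, [:: 3; 17; 44; 115; 116]); (10, 21, [:: 16; 17;
  28; 33; 52; 53]); (27, 5, [:: 12; 15; 22; 27; 30; 37]); (32, 17, [:: 3; 23; 35; 36; 37; 59;
  60])];
  ClassData [:: 91; 56; 1; 0] [:: 20; 37; 55; 86; 117] [:: [:: 0; 70; 77; 83]; [:: 0; 24; 25;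
  27; 37; 50; 91]] [:: (0, 6, [:: 12; 13; 30; 90; 105; 118]); (2, 22, [:: 0; 36; 51; 55; 75]);
  (27, 24, [:: 0; 5; 15; 28; 56]); (30, 20, [:: 27; 93; 104])];
  ClassData [:: 6; 4; 2; 1; 0] [:: 4; 30; 31; 52] [:: [:: 20; 21; 52]; [:: 0; 1; 3; 4; 7; 51]]
  [:: (0, 10, [:: 0; 18; 19; 38; 46; 107; 118]); (2, 12, [:: 27; 36; 52; 53]); (3, 7, [:: 6; 54;
  73; 78]); (4, 9, [:: 16; 17; 51; 54]); (8, 25, [::]); (20, 26, [::]); (50, 27, [::]); (56, 28,
  [::]); (64, 29, [::])];
  ClassData [:: 18; 4; 2; 1; 0] [:: 18; 26; 51] [:: [:: 2; 4; 34; 35]; [:: 0; 1; 2; 4; 19; 51];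
  [:: 53]] [:: (0, 10, [:: 0; 1; 7; 51; 55; 91; 96]); (2, 9, [:: 1; 2; 7; 55]); (3, 8, [:: 0; 2;
  19; 55; 81; 86]); (8, 26, [:: 2; 12; 13; 27; 37; 39]); (18, 7, [::]); (20, 30, [::]); (50, 31,
  [::]); (56, 29, [:: 1; 29; 34; 92; 111]); (72, 32, [::])];
  ClassData [:: 44; 4; 2; 1; 0] [:: 0; 98; 101] [:: [:: 0; 2; 44; 59; 60]; [:: 45; 55; 75; 76];
  [:: 44; 45; 54]] [:: (0, 9, [:: 1; 3; 37; 40; 49; 58; 69]); (2, 13, [:: 7; 20; 32; 42; 59;
  85]); (6, 25, [:: 3; 5; 7; 9; 24; 25]); (10, 27, [:: 2; 26; 36; 40; 48; 49]); (18, 30, [:: 2;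
  18; 19; 26]); (22, 31, [:: 20; 21; 46]); (44, 7, [::]); (45, 12, [:: 6; 10; 20; 24; 26; 27]);
  (46, 33, [::])];
  ClassData [:: 44; 16; 2; 1; 0] [:: 3; 22; 23] [:: [:: 0; 26]; [:: 0; 3; 22; 23; 115; 116]; [::
  44; 45; 55]] [:: (0, 9, [:: 0; 4; 36; 44; 52; 77; 82]); (6, 26, [:: 2; 28; 39]); (10, 31, [::
  37; 38; 41]); (44, 8, [::]); (45, 34, [::]); (46, 35, [::])];
  ClassData [:: 37; 36; 2; 1; 0] [:: 30; 31; 50] [:: [:: 16; 17; 36; 51; 55]; [:: 2; 12; 13;
  16]] [:: (0, 12, [:: 2; 4; 19; 53]); (2, 11, [:: 0; 5; 29; 45; 53]); (8, 12, [:: 0; 11; 16;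
  25; 37; 39]); (16, 9, [:: 16; 18; 50; 53]); (20, 34, [:: 2; 28; 29; 39; 54]); (50, 9, [:: 3;
  24; 36; 41; 44]); (56, 36, [::])];
  ClassData [:: 38; 36; 2; 1; 0] [:: 6; 7; 39] [:: [:: 22; 23; 55]] [:: (0, 14, [:: 2; 26; 30;
  50; 111; 113]); (2, 12, [:: 0; 16; 17; 30; 51; 54]); (4, 25, [:: 2; 3; 42; 43]); (10, 33, [::
  37; 39; 41; 75; 76]); (16, 26, [:: 1; 5; 7; 31; 54]); (22, 35, [:: 5; 7; 11; 53; 113; 118]);
  (36, 9, [:: 36; 45; 55]); (37, 34, [:: 16; 19; 39; 55]); (40, 37, [::]); (54, 31, [:: 1; 3; 6;
  31; 52]); (56, 38, [::]); (62, 39, [::])];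
  ClassData [:: 50; 36; 2; 1; 0] [:: 2; 41; 45] [:: [:: 2; 3; 41; 45]; [:: 37]; [:: 24; 25; 36]]
  [:: (0, 12, [:: 0; 7; 9; 22; 43; 63; 82]); (2, 13, [:: 16; 17; 32; 37; 38; 55]); (4, 27, [::
  18; 19]); (12, 12, [:: 5; 19; 54; 55; 67; 79]); (16, 31, [:: 0; 4; 15; 29]); (24, 34, [:: 6;
  7; 15; 38; 42; 67; 68]); (36, 9, [:: 36; 37; 40; 44; 53]); (37, 9, [:: 2; 19; 24; 38; 47]);
  (38, 37, [:: 2; 28; 29; 38; 46]); (42, 31, [:: 0; 3; 7; 34; 38; 39]); (56, 25, [:: 11; 27; 58;
  93; 104; 118]); (57, 40, [::]); (61, 25, [:: 8; 13; 16; 37; 66; 91])];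
  ClassData [:: 56; 36; 2; 1; 0] [:: 14; 15; 36; 37] [:: [:: 2; 34; 35; 50; 116]; [:: 8; 74;
  102]] [:: (0, 10, [:: 37; 51; 53; 68]); (2, 9, [:: 2; 32; 33; 58; 118]); (4, 29, [:: 1; 17;
  37; 50; 71]); (8, 30, [:: 1; 3; 36; 38; 56; 63]); (9, 25, [:: 15; 28; 45; 62; 87]); (14, 14,
  [:: 52; 103; 110; 112]); (17, 32, [:: 6; 10; 48; 49; 69; 105]); (20, 26, [:: 15; 28; 50; 51;
  61; 84]); (26, 28, [:: 5; 6; 14; 15; 55; 56]); (37, 36, [::]); (38, 38, [:: 2; 3; 56; 75]);
  (51, 40, [:: 0; 1; 30; 31; 36])];
  ClassData [:: 60; 36; 2; 1; 0] [:: 14; 15] [:: [:: 0; 1; 3; 52; 108]; [:: 51]] [:: (0, 9, [::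
  36; 37; 50; 67]); (2, 12, [:: 6; 16; 52; 88; 107]); (4, 29, [:: 44; 45; 51; 53; 108]); (5, 28,
  [:: 2; 5; 7; 50; 51; 92]); (8, 31, [:: 1; 17; 23; 45; 65; 98]); (9, 27, [:: 2; 28; 31; 40;
  105; 114]); (36, 10, [:: 36; 44; 48; 51]); (37, 36, [:: 42; 43; 51]); (38, 38, [:: 0; 22; 23;
  38; 93; 116]); (39, 39, [:: 36; 44; 50; 51; 54]); (50, 40, [:: 36; 37; 38; 46]); (51, 25, [::
  15; 16; 45; 47; 49; 75; 104])];
  ClassData [:: 68; 28; 26; 1; 0] [:: 1; 37; 53; 75] [:: [:: 0; 28; 30; 66; 81]; [:: 0; 1; 55;
  68]; [:: 53]] [:: (0, 12, [:: 1; 54; 69]); (1, 14, [:: 7; 15; 16; 96]); (2, 28, [:: 2; 3; 17;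
  68]); (8, 39, [:: 2; 9; 16; 17; 55; 62]); (27, 36, [:: 3; 6; 27; 51; 55]); (30, 40, [:: 0; 10;
  15; 24; 31; 85; 93; 110]); (31, 31, [:: 15; 52; 77; 113]); (51, 30, [:: 5; 18; 43; 45; 50; 81;
  86]); (103, 41, [::])];
  ClassData [:: 8; 6; 4; 2; 1; 0] [:: 3; 18; 19; 38] [:: [:: 55]; [:: 22; 23]] [:: (0, 22, [::
  1; 3; 42; 43; 51; 63; 65]); (2, 21, [:: 6; 20; 43; 46; 73; 86]); (3, 15, [:: 8; 50]); (4, 20,
  [:: 36; 39; 54]); (5, 17, [:: 2; 5; 28; 32; 33; 39]); (10, 42, [::]); (22, 43, [::]); (54, 23,
  [:: 14; 20; 27; 52; 88; 103]); (56, 44, [::]); (60, 45, [::]); (64, 46, [::]); (76, 47, [::])];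
  ClassData [:: 20; 6; 4; 2; 1; 0] [:: 16; 17; 28; 54] [:: [:: 2; 3; 5; 29]; [:: 20; 50; 51;
  55]] [:: (0, 22, [:: 9; 18; 19; 50; 94; 96]); (2, 20, [:: 1; 2; 5; 7; 9]); (3, 16, [:: 6;
  45]); (4, 18, [:: 0; 15; 36; 38; 107; 108]); (10, 43, [:: 2; 5; 6; 9; 11]); (20, 15, [::]);
  (22, 48, [::]); (54, 49, [::]); (56, 45, [:: 8; 10; 11; 14; 83; 101; 112]); (64, 47, [:: 0;
  10; 11; 27; 37; 54; 62])];
  ClassData [:: 50; 6; 4; 2; 1; 0] [:: 6; 26; 51] [:: [:: 2; 3; 36; 37; 51]; [:: 0; 1; 3; 27;
  37]] [:: (0, 23, [:: 2; 3; 7; 43; 72; 87]); (2, 17, [:: 0; 4; 19; 43; 46; 83; 84]); (3, 17,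
  [:: 6; 44; 45; 46; 75; 76]); (4, 21, [:: 36; 42; 43]); (8, 42, [:: 2; 5; 6; 9; 10]); (12, 23,
  [:: 1; 7; 16; 41; 43; 59; 69]); (20, 48, [:: 2; 3; 4; 21; 28; 50]); (24, 49, [:: 22; 23; 52]);
  (50, 15, [::]); (51, 15, [:: 2; 3; 5; 20; 23; 25; 28]); (52, 48, [:: 4; 5; 21; 51; 54]); (56,
  44, [:: 14; 17; 50; 53; 93]); (57, 46, [:: 21; 25; 28; 29; 108]); (64, 46, [:: 1; 3; 28; 31;
  32; 34; 73]); (65, 44, [:: 1; 12; 40; 59; 64; 102])];
  ClassData [:: 56; 6; 4; 2; 1; 0] [:: 2; 104; 111] [:: [:: 1; 4; 7; 51; 55; 116]] [:: (0, 15,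
  [:: 3; 21; 36; 77; 103; 110]); (1, 22, [:: 0; 2; 6; 17; 51; 55; 96]); (2, 23, [:: 4; 5; 30;
  50; 83; 90; 105]); (7, 24, [:: 4; 5; 7; 55]); (8, 45, [:: 0; 6; 17; 32; 33; 89; 112]); (9, 44,
  [:: 3; 5; 7; 9]); (30, 46, [:: 0; 7; 24; 25; 27; 30; 118]); (51, 46, [:: 0; 6; 27; 52; 79;
  82])];
  ClassData [:: 64; 6; 4; 2; 1; 0] [:: 6; 26; 108] [:: [:: 0; 10; 11; 27; 29; 53; 71]; [:: 54]]
  [:: (0, 16, [:: 1; 15; 17; 36; 55; 70]); (2, 23, [:: 0; 1; 28; 59; 72]); (4, 22, [:: 0; 1; 3;
  48; 49; 116]); (8, 47, [:: 22; 23; 55]); (9, 45, [:: 1; 2; 21; 71; 109; 118]); (17, 15, [:: 0;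
  4; 7; 54; 84]); (30, 46, [:: 14; 16; 17; 28; 30; 70]); (51, 44, [:: 1; 2; 36; 53; 86; 111])];
  ClassData [:: 20; 18; 4; 2; 1; 0] [:: 2; 18; 55] [:: [:: 0; 28; 38; 54]; [:: 2; 10; 11; 18;
  21; 27]; [:: 18; 44; 55]] [:: (0, 22, [:: 2; 16; 31; 52; 79; 80]); (2, 17, [:: 4; 5; 31; 37;
  98; 101]); (3, 16, [:: 1; 16; 29; 39; 51; 55]); (10, 48, [:: 0; 1; 21; 26; 27; 46]); (54, 24,
  [:: 10; 17; 24; 29; 64; 78]); (56, 46, [:: 6; 22; 23; 79; 99]); (60, 47, [:: 0; 12; 26; 50;
  73; 101]); (76, 50, [::])];
  ClassData [:: 50; 18; 4; 2; 1; 0] [:: 2; 18; 51] [:: [:: 18; 48; 49]; [:: 0; 1; 2; 4; 19]] [::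
  (0, 23, [:: 1; 2; 36; 46; 49; 90; 100]); (2, 21, [:: 1; 2; 7]); (3, 18, [:: 0; 3; 19; 53; 96;
  103]); (8, 43, [:: 24; 25; 45; 50]); (12, 49, [:: 0; 1; 5; 28; 31; 35]); (18, 17, [:: 18; 19;
  45; 51; 54]); (20, 48, [:: 4; 5; 10; 14; 36; 44]); (24, 24, [:: 15; 26; 28; 50; 52; 97; 111]);
  (50, 16, [::]); (51, 20, [:: 1; 15; 21; 23; 24; 28]); (52, 51, [::]); (56, 45, [:: 16; 44; 49;
  61; 83]); (57, 44, [:: 4; 15; 20; 25; 36; 77]); (72, 47, [:: 14; 27; 44; 48; 93; 115]); (73,
  52, [::])];
  ClassData [:: 72; 18; 4; 2; 1; 0] [:: 2; 48; 75; 76] [:: [:: 18; 19; 52; 72; 79]; [:: 2; 5; 6;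
  51; 52; 83]] [:: (0, 16, [:: 16; 17; 36; 51; 54; 99]); (2, 22, [:: 3; 38; 41; 62; 69; 111]);
  (8, 47, [:: 3; 7; 22; 23; 74; 92]); (20, 50, [:: 0; 9; 25; 29; 46; 84; 113]); (51, 52, [:: 2;
  5; 54; 55])];
  ClassData [:: 46; 44; 4; 2; 1; 0] [:: 3; 40; 41; 45] [:: [:: 44; 53; 73; 78]; [:: 0; 5; 44;
  49; 80; 87]] [:: (0, 20, [:: 1; 2; 39; 52; 93; 98]); (2, 17, [:: 63; 81; 101; 108]); (6, 42,
  [:: 2; 3; 36; 37]); (12, 48, [:: 4; 15; 18; 35; 38; 39]); (18, 48, [:: 0; 7; 30; 40]); (24,
  51, [:: 19; 20; 23; 24]); (44, 17, [:: 46; 74; 77]); (45, 20, [:: 5; 8; 15; 19; 25; 33])];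
  ClassData [:: 45; 44; 16; 2; 1; 0] [:: 4; 5; 45; 54] [:: [:: 1; 27; 52; 53]; [:: 0; 3; 5; 18;
  19; 54; 55]; [:: 16; 17; 44; 46; 47]; [:: 44; 55]] [:: (0, 21, [:: 5; 36; 44; 53; 60; 67]);
  (2, 19, [:: 4; 12; 13; 14; 20]); (6, 20, [:: 4; 15; 19; 21]); (10, 20, [:: 0; 14; 18; 24; 27;
  50]); (44, 18, [:: 52; 53]); (46, 53, [::]); (54, 18, [:: 0; 2; 8; 9; 113; 118]); (56, 49, [::
  0; 8; 29; 62; 96])];
  ClassData [:: 46; 44; 16; 2; 1; 0] [:: 4; 46; 67; 68] [:: [:: 0; 1; 27; 83; 84]; [:: 4; 44;
  53; 73; 78]] [:: (0, 20, [:: 1; 4; 39; 50; 52; 108; 114]); (6, 43, [:: 0; 2; 7; 8; 17; 32]);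
  (12, 51, [:: 0; 6; 9; 10; 13; 15; 16]); (44, 18, [:: 4; 44; 51; 75; 76]); (45, 53, [:: 2; 4;
  5; 18; 21; 41])];
  ClassData [:: 56; 37; 36; 2; 1; 0] [:: 2; 51; 55; 116] [:: [:: 19; 51; 53]; [:: 17; 51; 53]]
  [:: (0, 23, [:: 36; 40; 41; 55; 64]); (2, 19, [:: 2; 4; 5; 10; 80; 92]); (8, 24, [:: 1; 5; 11;
  19; 25; 39]); (9, 23, [:: 0; 8; 14; 41; 48; 64]); (14, 24, [:: 1; 6; 16; 56; 67]); (17, 22,
  [:: 14; 17; 55; 67; 111]); (20, 49, [:: 1; 5; 7; 15; 86; 92]); (51, 22, [:: 2; 17; 24; 37; 40;
  44])];
  ClassData [:: 40; 38; 36; 2; 1; 0] [:: 34; 35; 40; 45] [:: [:: 0; 1; 2]; [:: 0; 1; 34; 35];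
  [:: 24; 25; 71; 84; 98; 110]] [:: (0, 20, [:: 54; 63; 72; 100; 109]); (2, 21, [:: 4; 5; 24;
  57; 79; 99; 106]); (4, 42, [:: 18; 19; 50; 51]); (12, 20, [:: 35; 59; 77; 97; 104]); (16, 43,
  [:: 10; 14; 16; 17]); (24, 53, [:: 11; 27; 29; 48; 69; 88]); (42, 43, [:: 11; 15; 34; 36;
  37]); (56, 54, [::])];
  ClassData [:: 56; 38; 36; 2; 1; 0] [:: 1; 68; 87] [:: [:: 0; 1; 3; 55; 56; 75; 93]] [:: (0,
  22, [:: 0; 14; 15; 32; 48; 93; 106]); (2, 23, [:: 14; 15; 32; 89; 106]); (4, 45, [:: 3; 5; 22;
  23; 28; 38; 54]); (5, 46, [:: 26; 32; 42; 68; 77]); (6, 47, [:: 3; 5; 54; 55; 77]); (9, 45,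
  [:: 22; 23; 37; 38; 55; 98]); (10, 48, [:: 28; 44; 48; 50; 61; 81]); (11, 42, [:: 36; 40; 49;
  107; 108]); (14, 20, [:: 0; 1; 14; 68; 77; 104]); (22, 43, [:: 0; 11; 26; 27; 104; 118]); (26,
  44, [:: 5; 6; 8; 14; 15; 56]); (37, 49, [:: 7; 14; 92; 117]); (40, 54, [:: 0; 1; 3; 113]);
  (55, 45, [:: 0; 4; 5; 46; 47; 82; 108])];
  ClassData [:: 62; 38; 36; 2; 1; 0] [:: 1; 45; 81] [:: [:: 36; 38; 55]] [:: (0, 20, [:: 0; 1;
  34; 35; 65]); (2, 24, [:: 16; 17; 30; 75]); (4, 45, [:: 3; 7; 22; 23; 27; 31]); (5, 44, [::
  17; 36; 55; 102]); (10, 51, [:: 20; 21; 41; 53; 104; 111]); (11, 48, [:: 0; 9; 22; 84; 92;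
  106; 113]); (36, 23, [:: 2; 32; 33; 37; 44; 108]); (37, 49, [:: 0; 15; 37; 38; 63; 117]); (40,
  54, [:: 0; 1; 34; 35]); (41, 43, [:: 5; 13; 19; 30; 67; 114]); (54, 52, [:: 2; 4; 19; 44; 52;
  118]); (55, 47, [:: 3; 6; 17; 20; 97; 111])];
  ClassData [:: 57; 50; 36; 2; 1; 0] [:: 3; 57] [:: [:: 14; 86; 90]; [:: 37]] [:: (0, 23, [:: 0;
  4; 11; 49; 85; 100]); (2, 21, [:: 2; 3; 40; 44; 96; 108]); (4, 44, [:: 9; 12; 14; 66; 81;
  103]); (8, 46, [:: 36; 37; 39; 46; 53; 108]); (9, 44, [:: 0; 2; 3; 33; 38; 65; 70]); (12, 23,
  [:: 15; 34; 36; 38; 39; 111]); (13, 24, [:: 4; 18; 38; 39; 64; 76]); (14, 24, [:: 0; 6; 13;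
  73; 82; 96; 108]); (17, 52, [:: 18; 19; 50; 51; 98]); (20, 45, [:: 0; 20; 28; 46; 63; 86]);
  (24, 49, [:: 1; 3; 5; 53; 79; 101]); (26, 46, [:: 4; 7; 14; 15; 20; 24; 109]); (37, 22, [:: 8;
  9; 37; 84; 103; 110; 113]); (38, 54, [:: 0; 8; 9; 37; 68; 87]); (42, 45, [:: 1; 16; 18; 53;
  84; 106]); (50, 22, [:: 2; 8; 9; 53; 56]); (52, 52, [:: 2; 8; 34; 36; 76; 83; 117])];
  ClassData [:: 103; 68; 28; 26; 1; 0] [:: 3; 91; 96] [:: [:: 0; 3; 29; 51; 80]; [:: 3; 7; 51;
  55]; [:: 2; 4; 5; 6; 51]] [:: (0, 24, [:: 0; 8; 12; 74; 102]); (8, 52, [:: 0; 7; 45; 50; 55;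
  105]); (51, 50, [:: 5; 31; 35; 87; 91])];
  ClassData [:: 10; 8; 6; 4; 2; 1; 0] [:: 10; 30; 36] [::] [:: (0, 38, [:: 0; 28; 31; 53; 76;
  82]); (2, 25, [:: 1; 11; 24; 28; 29]); (3, 25, [:: 2; 5; 24; 25; 29; 39; 47]); (4, 37, [:: 2;
  26; 27; 39; 46]); (5, 27, [:: 2; 8; 32; 52; 53]); (6, 33, [:: 18; 19; 44; 51]); (12, 38, [::
  15; 24; 69; 86; 96; 108]); (24, 55, [::]); (56, 56, [::]); (58, 57, [::]); (60, 58, [::]);
  (62, 58, [:: 2; 3; 18; 40; 41; 45; 63]); (66, 56, [:: 6; 7; 21; 64; 105; 114]); (68, 59,
  [::])];
  ClassData [:: 22; 8; 6; 4; 2; 1; 0] [:: 6; 22; 26] [::] [:: (0, 38, [:: 15; 18; 23; 53; 60;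
  67]); (2, 37, [:: 0; 4; 5; 28; 33; 39]); (3, 26, [:: 8; 51; 55]); (4, 35, [:: 0; 2; 36; 38;
  40; 115; 116]); (5, 31, [:: 2; 8; 27; 37; 47]); (12, 55, [:: 55]); (22, 25, [::]); (24, 39,
  [:: 20; 27; 43; 90; 101]); (56, 57, [:: 24; 25; 51; 57]); (60, 60, [::]); (64, 56, [:: 0; 5;
  14; 51; 55; 60; 111]); (76, 61, [::])];
  ClassData [:: 56; 8; 6; 4; 2; 1; 0] [:: 6; 26; 54; 55] [::] [:: (0, 25, [:: 24; 25; 88]); (1,
  38, [:: 4; 8; 15; 19; 55; 96]); (2, 40, [:: 3; 11; 44; 45; 67; 112]); (3, 28, [:: 0; 11; 17;
  34; 61; 97; 107]); (5, 27, [:: 6; 30; 46; 74; 77]); (7, 39, [:: 0; 1; 4; 9; 28; 110]); (9, 31,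
  [:: 5; 12; 15; 33; 64; 92]); (10, 57, [:: 14; 26; 51; 54; 118]); (11, 56, [:: 1; 2; 18; 44;
  54; 66; 94]); (32, 58, [:: 2; 5; 6; 33; 79; 99]); (55, 29, [:: 1; 6; 11; 38; 49; 87; 94]);
  (108, 60, [:: 14; 22; 23; 45; 48; 82])];
  ClassData [:: 60; 8; 6; 4; 2; 1; 0] [:: 5; 44; 60] [::] [:: (0, 29, [:: 9; 17; 52; 56; 71;
  107]); (1, 26, [:: 0; 2; 18; 21; 26; 54; 101]); (2, 31, [:: 0; 15; 18; 52; 64; 92]); (4, 38,
  [:: 2; 31; 46; 47; 57; 74]); (6, 25, [:: 1; 5; 45; 113; 118]); (7, 38, [:: 15; 31; 46; 47; 57;
  80]); (9, 40, [:: 6; 33; 44; 52; 67; 77; 100]); (10, 56, [:: 1; 12; 38; 39; 87]); (11, 57, [::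
  6; 16; 44; 45; 55; 84; 102]); (19, 28, [:: 5; 24; 25; 29; 44; 105; 116]); (22, 60, [:: 0; 1;
  3; 22; 27; 37; 45; 67]); (38, 39, [:: 4; 28; 42; 43]); (40, 58, [:: 3; 16; 32; 36; 44; 103]);
  (54, 38, [:: 3; 6; 16; 42; 43; 91; 102])];
  ClassData [:: 64; 8; 6; 4; 2; 1; 0] [:: 17; 59; 101] [:: [:: 1; 44; 54; 59; 82]] [:: (0, 29,
  [:: 8; 14; 17; 18; 58]); (1, 30, [:: 17; 64]); (2, 27, [:: 0; 15; 17; 37; 52; 56; 100]); (4,
  38, [:: 2; 32; 33; 37; 44; 114]); (5, 25, [:: 2; 17; 18; 58; 100]); (9, 40, [:: 0; 6; 20; 21;
  42; 47; 106]); (10, 56, [:: 4; 64; 91; 101; 118]); (11, 58, [:: 0; 20; 29; 49; 66; 73; 87]);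
  (27, 28, [:: 0; 3; 8; 26; 50; 116]); (32, 59, [:: 0; 22; 23; 64; 83; 101]); (54, 28, [:: 0; 4;
  12; 13; 63; 110]); (76, 62, [::])];
  ClassData [:: 76; 8; 6; 4; 2; 1; 0] [:: 5; 44; 54] [::] [:: (0, 26, [:: 1; 7; 76; 96; 117]);
  (1, 32, [:: 8; 9; 10; 62; 87; 100; 114]); (2, 31, [:: 10; 15; 31; 43; 58; 110]); (3, 29, [::
  8; 37; 42; 51; 104; 115]); (4, 38, [:: 37; 44; 91; 114]); (5, 30, [:: 7; 31; 40; 41; 72; 79]);
  (10, 56, [:: 15; 33; 45; 48; 70; 88]); (22, 61, [:: 2; 6; 26; 30; 55; 109]); (54, 25, [:: 2;
  4; 6; 8; 34; 35; 109]); (55, 39, [:: 0; 6; 9; 115; 116]); (58, 60, [:: 12; 14; 21; 47; 82; 85;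
  99]); (64, 62, [::])];
  ClassData [:: 22; 20; 6; 4; 2; 1; 0] [:: 6; 20; 26] [::] [:: (0, 38, [:: 2; 7; 8; 53; 92;
  98]); (2, 33, [:: 32; 38; 53; 65; 70]); (3, 30, [:: 6; 20; 46; 52; 53]); (4, 31, [:: 1; 4; 9;
  29; 33]); (12, 39, [:: 15; 25; 28; 41; 63; 65]); (20, 27, [:: 2; 10; 11; 27; 37]); (21, 26,
  [:: 2; 3; 4; 22; 28; 54]); (24, 63, [::]); (56, 58, [:: 1; 2; 31; 37; 42; 91; 96]); (58, 60,
  [:: 1; 2; 36; 50; 88; 102; 113]); (64, 56, [:: 0; 1; 14; 31; 77; 100; 106]); (66, 62, [:: 1;
  3; 37; 38; 46; 57; 68])];
  ClassData [:: 54; 20; 6; 4; 2; 1; 0] [:: 3; 20; 36] [:: [:: 2; 3; 4; 28; 54]; [:: 54; 55]] [::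
  (0, 40, [:: 13; 22; 62; 77; 88; 116]); (2, 31, [:: 7; 14; 15; 45; 51; 54]); (3, 31, [:: 1; 3;
  20; 27; 37; 53]); (4, 34, [:: 2; 4; 7; 9; 114; 117]); (8, 36, [:: 11; 30; 58; 71; 80; 118]);
  (10, 55, [:: 21; 29; 51; 69; 80]); (20, 27, [:: 2; 3; 5; 29; 53]); (22, 63, [:: 1; 15; 23; 36;
  45; 70; 80]); (54, 26, [::]); (55, 26, [:: 0; 1; 4; 28; 34; 35]); (56, 39, [:: 0; 2; 3; 5; 30;
  75]); (58, 38, [:: 0; 2; 10; 11; 86; 115]); (64, 39, [:: 1; 19; 42; 43; 75; 110]); (66, 38,
  [:: 0; 2; 3; 8; 27; 37; 75])];
  ClassData [:: 76; 20; 18; 4; 2; 1; 0] [:: 15; 57; 62] [:: [:: 0; 8; 15; 18; 26; 55; 117]; [::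
  4; 18; 21; 69; 115]] [:: (0, 30, [:: 0; 3; 17; 28; 30; 81]); (1, 32, [:: 18; 26; 48; 86; 98;
  101]); (10, 62, [:: 5; 8; 35; 56; 63; 84; 101]); (55, 41, [:: 2; 3; 16; 31; 55; 69]); (106,
  64, [::])];
  ClassData [:: 52; 50; 18; 4; 2; 1; 0] [:: 2; 18; 55] [:: [:: 2; 26]] [:: (0, 39, [:: 1; 2; 39;
  51; 90; 100]); (2, 31, [:: 0; 1; 12; 30; 40]); (3, 35, [:: 3; 29; 47; 106; 109]); (8, 55, [::
  4; 9; 10; 28; 34]); (18, 33, [:: 2; 26; 46; 47; 49]); (20, 39, [:: 0; 1; 7; 13; 31; 78; 80]);
  (50, 31, [:: 2; 5; 52]); (51, 35, [:: 2; 6; 34; 41; 65; 70]); (56, 57, [:: 18; 46; 69; 89;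
  115]); (57, 60, [:: 4; 20; 35; 51; 75; 108; 119]); (72, 60, [:: 6; 25; 26; 62; 77; 83; 103]);
  (74, 65, [::])];
  ClassData [:: 73; 50; 18; 4; 2; 1; 0] [:: 15; 50; 61; 70] [:: [:: 1; 3; 37; 50; 61]; [:: 0; 4;
  28; 118]] [:: (0, 31, [:: 36; 70]); (2, 40, [:: 0; 12; 14; 15; 16; 61; 113]); (8, 60, [:: 3;
  5; 11; 18; 19; 91]); (12, 39, [:: 1; 11; 24; 36; 60; 112]); (20, 62, [:: 2; 3; 13; 17; 33; 64;
  108]); (24, 41, [:: 3; 11; 26; 65; 90; 109]); (50, 32, [:: 6; 22; 24; 77; 88; 110]); (53, 65,
  [:: 1; 12; 31; 33; 66; 115])];
  ClassData [:: 46; 45; 44; 16; 2; 1; 0] [:: 3; 17; 47] [:: [:: 5; 7; 14; 33]; [:: 19; 41]] [::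
  (0, 37, [:: 5; 38; 53; 61; 66]); (2, 34, [:: 0; 1; 7; 17; 33; 55]); (8, 35, [:: 1; 4; 18; 33;
  54; 58; 61]); (12, 35, [:: 10; 27; 37; 55; 81; 86]); (52, 66, [::]); (56, 55, [:: 8; 24; 26;
  70; 83; 96; 106])];
  ClassData [:: 56; 40; 38; 36; 2; 1; 0] [:: 3; 47; 56] [::] [:: (0, 38, [:: 65]); (2, 40, [::
  1; 30; 31; 36; 63; 83]); (4, 57, [:: 0; 18; 26; 38; 96; 103]); (5, 58, [:: 3; 5; 6; 8; 54;
  98]); (6, 56, [:: 2; 7; 9; 10; 24; 26]); (7, 58, [:: 0; 2; 6; 9; 55; 62; 98]); (11, 57, [:: 0;
  6; 8; 54; 73; 95; 108]); (12, 39, [:: 2; 3; 34; 87; 100; 114]); (13, 38, [:: 2; 25; 38; 39;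
  93; 113]); (14, 39, [:: 0; 8; 19; 22; 26; 79; 81]); (17, 60, [:: 10; 18; 26; 78; 103]); (24,
  55, [:: 2; 5; 9; 46; 60; 97]); (26, 56, [:: 0; 21; 28; 41; 48; 49; 103]); (42, 60, [:: 1; 21;
  26; 28; 46; 56; 105]); (56, 37, [::]); (71, 63, [:: 1; 2; 27; 36; 73; 84])];
  ClassData [:: 24; 10; 8; 6; 4; 2; 1; 0] [:: 2; 25; 41; 45] [:: [:: 24; 25]; [:: 24; 25; 68;
  81]] [:: (0, 49, [:: 1; 19; 46; 60; 104]); (2, 43, [:: 1; 10; 24; 38; 39]); (3, 43, [:: 0; 2;
  24; 26; 36; 44; 50]); (4, 53, [:: 0; 11; 14; 29; 43; 60; 97]); (6, 51, [:: 2; 19; 20; 24; 26;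
  50]); (12, 54, [:: 0; 3; 16; 17; 63; 64]); (24, 42, [::])];
  ClassData [:: 56; 10; 8; 6; 4; 2; 1; 0] [:: 24; 58; 81; 114] [::] [:: (0, 42, [:: 24; 25;
  88]); (1, 54, [:: 0; 3; 16; 17; 63]); (2, 45, [:: 4; 46; 59; 68; 93]); (3, 44, [:: 3; 27; 37;
  45; 51; 55]); (5, 46, [:: 2; 3; 17; 61; 86; 100; 104]); (7, 48, [:: 0; 23; 25; 31; 81; 106]);
  (9, 43, [:: 0; 8; 34; 40; 56; 93]); (11, 47, [:: 2; 7; 25; 26; 30])];
  ClassData [:: 58; 10; 8; 6; 4; 2; 1; 0] [:: 5; 20; 21; 46] [::] [:: (0, 45, [:: 1; 6; 15; 17;
  88; 114]); (1, 43, [:: 21; 58]); (2, 44, [:: 2; 3; 11; 18; 48; 62]); (6, 42, [:: 6; 24; 25;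
  30; 61; 99]); (7, 51, [:: 7; 31; 41; 54; 107; 108]); (8, 44, [:: 1; 6; 9; 12; 26; 68; 104]);
  (9, 54, [:: 15; 33; 44; 45; 60; 80]); (11, 45, [:: 16; 29; 40; 43; 58; 118]); (12, 43, [:: 0;
  9; 14; 19; 75; 76; 94]); (13, 54, [:: 4; 29; 30; 50; 55; 101])];
  ClassData [:: 60; 10; 8; 6; 4; 2; 1; 0] [:: 15; 43; 59; 109] [::] [:: (0, 46, [:: 1; 4; 15;
  88; 110]); (1, 48, [:: 0; 1; 19; 26; 27; 95]); (2, 44, [:: 17; 20; 23; 58; 81; 108]); (4, 42,
  [:: 9; 33; 65; 92; 107; 117]); (6, 42, [:: 10; 26; 30; 35; 36; 77; 106]); (9, 54, [:: 2; 11;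
  28; 29; 30; 56]); (11, 45, [:: 3; 5; 24; 28; 39]); (14, 45, [:: 0; 7; 21; 35; 70; 77]); (19,
  44, [:: 2; 10; 26; 36; 79; 102]); (22, 54, [:: 6; 9; 10; 91; 96]); (26, 46, [:: 2; 11; 24; 28;
  29]); (40, 48, [:: 9; 15; 18; 24; 73; 110])];
  ClassData [:: 68; 10; 8; 6; 4; 2; 1; 0] [:: 8; 29; 58; 86] [:: [:: 45; 51; 55; 106]; [:: 0;
  18; 19; 27; 39; 48; 51; 93]] [:: (0, 46, [:: 8; 14; 17; 52; 92]); (2, 46, [:: 4; 22; 29; 38;
  52; 64; 94]); (4, 42, [:: 7; 8; 13; 17; 50; 86; 117])];
  ClassData [:: 60; 22; 8; 6; 4; 2; 1; 0] [:: 56; 69; 82; 91] [:: [:: 0; 8; 12; 16; 87; 112]]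
  [:: (0, 47, [:: 4; 6; 11; 13; 14; 112]); (1, 45, [:: 2; 32; 37; 45; 55; 73; 86]); (2, 43, [::
  2; 62; 88; 101; 114]); (5, 52, [:: 9; 26; 36; 46; 48; 49]); (9, 54, [:: 14; 19; 33; 34; 67;
  79]); (12, 51, [:: 3; 38; 42; 65; 115]); (16, 48, [:: 9; 13; 33; 80; 102; 109]); (47, 44, [::
  0; 6; 11; 57; 66; 95])];
  ClassData [:: 76; 22; 8; 6; 4; 2; 1; 0] [:: 21; 65; 84; 103] [:: [:: 11; 14; 31; 71]; [:: 0;
  1; 13; 15; 20; 71; 115; 116]] [:: (0, 47, [:: 5; 15; 44; 49; 59; 76; 114]); (2, 43, [:: 15;
  17; 20; 48; 50; 67; 90])];
  ClassData [:: 76; 64; 8; 6; 4; 2; 1; 0] [:: 1; 31; 60; 79] [:: [:: 27; 43]; [:: 27; 32; 54;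
  68]] [:: (0, 47, [:: 37; 46; 55; 61]); (1, 50, [:: 16; 17; 18; 44; 67; 100]); (2, 48, [:: 1;
  4; 14; 44; 53; 57; 82]); (9, 52, [:: 14; 33; 36; 43; 98; 110]); (27, 46, [:: 1; 6; 9; 32; 54;
  85; 118])];
  ClassData [:: 24; 22; 20; 6; 4; 2; 1; 0] [:: 63; 82; 90; 97] [:: [:: 0; 2; 3; 22; 31; 52; 57;
  79]; [:: 0; 1; 4; 28; 44; 45; 54; 55]] [:: (0, 49, [:: 1; 12; 33; 36; 62; 106]); (2, 48, [::
  0; 18; 31; 40; 49]); (3, 48, [:: 0; 19; 30; 40; 48]); (8, 54, [:: 1; 2; 7; 20; 32; 105; 118])];
  ClassData [:: 106; 76; 20; 18; 4; 2; 1; 0] [:: 16; 19; 40; 43; 82; 113] [:: [:: 0; 2; 12; 16;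
  18; 46; 73; 95]; [:: 0; 3; 23; 25; 31; 65; 92; 105]] [:: (0, 50, [:: 0; 4; 37; 40; 55; 78])];
  ClassData [:: 74; 52; 50; 18; 4; 2; 1; 0] [:: 33; 60; 81; 109] [:: [:: 21; 29; 50; 52; 78;
  102]; [:: 2; 25; 39; 41; 87; 114]] [:: (0, 51, [:: 16; 17; 36; 50; 55; 97]); (2, 52, [:: 23;
  37; 56; 79; 102]); (21, 52, [:: 24; 29; 51; 108; 113])];
  ClassData [:: 52; 46; 45; 44; 16; 2; 1; 0] [:: 15; 23; 36; 43; 81; 107] [:: [:: 19; 38; 41;
  49; 100; 106]; [:: 0; 1; 2; 9; 85; 93; 99; 118]] [:: (0, 53, [:: 1; 3; 16; 64; 74; 94; 115])]]%N.
Lemma checkE8 :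
  [&& check_roots weightsE8 rootsE8, check_basis weightsE8 rootsE8 basisE8 coefsE8
    & check_classes weightsE8 rootsE8 basisE8 minusE8 classesE8].
Proof. by vm_compute. Qed.

(** * The classical types *)

Section InversePerm.
Variables (X : finType) (G : {group {perm X}}).
Hypothesis abG : abelian G.

(** Choose a base point [r x] in each orbit and send [k (r x)] to [k^-1 (r x)]. Commutativity makes
    this independent of the choice of [k]. *)
Lemma orbit_inversion :
  exists g : {perm X}, forall h x, h \in G -> g (h x) = h^-1%g (g x).
Proof.
pose r x := odflt x [pick y | y \in orbit 'P G x].
have rP x : r x \in orbit 'P G x.
  by rewrite /r; case: pickP => // /(_ x) /=; rewrite orbit_refl.
have rE x y : orbit 'P G y = orbit 'P G x -> r y = r x.
  move=> e; rewrite /r e.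
  by case: pickP => // /(_ x) /=; rewrite orbit_refl.
have rr x : r (r x) = r x by apply/rE/orbit_eqP.
have kP x : exists k, (k \in G) && (k (r x) == x).
  have := rP x; rewrite orbit_sym => /orbitP[k kG e]; exists k => //.
  by rewrite kG /=; apply/eqP.
pose k x := xchoose (kP x).
have kG x : k x \in G by case/andP: (xchooseP (kP x)).
have kr x : k x (r x) = x by case/andP: (xchooseP (kP x)) => _ /eqP.
pose g x := (k x)^-1%g (r x).
have gE h x : h \in G -> g (h x) = h^-1%g (g x).
  move=> hG; have rh : r (h x) = r x by apply/rE/orbit_eqP/orbitP; exists h.
  have cG a b y : a \in G -> b \in G -> a (b y) = b (a y).
    move=> aG bG; have := centsP abG a aG b bG.
    by move=> /(congr1 (fun p : {perm X} => p y)); rewrite !permM.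
  (* Both [k x] and [h^-1] after [k (h x)] carry [r x] to [x]; comparing them gives the independence
     of the choice. *)
  have e : (k x)^-1%g (h^-1%g (k (h x) (r x))) = r x.
    by apply: (@perm_inj _ (k x)); rewrite permKV -{1}rh !kr permK.
  rewrite /g rh -{1}e (cG (k (h x))^-1%g) ?groupV // (cG (k (h x))^-1%g) ?groupV //.
  by rewrite permK cG ?groupV.
have gr x : g (r x) = r x.
  have -> : g (r x) = (k (r x))^-1%g (r x) by rewrite /g rr.
  by apply: (@perm_inj _ (k (r x))); rewrite permKV; have := kr (r x); rewrite rr => ->.
have gK : involutive g.
  by move=> x; rewrite {2}/g gE ?groupV // invgK gr kr.
by exists (perm (inv_inj gK)) => h x hG; rewrite (permE _ (h x)) gE // (permE _ x).
Qed.
End InversePerm.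

(** * Permutations of a family: type A *)

Section TypeA.
Variables (R : realType) (V : vectType R) (dot : {dot V for idfun}).
Local Notation rf := (reflection dot).
Local Notation word := (word dot).
Implicit Types (s g : seq V) (v : V).
Variables (T : finType) (f : T -> V) (k : R).
Hypothesis k0 : k != 0.
(** Only pairings with differences are prescribed. This covers orthonormal families as well as
    centred ones, whose members are not orthogonal to each other. *)
Hypothesis fP : forall i j l,
  dot (f i) (f j - f l) = k * ((i == j)%:R - (i == l)%:R).

Definition diffs := [seq f p.1 - f p.2 | p <- enum {: T * T} & p.1 != p.2].

Lemma diffsP v : reflect (exists i j, i != j /\ v = f i - f j) (v \in diffs).
Proof.
apply: (iffP mapP) => [[[i j]]|[i [j [ij ->]]]].
  by rewrite mem_filter /= => /andP[ij _] ->; exists i, j.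
by exists (i, j) => //; rewrite mem_filter /= ij mem_enum.
Qed.

Lemma dot_diff i j : i != j -> dot (f i - f j) (f i - f j) = 2 * k.
Proof.
by move=> ij; rewrite dotDl dotNl !fP !eqxx (eq_sym j i) (negPf ij) /=; ring.
Qed.

Lemma rf_diff a b i : a != b -> rf (f a - f b) (f i) = f (tperm a b i).
Proof.
move=> ab; rewrite rfE dot_diff // fP.
have [->|ia] := eqVneq i a.
  rewrite tpermL (negPf ab) /= (_ : _ / _ = 1); last by field.
  by rewrite scale1r opprB addrC subrK.
have [->|ib] := eqVneq i b.
  rewrite tpermR /= (_ : _ / _ = -1); last by field.
  by rewrite scaleN1r opprK addrC subrK.
rewrite /= subrr mulr0 mulr0 mul0r scale0r subr0 tpermD //; by rewrite eq_sym.
Qed.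

Lemma diffs_neq0 s : {subset s <= diffs} -> 0 \notin s.
Proof.
move=> sD; apply/negP => /sD/diffsP[i [j [ij e]]].
have /eqP := dot_diff ij; rewrite -e dot0l eq_sym mulf_eq0 (negPf k0).
by rewrite pnatr_eq0.
Qed.

Lemma word_diffs s : {subset s <= diffs} ->
  exists p : {perm T}, forall i, word s (f i) = f (p i).
Proof.
elim: s => [_|a s IHs]; first by exists 1%g => i; rewrite word_nil perm1.
move=> /sub_cons[/diffsP[i [j [ij ->]]] /IHs[p pP]].
by exists (p * tperm i j)%g => l; rewrite word_cons pP permM rf_diff.
Qed.

Lemma realize_perm (p : {perm T}) :
  exists2 g, {subset g <= diffs} & forall i, word g (f i) = f (p i).
Proof.
have [ts -> +] := prod_tpermP p.
elim: ts => [_|[a b] ts IHts] /=.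
  by exists [::] => // i; rewrite big_nil word_nil perm1.
move=> /andP[/= ab /IHts[g gD gP]]; exists (g ++ [:: f a - f b]).
  apply/sub_cat; split=> //; apply/sub_cons; split=> //.
  by apply/diffsP; exists a, b.
move=> i; rewrite word_cat word_cons word_nil rf_diff // gP.
by rewrite big_cons permM.
Qed.

Lemma diffs_span s : {subset s <= diffs} -> {subset s <= <<map f (enum T)>>%VS}.
Proof.
move=> sD _ /sD/diffsP[i [j [_ ->]]].
by rewrite rpredB // memv_span // map_f // mem_enum.
Qed.

Lemma ambivalent_diffs : ambivalent dot diffs.
Proof.
move=> s sD; have [p pP] := word_diffs sD.
have [q qP] := orbit_inversion (cycle_abelian p).
have [g gD gP] := realize_perm q; exists g => // v.
rewrite -!word_cat; congr (fun_of_lfun _ _).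
have sgsD : {subset (s ++ g) ++ s <= diffs}.
  by apply/sub_cat; split=> //; apply/sub_cat.
apply: (@eq_word_on _ _ dot (map f (enum T)));
  try exact: diffs_neq0; try exact: diffs_span.
move=> _ /mapP[i _ ->]; rewrite !word_cat pP !gP pP qP ?cycle_id //.
by rewrite permKV.
Qed.

End TypeA.

(** * Signed permutations: types B and D *)

Section TypeBD.
Variables (R : realType) (V : vectType R) (dot : {dot V for idfun}).
Local Notation rf := (reflection dot).
Local Notation word := (word dot).
Implicit Types (s g : seq V) (v : V).
Variables (T : finType) (e : T -> V) (k : R).
Hypothesis k0 : k != 0.
Hypothesis eP : forall i j, dot (e i) (e j) = k * (i == j)%:R.
Local Notation X := (T * bool)%type.

(* Signed permutations of the frame [e] are the permutations of [T * bool] that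
   commute with [opp_frame]; those of type D are the even ones among them. *)
Definition sframe (x : X) : V := if x.2 then - e x.1 else e x.1.
Definition opp_frame (x : X) : X := (x.1, ~~ x.2).
Local Notation E := sframe.
Local Notation nu := opp_frame.

Lemma nuK : involutive nu.
Proof. by case=> i b; rewrite /nu /= negbK. Qed.

Lemma nu_neq x : nu x != x.
Proof. by case: x => i []; rewrite /nu xpair_eqE andbF. Qed.

Lemma E_nu x : E (nu x) = - E x.
Proof. by case: x => i [] /=; rewrite /E //= opprK. Qed.

Lemma dotE_frame x y : dot (E x) (E y) = k * ((x == y)%:R - (x == nu y)%:R).
Proof.
case: x y => i b [j c]; rewrite /E /nu /= !xpair_eqE /=.
by case: b; case: c; rewrite /= ?dotE eP; case: eqP => _ /=; ring.
Qed.

Lemma E_inj : injective E.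
Proof.
move=> x y exy; have := dotE_frame x x; rewrite {2}exy dotE_frame eqxx.
rewrite [x == nu x]eq_sym (negPf (nu_neq x)) => /(mulfI k0).
case: eqP => // _; case: eqP => _ /eqP; rewrite ?subr0 ?sub0r.
  by rewrite eq_sym -subr_eq0 opprK paddr_eq0 ?ler01 // oner_eq0.
by rewrite eq_sym oner_eq0.
Qed.

Definition rootsD := [seq E p.1 - E p.2 | p <- enum {: X * X} & p.1.1 != p.2.1].
Definition rootsB := rootsD ++ [seq e i | i <- enum T].

Lemma rootsDP v : reflect (exists x y, x.1 != y.1 /\ v = E x - E y) (v \in rootsD).
Proof.
apply: (iffP mapP) => [[[x y]]|[x [y [xy ->]]]].
  by rewrite mem_filter /= => /andP[xy _] ->; exists x, y.
by exists (x, y) => //; rewrite mem_filter /= xy mem_enum.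
Qed.

Lemma rootsD_B s : {subset s <= rootsD} -> {subset s <= rootsB}.
Proof. by move=> sD x /sD; rewrite mem_cat => ->. Qed.

Definition nuC (p : {perm X}) := forall x, p (nu x) = nu (p x).

(** The reflection acts by two disjoint transpositions, hence evenly, whereas in [rf_flip] a single
    transposition appears. This is the source of the parity criterion for type D. *)
Lemma rf_swap x y z : x.1 != y.1 ->
  rf (E x - E y) (E z) = E ((tperm x y * tperm (nu x) (nu y))%g z).
Proof.
move=> xy.
have xyF : (x == y) = false by apply: contraNF xy => /eqP ->.
have xnyF : (x == nu y) = false by apply: contraNF xy => /eqP ->.
have yxF : (y == x) = false by rewrite eq_sym.
have ynxF : (y == nu x) = false by rewrite -(inj_eq (inv_inj nuK)) nuK eq_sym.
have nxF : (x == nu x) = false by rewrite eq_sym (negPf (nu_neq x)).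
have nyF : (y == nu y) = false by rewrite eq_sym (negPf (nu_neq y)).
have n0 : dot (E x - E y) (E x - E y) = 2 * k.
  rewrite !dotE !dotE_frame !eqxx xyF xnyF yxF ynxF nxF nyF /=; ring.
rewrite rfE n0 dotDr dotNr !dotE_frame permM.
have [->|zx] := eqVneq z x.
  rewrite xyF xnyF nxF tpermL tpermD 1?eq_sym ?ynxF ?nyF //=.
  rewrite (_ : _ / _ = 1); last by field.
  by rewrite scale1r opprB addrC subrK.
have [->|zy] := eqVneq z y.
  rewrite ynxF nyF tpermR tpermD 1?eq_sym ?nxF ?xnyF //=.
  rewrite (_ : _ / _ = -1); last by field.
  by rewrite scaleN1r opprK addrC subrK.
rewrite [tperm x y z]tpermD 1?eq_sym //.
have [->|znx] := eqVneq z (nu x).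
  rewrite tpermL (inj_eq (inv_inj nuK)) xyF /=.
  rewrite (_ : _ / _ = -1); last by field.
  by rewrite scaleN1r opprK !E_nu addrA addNr add0r.
have [->|zny] := eqVneq z (nu y).
  rewrite tpermR /= (_ : _ / _ = 1); last by field.
  by rewrite scale1r !E_nu opprB addrA addNr add0r.
rewrite tpermD 1?eq_sym //= (_ : _ / _ = 0) ?scale0r ?subr0 //.
by field.
Qed.

Lemma rf_flip i z : rf (e i) (E z) = E (tperm (i, false) (i, true) z).
Proof.
rewrite -[e i]/(E (i, false)) rfE !dotE_frame eqxx.
have -> : nu (i, false) = (i, true) by [].
have -> : ((i, false) == (i, true)) = false by rewrite xpair_eqE andbF.
have [->|z0] := eqVneq z (i, false).
  rewrite tpermL /= xpair_eqE andbF /= (_ : _ / _ = 2); last by field.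
  by rewrite scaler_nat mulr2n opprD addrA subrr sub0r.
have [->|z1] := eqVneq z (i, true).
  rewrite tpermR /= (_ : _ / _ = -2); last by field.
  by rewrite scaleNr scaler_nat mulr2n opprK addrA addNr add0r.
rewrite tpermD 1?eq_sym //= (_ : _ / _ = 0) ?scale0r ?subr0 //.
by field.
Qed.

Lemma swap_nuC x y : x.1 != y.1 -> nuC (tperm x y * tperm (nu x) (nu y))%g.
Proof. by move=> xy z; apply: E_inj; rewrite -rf_swap // !E_nu linearN /= rf_swap. Qed.

Lemma flip_nuC i : nuC (tperm (i, false) (i, true)).
Proof. by move=> z; apply: E_inj; rewrite -rf_flip // !E_nu linearN /= rf_flip. Qed.

Lemma nuCM p q : nuC p -> nuC q -> nuC (p * q)%g.
Proof. by move=> pC qC x; rewrite !permM pC qC. Qed.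

Lemma word_rootsD s : {subset s <= rootsD} -> exists p : {perm X},
  [/\ nuC p, odd_perm p = false & forall x, word s (E x) = E (p x)].
Proof.
elim: s => [_|a s IHs].
  exists 1%g; split=> [x||x]; rewrite ?word_nil ?perm1 //.
  exact: odd_perm1.
move=> /sub_cons[/rootsDP[x [y [xy ->]]] /IHs[p [pC pe pP]]].
exists (p * (tperm x y * tperm (nu x) (nu y)))%g; split.
- exact/nuCM/swap_nuC.
- rewrite !odd_permM pe !odd_tperm (inj_eq (inv_inj nuK)).
  by rewrite addbb.
- by move=> z; rewrite word_cons pP rf_swap // [in RHS]permM.
Qed.

Lemma word_rootsB s : {subset s <= rootsB} -> exists2 p : {perm X},
  nuC p & forall x, word s (E x) = E (p x).
Proof.
elim: s => [_|a s IHs].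
  by exists 1%g => x; rewrite ?word_nil ?perm1.
move=> /sub_cons[+ /IHs[p pC pP]]; rewrite mem_cat => /orP[|/mapP[i _ ->]].
  case/rootsDP=> x [y [xy ->]].
  exists (p * (tperm x y * tperm (nu x) (nu y)))%g; first exact/nuCM/swap_nuC.
  by move=> z; rewrite word_cons pP rf_swap // [in RHS]permM.
exists (p * tperm (i, false) (i, true))%g; first exact/nuCM/flip_nuC.
by move=> z; rewrite word_cons pP rf_flip // [in RHS]permM.
Qed.

Lemma frame_fP i j l : dot (e i) (e j - e l) = k * ((i == j)%:R - (i == l)%:R).
Proof. by rewrite dotDr dotNr !eP; ring. Qed.

Lemma diffs_D s : {subset s <= diffs e} -> {subset s <= rootsD}.
Proof.
move=> sD v /sD/diffsP[i [j [ij ->]]].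
by apply/rootsDP; exists (i, false), (j, false).
Qed.

Lemma flips_B (l : seq T) i : uniq l ->
  word (map e l) (e i) = if i \in l then - e i else e i.
Proof.
elim: l => [|a l IHl] /=; first by rewrite word_nil.
case/andP=> al /IHl; rewrite comp_lfunE => ->.
have e0 : e a != 0.
  by rewrite -(dot_eq0 dot) eP eqxx mulr1.
rewrite inE; have [->|ia] := eqVneq i a.
  by rewrite (negPf al) rf_self.
by case: ifP; rewrite ?linearN /= rf_ortho // eP (negPf ia) mulr0.
Qed.

(** The reflections in [e a - e b] and [e a + e b] together negate both [e a] and [e b], so sign
    changes come in pairs. *)
Lemma flips_D (l : seq T) : uniq l -> ~~ odd (size l) ->
  exists2 s, {subset s <= rootsD} &
    forall i, word s (e i) = if i \in l then - e i else e i.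
Proof.
have [n] := ubnP (size l); elim: n l => // n IHn [|a [|b l]] //=.
  by move=> _ _ _; exists [::] => // i; rewrite word_nil.
rewrite inE negb_or negbK => ln /and3P[/andP[ab al] bl ul] ol.
have [|//|//|s sD sP] := IHn l; first by lia.
exists (E (a, false) - E (b, false) :: E (a, false) - E (b, true) :: s).
  apply/sub_cons; split; first by apply/rootsDP; exists (a, false), (b, false).
  by apply/sub_cons; split=> //; apply/rootsDP; exists (a, false), (b, true).
move=> i; rewrite !word_cons sP !inE.
have [->|ia] := eqVneq i a.
  rewrite (negPf al) /= -[e a]/(E (a, false)).
  rewrite rf_swap // permM tpermL tpermD ?xpair_eqE ?andbF // ?[b == a]eq_sym ?(negPf ab) //.
  rewrite rf_swap // permM [tperm (a, false) _ _]tpermD ?xpair_eqE ?(negPf ab) ?andbF //.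
  by rewrite -[(b, true)]/(nu (b, false)) tpermR E_nu.
have [->|ib] := eqVneq i b.
  rewrite (negPf bl) /= -[e b]/(E (b, false)).
  rewrite rf_swap // permM [tperm (a, false) _ _]tpermD ?xpair_eqE ?(negPf ab) ?andbF //.
  rewrite -[(b, true)]/(nu (b, false)) nuK tpermR.
  rewrite rf_swap // permM [tperm (a, false) _ _]tpermD ?xpair_eqE ?[b == a]eq_sym
    ?(negPf ab) ?andbF //.
  by rewrite tpermL E_nu.
have oi c d : dot (e i) (E (a, c) - E (b, d)) = 0.
  rewrite -[e i]/(E (i, false)) !dotE !dotE_frame !xpair_eqE.
  by rewrite (negPf ia) (negPf ib) /=; ring.
by case: ifP => _; rewrite !rf_ortho ?dotNl ?oi ?oppr0.
Qed.

Lemma nuC_decomp (p : {perm X}) : nuC p -> exists (q : {perm T}) (S : {set T}),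
  forall i, E (p (i, false)) = if q i \in S then - e (q i) else e (q i).
Proof.
move=> pC; pose f i := (p (i, false)).1.
have f_inj : injective f.
  move=> i j fij.
  have [c ec] : exists c, p (i, false) = p (j, c).
    have [e2|e2] := eqVneq (p (i, false)).2 (p (j, false)).2.
      exists false; move: fij e2; rewrite /f.
      by case: (p (i, false)) (p (j, false)) => [? ?] [? ?] /= -> ->.
    exists true; rewrite -[(j, true)]/(nu (j, false)) pC; move: fij e2; rewrite /f.
    case: (p (i, false)) (p (j, false)) => [? b] [? c] /= ->.
    by rewrite /nu /=; case: b c => [] [].
  by have [] := perm_inj ec.
exists (perm f_inj), [set j | (p (invF f_inj j, false)).2] => i.
by rewrite inE permE invF_f.
Qed.

Lemma E_false (s : seq V) (p : {perm X}) : nuC p ->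
  (forall i, word s (e i) = E (p (i, false))) -> forall x, word s (E x) = E (p x).
Proof.
move=> pC sP [i []]; last exact: sP.
by rewrite -[(i, true)]/(nu (i, false)) pC !E_nu linearN /= -sP.
Qed.

Lemma realize_B (p : {perm X}) : nuC p ->
  exists2 s, {subset s <= rootsB} & forall x, word s (E x) = E (p x).
Proof.
move=> pC; have [q [S pE]] := nuC_decomp pC.
have [t tD tP] := realize_perm k0 frame_fP q.
exists (map e (enum S) ++ t).
  apply/sub_cat; split; last exact/rootsD_B/diffs_D.
  by move=> _ /mapP[i _ ->]; rewrite mem_cat map_f ?orbT // mem_enum.
apply: E_false => // i; rewrite word_cat tP flips_B ?enum_uniq // pE.
by rewrite mem_enum.
Qed.

(** If the number of sign changes were odd, leaving one out would give a permutation realised in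
    type D, hence an even one. Then [p], which differs from it by one flip, would be odd. *)
Lemma realize_D (p : {perm X}) : nuC p -> odd_perm p = false ->
  exists2 s, {subset s <= rootsD} & forall x, word s (E x) = E (p x).
Proof.
move=> pC pe; have [q [S pE]] := nuC_decomp pC.
have [t tD tP] := realize_perm k0 frame_fP q.
have [S_odd|S_even] := boolP (odd #|S|); last first.
  have [||s sD sP] := @flips_D (enum S); rewrite -?cardE ?enum_uniq //.
  exists (s ++ t); first by apply/sub_cat; split=> //; apply: diffs_D.
  by apply: E_false => // i; rewrite word_cat tP sP pE mem_enum.
have [i0 i0S] : exists i, i \in S by apply/card_gt0P; case: #|S| S_odd.
have [||s sD sP] := @flips_D (enum (S :\ i0)); rewrite -?cardE ?enum_uniq //.
  by move: S_odd; rewrite (cardsD1 i0) i0S /=.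
have stD : {subset s ++ t <= rootsD} by apply/sub_cat; split=> //; apply: diffs_D.
have [r [rC re rP]] := word_rootsD stD.
have e_p : p = (r * tperm (i0, false) (i0, true))%g.
  apply/permP => x; apply: E_inj; rewrite permM -rf_flip -rP -(word_cons dot).
  apply/esym/E_false => // i.
  rewrite word_cons word_cat tP sP pE mem_enum !inE.
  have [->|qi] := eqVneq (q i) i0.
    by rewrite i0S /= rf_self // -(dot_eq0 dot) eP eqxx mulr1.
  by case: ifP => _; rewrite ?linearN /= rf_ortho // eP (negPf qi) mulr0.
by move: pe; rewrite e_p odd_permM re odd_tperm xpair_eqE andbF.
Qed.

Definition nu_perm : {perm X} := perm (inv_inj nuK).

(** Inversion is applied to the abelian group generated by [p] and [nu]. Since [nu] is an
    involution, inverting it amounts to commuting with it. *)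
Lemma nuC_inversion (p : {perm X}) : nuC p ->
  exists2 g : {perm X}, nuC g & forall x, p (g (p x)) = g x.
Proof.
move=> pC.
have ab : abelian <<[set p; nu_perm]>>.
  rewrite abelian_gen; apply/centsP => a + b.
  have c1 : commute p nu_perm by apply/permP => x; rewrite !permM !permE pC.
  rewrite !inE => /orP[]/eqP -> /orP[]/eqP -> //; exact: commute_sym.
have [g gP] := orbit_inversion ab.
exists g => x; last by rewrite gP ?permKV // mem_gen // !inE eqxx.
have nuE y : nu_perm y = nu y by rewrite permE.
have := gP nu_perm x; rewrite mem_gen ?inE ?eqxx ?orbT // => /(_ isT).
rewrite nuE => ->; apply: (@perm_inj _ nu_perm).
by rewrite permKV nuE nuK.
Qed.

Lemma frame_neq0 i : e i != 0.
Proof. by rewrite -(dot_eq0 dot) eP eqxx mulr1. Qed.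

Lemma rootsB_neq0 s : {subset s <= rootsB} -> 0 \notin s.
Proof.
move=> sB; apply/negP => /sB; rewrite mem_cat => /orP[/rootsDP[x [y [xy]]]|].
  move/esym/eqP; rewrite subr_eq0 => /eqP/E_inj exy.
  by rewrite exy eqxx in xy.
by case/mapP=> i _ /esym/eqP; rewrite (negPf (frame_neq0 i)).
Qed.

Definition frame_seq := [seq E x | x <- enum {: X}].

Lemma E_span x : E x \in <<frame_seq>>%VS.
Proof. by rewrite memv_span // map_f // mem_enum. Qed.

Lemma rootsB_span s : {subset s <= rootsB} ->
  {subset s <= <<frame_seq>>%VS}.
Proof.
move=> sB v /sB; rewrite mem_cat => /orP[/rootsDP[x [y [_ ->]]]|].
  by rewrite rpredB ?E_span.
by case/mapP=> i _ ->; rewrite -[e i]/(E (i, false)) E_span.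
Qed.

Lemma invert_frame s g (p q : {perm X}) :
  {subset s <= rootsB} -> {subset g <= rootsB} ->
  (forall x, word s (E x) = E (p x)) -> (forall x, word g (E x) = E (q x)) ->
  (forall x, p (q (p x)) = q x) -> forall v, word s (word g (word s v)) = word g v.
Proof.
move=> sB gB sP gP pq v; rewrite -!word_cat; congr (fun_of_lfun _ _).
have sgsB : {subset (s ++ g) ++ s <= rootsB}.
  by apply/sub_cat; split=> //; apply/sub_cat.
apply: (@eq_word_on _ _ dot frame_seq);
  try exact: rootsB_neq0; try exact: rootsB_span.
by move=> _ /mapP[x _ ->]; rewrite !word_cat sP !gP sP pq.
Qed.

Lemma ambivalent_B : ambivalent dot rootsB.
Proof.
move=> s sB; have [p pC sP] := word_rootsB sB.
have [q qC pq] := nuC_inversion pC; have [g gB gP] := realize_B qC.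
by exists g => //; apply: (invert_frame sB gB sP gP).
Qed.

Lemma nuCX p i : nuC p -> nuC (p ^+ i)%g.
Proof.
move=> pC; elim: i => [|i IHi] x; first by rewrite !perm1.
by rewrite !expgS !permM pC IHi.
Qed.

(* A cycle containing a vector of the frame together with its opposite has even
   length, hence is an odd permutation. *)
Lemma negative_cycle (p : {perm X}) x : nuC p -> nu x \in porbit p x ->
  exists c : {perm X}, [/\ nuC c, odd_perm c & forall y, c (p y) = p (c y)].
Proof.
move=> pC nx; pose O := porbit p x.
have pO y : (p y \in O) = (y \in O).
  rewrite /O -!eq_porbit_mem; congr (_ == _).
  by have := porbit_perm p 1 y; rewrite expg1.
have nuO y : y \in O -> nu y \in O.
  move=> /porbitP[i ->]; rewrite -(nuCX i pC).
  by case/porbitP: nx => j ->; rewrite -permM -expgD mem_porbit.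
have nuOE y : (nu y \in O) = (y \in O).
  by apply/idP/idP => [/nuO|/nuO//]; rewrite nuK.
(* The cycle of [p] through [x], extended by the identity. *)
pose c0 y := if y \in O then p y else y.
have c0_inj : injective c0.
  move=> y z; rewrite /c0; case: ifP => yO; case: ifP => zO //.
  - exact: perm_inj.
  - by move=> eyz; move: zO; rewrite -eyz pO yO.
  - by move=> eyz; move: yO; rewrite eyz pO zO.
pose c := perm c0_inj.
have cE y : c y = if y \in O then p y else y by rewrite permE.
have cO i y : y \in O -> (c ^+ i)%g y = (p ^+ i)%g y /\ (p ^+ i)%g y \in O.
  move=> yO; elim: i => [|i [IH1 IH2]]; first by rewrite !perm1.
  by rewrite !expgSr !permM IH1 cE IH2 pO.
have cN i y : y \notin O -> (c ^+ i)%g y = y.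
  by move=> yO; elim: i => [|i IH]; rewrite ?perm1 // expgSr permM IH cE (negPf yO).
have O_even : odd #|O| = false.
  pose A := [set y in O | ~~ y.2].
  have -> : O = A :|: nu @: A.
    apply/setP => y; rewrite !inE; apply/idP/idP => [yO|].
      case y2 : y.2; rewrite ?yO //=; apply/imsetP.
      by exists (nu y); rewrite ?nuK // inE nuOE yO /= y2.
    case/orP => [/andP[]//|/imsetP[z]]; rewrite inE => /andP[zO _] ->.
    by rewrite nuOE.
  rewrite cardsU disjoint_setI0 ?cards0 ?subn0.
    by rewrite card_imset ?addnn ?odd_double //; apply: inv_inj nuK.
  rewrite disjoint_subset; apply/subsetP => y; rewrite !inE => /andP[_ y2].
  by apply/imsetP => -[z]; rewrite inE => /andP[_ z2] ey; rewrite ey /= z2 in y2.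
have cyc : porbits c = O |: [set [set y] | y in ~: O].
  have pcO y : y \in O -> porbit c y = O.
    move=> yO; have <- : porbit p y = O by apply/eqP; rewrite eq_porbit_mem.
    apply/setP => z; apply/porbitP/porbitP => -[i ->]; exists i.
      by have [->] := cO i y yO.
    by have [->] := cO i y yO.
  have pcN y : y \notin O -> porbit c y = [set y].
    move=> yO; apply/setP => z; rewrite inE; apply/porbitP/eqP => [[i ->]|->].
      by rewrite cN.
    by exists 0%N; rewrite perm1.
  apply/setP => A; rewrite !inE; apply/imsetP/idP => [[y _ ->]|].
    have [yO|yO] := boolP (y \in O); first by rewrite pcO ?eqxx.
    by rewrite pcN //; apply/orP; right; apply: imset_f; rewrite inE.
  case/predU1P => [->|/imsetP[y]]; first by exists x; rewrite ?pcO // porbit_id.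
  by rewrite inE => yO ->; exists y; rewrite ?pcN.
exists c; split=> [y||y].
- by rewrite !cE nuOE; case: ifP.
(* The sign compares the number of points, [#|O| + #|~: O|], with the number of orbits,
   [1 + #|~: O|]; as [#|O|] is even, these have different parity. *)
- rewrite /odd_perm cyc cardsU1 card_imset; last exact: set1_inj.
  rewrite (_ : O \notin _); last first.
    apply/imsetP => -[y]; rewrite inE => yO eO.
    by move: yO; rewrite eO inE eqxx.
  by rewrite -(cardsC O) oddD O_even /= addbN addbb.
- by rewrite !cE pO; case: ifP.
Qed.

(* Without such a cycle, a choice of one sign per frame vector is permuted. *)
Lemma positive_section (p : {perm X}) : nuC p ->
  (forall x, nu x \notin porbit p x) ->
  exists (d : T -> bool) (q : {perm T}), forall i, p (i, d i) = (q i, d (q i)).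
Proof.
move=> pC np; pose O x := porbit p x :|: porbit p (nu x).
pose r x := odflt x [pick y | y \in O x].
have rO x : r x \in O x.
  by rewrite /r; case: pickP => // /(_ x) /=; rewrite inE porbit_id.
have rE x y : O x = O y -> r x = r y.
  move=> eO; rewrite /r eO.
  by case: pickP => // /(_ y) /=; rewrite inE porbit_id.
have rnu x : r (nu x) = r x by apply: rE; rewrite /O nuK setUC.
have porb x : porbit p (p x) = porbit p x.
  by have := porbit_perm p 1 x; rewrite expg1.
have rp x : r (p x) = r x by apply: rE; rewrite /O -pC !porb.
(* Each [O x] consists of two opposite cycles; [Y] selects the one containing the representative
   [r x]. *)
pose Y x := x \in porbit p (r x).
have Yp x : Y (p x) = Y x by rewrite /Y rp -!eq_porbit_mem porb.
have Ynu x : Y (nu x) = ~~ Y x.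
  apply/idP/idP => [Yn|].
    apply/negP => Yx; have := np x; rewrite /Y rnu in Yn Yx.
    by rewrite -eq_porbit_mem in Yx; rewrite (eqP Yx) Yn.
  rewrite /Y rnu; have := rO x; rewrite inE porbit_sym => /orP[->//|].
  by rewrite porbit_sym.
have YE i b : Y (i, b) = (b == Y (i, true)).
  case: b; first by case: (Y _).
  by rewrite -[(i, true)]/(nu (i, false)) Ynu; case: (Y _).
pose d i := Y (i, true).
have dP i : Y (i, d i) by rewrite YE.
pose f i := (p (i, d i)).1.
have pf i : p (i, d i) = (f i, d (f i)).
  have := dP i; rewrite -Yp /f; case: (p _) => j b /=.
  by rewrite YE => /eqP ->.
have f_inj : injective f.
  move=> i j fij; have : p (i, d i) = p (j, d j) by rewrite !pf fij.
  by move/perm_inj => [].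
by exists d, (perm f_inj) => i; rewrite permE pf.
Qed.

Lemma ambivalent_D : ambivalent dot rootsD.
Proof.
move=> s sD; have [p [pC pe sP]] := word_rootsD sD.
have [/existsP[x nx]|/existsPn np] := boolP [exists x, nu x \in porbit p x].
  have [c [cC co pc]] := negative_cycle pC nx.
  have [q [qC qe pq]] : exists q : {perm X},
      [/\ nuC q, odd_perm q = false & forall x, p (q (p x)) = q x].
    have [q qC pq] := nuC_inversion pC.
    have [qo|qe] := boolP (odd_perm q); last by exists q; split=> //; apply: negPf.
    (* As [c] commutes with [p], composing with it preserves the inverting property, and it corrects
       the parity of [q]. *)
    exists (c * q)%g; split; first exact: nuCM.
      by rewrite odd_permM co qo.
    by move=> y; rewrite !permM pc pq.
  have [g gD gP] := realize_D qC qe.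
  by exists g => //; apply: (invert_frame (rootsD_B sD) (rootsD_B gD) sP gP).
(* In the frame [f] with changed signs, [s] is a permutation without signs. Type A then inverts it
   by reflections in differences of [f], which are roots of type D. *)
have [d [q dq]] := positive_section pC np; pose f i := E (i, d i).
have fP i j l : dot (f i) (f j - f l) = k * ((i == j)%:R - (i == l)%:R).
  have ff a b : dot (f a) (f b) = k * (a == b)%:R.
    rewrite dotE_frame /nu !xpair_eqE /=; have [->|_] := eqVneq a b.
      by rewrite eqxx /=; case: (d b) => /=; ring.
    by rewrite subr0.
  by rewrite dotDr dotNr !ff; ring.
have [q' q'P] := orbit_inversion (cycle_abelian q).
have [g gf gP] := realize_perm k0 fP q'.
have gD : {subset g <= rootsD}.
  by move=> _ /gf/diffsP[i [j [ij ->]]]; apply/rootsDP; exists (i, d i), (j, d j).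
have sf i : word s (f i) = f (q i) by rewrite sP dq.
exists g => // v; rewrite -!word_cat; congr (fun_of_lfun _ _).
have sgsD : {subset (s ++ g) ++ s <= rootsD}.
  by apply/sub_cat; split=> //; apply/sub_cat.
have Ef x : E x \in <<map f (enum T)>>%VS.
  have fi : f x.1 \in <<map f (enum T)>>%VS.
    by rewrite memv_span // map_f // mem_enum.
  have [ex|ex] := eqVneq x.2 (d x.1).
    by rewrite (_ : E x = f x.1) // /f -ex; case: (x).
  rewrite (_ : E x = - f x.1) ?rpredN // /f -E_nu /nu; congr E.
  by case: x ex {fi} => i b /=; case: b (d i) => [] [].
have Df u : {subset u <= rootsD} -> {subset u <= <<map f (enum T)>>%VS}.
  by move=> uD w /uD/rootsDP[x [y [_ ->]]]; rewrite rpredB.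
apply: (@eq_word_on _ _ dot (map f (enum T))); try exact/rootsB_neq0/rootsD_B;
  try exact: Df.
move=> _ /mapP[i _ ->]; rewrite !word_cat sf !gP sf q'P ?cycle_id //.
by rewrite permKV.
Qed.

End TypeBD.

(** * Roots of one length and frames *)

(** To be applied to the two Cartan integers of a pair of roots: their product is bounded by the
    Cauchy-Schwarz inequality, and their ratio is that of the squared lengths. *)
Lemma small_int_pairs (x y : int) : 0 < x * y -> x * y < 4 ->
  x = y \/ y = 2 * x \/ x = 2 * y \/ y = 3 * x \/ x = 3 * y.
Proof.
move=> h1 h2.
have xy (n m : int) : 0 < n -> n * m < 4 -> 0 < n * m ->
    n = m \/ m = 2 * n \/ n = 2 * m \/ m = 3 * n \/ n = 3 * m.
  move=> n0 nm4 nm0; have m0 : 0 < m by rewrite -(pmulr_rgt0 _ n0).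
  have n4 : n < 4 by apply: le_lt_trans nm4; rewrite ler_peMr //; lia.
  have : n = 1 \/ n = 2 \/ n = 3 by lia.
  by case=> [|[|]] e; move: nm4; rewrite e; lia.
have [x0|x0|x0] := ltgtP x 0; last by rewrite x0 mul0r in h1.
  by have := xy (- x) (- y); rewrite mulrNN => /(_ _ h2 h1); lia.
exact: xy.
Qed.

Section RootSystemFacts.
Variables (R : realType) (V : vectType R) (dot : {dot V for idfun}).
Local Notation rf := (reflection dot).
Variable Phi : seq V.
Hypotheses (HPhi : root_system dot Phi) (HcPhi : crystallographic dot Phi).
Implicit Types (a b d v : V) (M : seq V).

(** The last condition is what lets the roots orthogonal to [M] be treated separately, as in
    [ambivalent_perp]. *)
Definition component M := [/\ ambivalent dot M, M != [::],
  forall m, m \in M -> m != 0 /\ on_line Phi m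
  & forall a, a \in Phi -> on_line M a \/ forall m, m \in M -> dot a m = 0].

Lemma root_nz a : a \in Phi -> a != 0.
Proof. by apply: contraTneq => ->; apply: root_neq0 HPhi. Qed.

Lemma root_norm a : a \in Phi -> dot a a != 0.
Proof. by move=> /root_nz; rewrite dot_eq0. Qed.

Lemma root_opp a : a \in Phi -> - a \in Phi.
Proof.
move=> aP; rewrite -(rf_self dot (root_nz aP)).
exact: (root_reflection HPhi).
Qed.

Lemma on_line_rf a b : on_line Phi a -> on_line Phi b -> on_line Phi (rf a b).
Proof.
move=> [c c0 ca] [d d0 db]; exists d => //.
by rewrite -linearZ -(rfZ dot a c0); apply: (root_reflection HPhi).
Qed.

Lemma on_lineN Q a : on_line Q a -> on_line Q (- a).
Proof. by rewrite -scaleN1r; apply: on_lineZ; rewrite oppr_eq0 oner_eq0. Qed.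

Definition unit_int (x : R) := [|| x == -1, x == 0 | x == 1].

Lemma unit_intP x : reflect [\/ x = -1, x = 0 | x = 1] (unit_int x).
Proof.
apply: (iffP or3P) => [[]/eqP ->|[] ->]; rewrite ?eqxx;
  by [constructor 1 | constructor 2 | constructor 3].
Qed.

Lemma unit_intN x : unit_int (- x) = unit_int x.
Proof. by apply/unit_intP/unit_intP => -[] h; [constructor 3|constructor 2|
  constructor 1|constructor 3|constructor 2|constructor 1]; lra. Qed.

Lemma int_bounds (x : R) : x \is a Num.int -> -2 < x -> x < 2 -> unit_int x.
Proof.
case/intrP=> z ->.
rewrite -[2]/(2%:~R) -[- _]/((-2)%:~R) !ltr_int => z1 z2.
have : [\/ z = -1, z = 0 | z = 1] by case: z z1 z2 => [[|[|]]|[|[|]]] //=; 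
  by [constructor 1 | constructor 2 | constructor 3].
by case=> ->; apply/unit_intP; [constructor 1 | constructor 2 | constructor 3].
Qed.

(** The roots of the singled-out length after rescaling. Squared norm 2 makes their pairings equal
    to Cartan numbers; other roots of [Phi] may well be longer. *)
Definition long a := (a \in Phi) && (dot a a == 2).

Lemma longP a : long a -> a \in Phi /\ dot a a = 2.
Proof. by case/andP=> ? /eqP. Qed.

Lemma longN a : long a -> long (- a).
Proof. by case/longP=> aP a2; rewrite /long root_opp // !dotE a2; apply/eqP; ring. Qed.

Lemma long_rf a b : on_line Phi b -> long a -> long (rf b a).
Proof.
move=> [c c0 cb] /longP[aP a2]; rewrite /long dot_rf a2 eqxx andbT.
by rewrite -(rfZ dot b c0); apply: (root_reflection HPhi).
Qed.

Lemma long_line a : long a -> on_line Phi a.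
Proof. by case/longP=> /mem_on_line. Qed.

Lemma long_neq0 a : long a -> a != 0.
Proof. by case/longP=> /root_nz. Qed.

Lemma dot_eq_norm (x : R) a b : dot a a = x -> dot b b = x -> dot a b = x -> a = b.
Proof.
move=> ha hb hab; apply/eqP; rewrite -subr_eq0 -(dot_eq0 dot) !dotE (dotC dot b a).
by rewrite ha hb hab; apply/eqP; ring.
Qed.

Lemma long_dot a b : long a -> long b -> [\/ a = b, a = - b | unit_int (dot a b)].
Proof.
move=> /longP[aP a2] /longP[bP b2].
have ab : dot a b \is a Num.int.
  by have := HcPhi bP aP; rewrite /cartan_number b2 mulrAC divff ?pnatr_eq0 // mul1r.
have h1 : 0 <= 4 - 2 * dot a b.
  by have := dot_ge0 dot (a - b); rewrite !dotE (dotC dot b a) a2 b2; lra.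
have h2 : 0 <= 4 + 2 * dot a b.
  by have := dot_ge0 dot (a + b); rewrite !dotE (dotC dot b a) a2 b2; lra.
have [e|ne] := eqVneq (dot a b) 2; first by constructor 1; apply: (dot_eq_norm a2 b2 e).
have [e|ne'] := eqVneq (dot a b) (-2).
  constructor 2; apply: (dot_eq_norm a2); rewrite !dotE ?b2 ?e; ring.
constructor 3; apply: int_bounds => //; rewrite lt_neqAle.
  by rewrite eq_sym ne' /=; lra.
by rewrite ne /=; lra.
Qed.

Lemma longB a b : long a -> long b -> dot a b = 1 -> long (a - b).
Proof.
move=> La Lb ab; have := long_rf (long_line Lb) La.
case/longP: Lb => _ b2; rewrite rfE ab b2 (_ : 2 * 1 / 2 = 1) ?scale1r //.
by field.
Qed.

Lemma longD a b : long a -> long b -> dot a b = -1 -> long (a + b).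
Proof.
move=> La /longN Lb ab; rewrite -[b]opprK; apply: longB => //.
by rewrite dotNr ab opprK.
Qed.

(* A root that is not long, but not orthogonal to all long roots, rescaled so
   that its pairings with the long roots are 0, 1 or -1. *)
Definition short d := [/\ on_line Phi d, dot d d = 1 \/ dot d d = 2 / 3
  & forall a, long a -> unit_int (dot d a)].

Lemma short_neq0 d : short d -> d != 0.
Proof.
case=> _ dd _; apply/negP => /eqP d0; move: dd; rewrite d0 dot0l.
by case=> [/eqP|]; [rewrite eq_sym oner_eq0 | lra].
Qed.

Lemma short_rf d a : short d -> long a -> dot d a = 1 ->
  (dot d d = 1 /\ long (a - 2 *: d)) \/ (dot d d = 2 / 3 /\ long (a - 3 *: d)).
Proof.
case=> dP dd _ La da; have := long_rf dP La; rewrite rfE (dotC dot a d) da.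
case: dd => ->.
  by rewrite (_ : 2 * 1 / 1 = 2) => [h|]; [left | field].
by rewrite (_ : 2 * 1 / (2 / 3) = 3) => [h|]; [right | field].
Qed.

(** Equality in the Cauchy-Schwarz inequality would make [c] a multiple of [a], hence [a] or [- a]
    because the system is reduced, and then [c] would be long. *)
Lemma cauchy_long a c : long a -> c \in Phi -> ~~ long c ->
  dot c a * dot c a < 2 * dot c c.
Proof.
move=> La cP cN; have [aP a2] := longP La.
have h : dot (2 *: c - dot c a *: a) (2 *: c - dot c a *: a)
    = 2 * (2 * dot c c - dot c a * dot c a).
  by rewrite !dotE (dotC dot a c) a2; ring.
have := dot_ge0 dot (2 *: c - dot c a *: a); rewrite h pmulr_rge0 // subr_ge0.
rewrite le_eqVlt => /predU1P[e|//].
have /eqP : 2 *: c - dot c a *: a = 0.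
  by apply/eqP; rewrite -(dot_eq0 dot) h e; apply/eqP; ring.
rewrite subr_eq0 => /eqP e2.
have ec : c = (dot c a / 2) *: a.
  by rewrite mulrC -scalerA -e2 scalerA mulVf ?scale1r // pnatr_eq0.
have := root_reduced HPhi (dot c a / 2) aP; rewrite -ec cP.
move=> /esym/orP[]/eqP ek; move: cN; rewrite ec ek ?scale1r ?La //.
by rewrite scaleN1r longN.
Qed.

Lemma sqr_int (x : R) : x \is a Num.int -> x * x < 4 -> unit_int x.
Proof. by move=> xi x4; apply: int_bounds => //; nra. Qed.

(** Integrality leaves the squared norms 1, 4, 2/3 and 6 for [c], and the factors 1, 1/2, 1 and 1/3
    bring them to 1 or 2/3. For the two larger norms, the scaled pairing with a long root is the
    Cartan number taken in the other direction, hence still an integer. *)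
Lemma short_exists a c : long a -> c \in Phi -> ~~ long c -> dot c a != 0 ->
  exists2 k : R, k != 0 & short (k *: c).
Proof.
move=> La cP cN ca0; have [aP a2] := longP La.
have c0 : dot c c != 0 by apply: root_norm.
have c_gt : 0 < dot c c by rewrite lt_def c0 dot_ge0.
have int1 b : long b -> dot c b \is a Num.int.
  move=> /longP[bP b2]; have := HcPhi bP cP.
  by rewrite /cartan_number b2 mulrAC divff ?pnatr_eq0 // mul1r.
have int2 b : long b -> 2 * dot c b / dot c c \is a Num.int.
  by move=> /longP[bP b2]; rewrite (dotC dot c b); apply: HcPhi.
have shortZ (n k : R) : dot c c = n -> k != 0 -> k * k * n = 1 \/ k * k * n = 2 / 3 ->
    (forall b, long b -> k * dot c b \is a Num.int) -> 2 * k * k * n < 4 ->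
    exists2 k : R, k != 0 & short (k *: c).
  move=> cn k0 kn ki k4; exists k => //; split.
  - exact/(on_lineZ k0)/mem_on_line.
  - by rewrite !dotE mulrA cn.
  - move=> b Lb; rewrite dotZl; apply: sqr_int; first exact: ki.
    have k2 : 0 < k * k by rewrite lt_def mulf_neq0 //= -expr2 sqr_ge0.
    by have := cauchy_long Lb cP cN; rewrite cn; nra.
have /intrP[z ez] := int1 a La; have /intrP[z' ez'] := int2 a La.
have hz : z'%:~R * dot c c = 2 * z%:~R :> R by rewrite -ez' ez; field.
have z0 : z%:~R != 0 :> R by rewrite -ez.
have z2 : 0 < z%:~R * z%:~R :> R by rewrite lt_def mulf_neq0 //= -expr2 sqr_ge0.
have zzE : (z * z')%:~R = 2 * (z%:~R * z%:~R) / dot c c :> R.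
  by rewrite intrM -ez' ez; field.
have zz1 : 0 < z * z' by rewrite -(ltr0z R) zzE; apply: divr_gt0 => //; apply: mulr_gt0.
have zz2 : z * z' < 4.
  rewrite -(ltr_int R) zzE ltr_pdivrMr //.
  by have := cauchy_long La cP cN; rewrite ez (_ : 4%:~R = 4 :> R) //;
    set u := _ * _; set n := dot c c; lra.
have := small_int_pairs zz1 zz2.
have two0 : (2 : R) != 0 by rewrite pnatr_eq0.
have three0 : (3 : R) != 0 by rewrite pnatr_eq0.
have nE (x : R) : x != 0 -> z'%:~R = x * z%:~R -> dot c c = 2 / x.
  move=> x0 e; apply: (mulfI z0); apply: (mulfI x0).
  by rewrite mulrA -e hz; field.
case=> [e|[e|[e|[e|e]]]].
- move: cN; rewrite /long cP (nE 1) ?oner_eq0 //; last by rewrite e mul1r.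
  by rewrite divr1 eqxx.
- apply: (shortZ 1 1); rewrite ?oner_eq0 // ?mulr1; [|by left| |by lra].
    by rewrite (nE 2) ?divff // e intrM.
  by move=> b Lb; rewrite mul1r int1.
- apply: (shortZ 4 (1 / 2)); [|by lra|by left; field| |by lra].
    by rewrite (nE (1 / 2)); [by field|lra|by rewrite e intrM; field].
  move=> b Lb; have := int2 b Lb; rewrite (nE (1 / 2)); [|lra|by rewrite e intrM; field].
  by rewrite (_ : 2 * _ / _ = 1 / 2 * dot c b) //; by field.
- apply: (shortZ (2 / 3) 1); rewrite ?oner_eq0 // ?mul1r; [|by right| |by lra].
    by rewrite (nE 3) // e intrM.
  by move=> b Lb; rewrite mul1r int1.
- apply: (shortZ 6 (1 / 3)); [|by lra|by right; field| |by lra].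
    by rewrite (nE (1 / 3)); [by field|lra|by rewrite e intrM; field].
  move=> b Lb; have := int2 b Lb; rewrite (nE (1 / 3)); [|lra|by rewrite e intrM; field].
  by rewrite (_ : 2 * _ / _ = 1 / 3 * dot c b) //; by field.
Qed.

(** A root that is neither long nor proportional to a short one is orthogonal to all long roots, and
    the fourth condition then makes it orthogonal to [M]. *)
Lemma component_intro M : ambivalent dot M -> M != [::] ->
  (forall m, m \in M -> m != 0 /\ on_line Phi m) ->
  (forall m v, m \in M -> (forall a, long a -> dot v a = 0) -> dot v m = 0) ->
  (forall a, long a -> on_line M a \/ forall m, m \in M -> dot a m = 0) ->
  (forall d, short d -> on_line M d \/ forall m, m \in M -> dot d m = 0) ->
  component M.
Proof.
move=> ambM M0 MPhi Mspan ML MS; split=> // a aP.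
have [La|aN] := boolP (long a); first exact: ML.
have [[b [Lb ab]]|no] := pselect (exists b, long b /\ dot a b != 0).
  have [k k0 /MS] := short_exists Lb aP aN ab; case=> [/(on_lineVZ k0)|h].
    by left.
  right=> m /h/eqP; rewrite dotZl mulf_eq0 (negPf k0) => /eqP //.
right=> m mM; apply: Mspan => // b Lb; apply/eqP/negPn/negP => ab.
by apply: no; exists b.
Qed.

End RootSystemFacts.

Section Frames.
Variables (R : realType) (V : vectType R) (dot : {dot V for idfun}).
Variable Phi : seq V.
Hypotheses (HPhi : root_system dot Phi) (HcPhi : crystallographic dot Phi).
Local Notation long := (long dot Phi).
Local Notation dC := (dotC dot).

(** Only differences are constrained, since the members are determined by the roots only up to a
    common translation. *)
Definition Aframe (T : finType) (f : T -> V) :=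
  (forall i j l m, dot (f i - f j) (f l - f m) =
     (i == l)%:R - (i == m)%:R - (j == l)%:R + (j == m)%:R)
  /\ forall i j, i != j -> long (f i - f j).

Definition Dframe (T : finType) (e : T -> V) :=
  (forall i j, dot (e i) (e j) = (i == j)%:R)
  /\ forall i j, i != j -> long (e i + e j) /\ long (e i - e j).

Lemma frame_bound (T : finType) (F : T -> T -> V) : (forall i, injective (F i)) ->
  (forall i j, i != j -> F i j \in Phi) -> (#|T| <= (size Phi).+1)%N.
Proof.
move=> F_inj FP; case: (pickP (@predT T)) => [i _|/eq_card0 -> //].
rewrite (cardD1 i) inE add1n ltnS cardE -(size_map (F i)).
apply: uniq_leq_size; first by rewrite map_inj_uniq ?enum_uniq.
by move=> _ /mapP[j + ->]; rewrite mem_enum !inE andbT eq_sym => /FP.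
Qed.

Lemma max_frame (P : forall T : finType, (T -> V) -> Prop) (B : nat)
    (T0 : finType) (f0 : T0 -> V) :
  (forall T f, P T f -> (#|T| <= B)%N) -> P T0 f0 ->
  exists (T : finType) (f : T -> V),
    P T f /\ forall T' f', P T' f' -> (#|T'| <= #|T|)%N.
Proof.
move=> PB P0; pose Q n := `[< exists (T : finType) (f : T -> V), P T f /\ #|T| = n >].
have exQ : exists n, Q n by exists #|T0|; apply/asboolP; exists T0, f0.
have Qle n : Q n -> (n <= B)%N by move=> /asboolP[T [f [Pf <-]]]; apply: PB Pf.
case: (ex_maxnP exQ Qle) => n /asboolP[T [f [Pf <-]]] maxn.
by exists T, f; split=> // T' f' Pf'; apply: maxn; apply/asboolP; exists T', f'.
Qed.

Lemma Aframe_bound T f : @Aframe T f -> (#|T| <= (size Phi).+1)%N.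
Proof.
move=> [fG fL]; apply: (@frame_bound T (fun i j => f i - f j)).
  move=> i j l /addrI/oppr_inj fjl; apply/eqP/negPn/negP => jl.
  have := fG j l j l; rewrite fjl subrr dot0l !eqxx (eq_sym l j) (negPf jl) /=.
  by lra.
by move=> i j /fL/longP[].
Qed.

Lemma Dframe_bound T e : @Dframe T e -> (#|T| <= (size Phi).+1)%N.
Proof.
move=> [eG eL]; apply: (@frame_bound T (fun i j => e i + e j)).
  move=> i j l /addrI ejl; apply/eqP/negPn/negP => jl.
  by have /eqP := eG j l; rewrite -ejl eG eqxx (negPf jl) oner_eq0.
by move=> i j /eL[/longP[]].
Qed.

(** With [f i] moved to the origin, the new member is [- b]. Its differences with the others are
    roots because [b] pairs to -1 with each [f l - f i]. *)
Lemma Aframe_ext T f b i : @Aframe T f -> long b ->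
  (forall l, l != i -> dot b (f i - f l) = 1) ->
  exists (T' : finType) f', @Aframe T' f' /\ #|T'| = #|T|.+1.
Proof.
move=> [fG fL] Lb bi; have [_ b2] := longP Lb.
pose h o := if o is Some j then f j - f i else - b.
have bh j : dot b (f j - f i) = (j == i)%:R - 1.
  have [->|ji] := eqVneq j i; first by rewrite !subrr dot0r.
  by rewrite -opprB dotNr bi // sub0r.
have hG o o' : dot (h o) (h o') = (o == o')%:R - (o == Some i)%:R - (o' == Some i)%:R + 1.
  case: o o' => [j|] [l|] /=.
  - by rewrite fG eqxx (inj_eq Some_inj) (eq_sym i l); congr (_ - _ - _ + _).
  - by rewrite dotNr dC bh -[Some j == Some i]/(j == i) /=; ring.
  - by rewrite dotNl bh -[Some l == Some i]/(l == i) /=; ring.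
  - by rewrite !dotE b2 /=; ring.
exists (option T), h; split; last by rewrite card_option.
split=> [o1 o2 o3 o4|]; first by rewrite !dotE !hG; ring.
have hi j : j != i -> long (f j - f i + b).
  move=> ji; apply: longD => //; first exact: fL.
  by rewrite dC bh (negPf ji) sub0r.
move=> [j|] [l|] //= jl.
- have -> : f j - f i - (f l - f i) = f j - f l by vec dot.
  by apply: fL.
- rewrite opprK; have [->|/hi//] := eqVneq j i.
  by rewrite subrr add0r.
- have -> : - b - (f l - f i) = - (f l - f i + b) by vec dot.
  apply: longN => //; have [->|/hi//] := eqVneq l i.
  by rewrite subrr add0r.
Qed.

(** The new member is [n = b - s *: e i], the part of [b] orthogonal to the frame, of squared norm 2
    - 1 = 1. For [j != i], [n + e j] and [n - e j] are differences of long roots pairing to 1. *)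
Lemma Dframe_ext T e b i (s : R) : @Dframe T e -> (1 < #|T|)%N -> long b ->
  s = 1 \/ s = -1 -> (forall j, dot b (e j) = s * (j == i)%:R) ->
  exists (T' : finType) e', @Dframe T' e' /\ #|T'| = #|T|.+1.
Proof.
move=> [eG eL] T1 Lb s1 bE; have [_ b2] := longP Lb.
have ss : s * s = 1 by case: s1 => ->; ring.
have sL j : j != i -> long (s *: e i + e j) /\ long (s *: e i - e j).
  rewrite eq_sym => /eL[Lp Lm]; case: s1 => ->; rewrite ?scale1r // scaleN1r.
  split; first by rewrite (_ : - e i + e j = - (e i - e j)) ?longN //; vec dot.
  by rewrite -opprD; apply: longN.
have [n nE] : exists n, n = b - s *: e i by exists (b - s *: e i).
pose e' o := if o is Some j then e j else n.
have ne j : dot n (e j) = 0.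
  by rewrite nE dotDl dotNl dotZl bE eG (eq_sym i j); ring.
have nn : dot n n = 1.
  rewrite nE !dotE (dC _ b) b2 !bE eG !eqxx /=.
  by transitivity (2 - s * s); [ring | rewrite ss; ring].
exists (option T), e'; split; last by rewrite card_option.
have eG' o o' : dot (e' o) (e' o') = (o == o')%:R.
  by case: o o' => [j|] [l|] /=; rewrite ?ne ?nn ?[dot _ n]dC ?ne ?eG.
have nL j : j != i -> long (n + e j) /\ long (n - e j).
  move=> ji; have [Lp Lm] := sL j ji.
  have -> : n + e j = b - (s *: e i - e j) by rewrite nE; vec dot.
  have -> : n - e j = b - (s *: e i + e j) by rewrite nE; vec dot.
  split; apply: longB => //; rewrite !dotE !bE eqxx (negPf ji) /=.
    by transitivity (s * s); [ring | rewrite ss].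
  by transitivity (s * s); [ring | rewrite ss].
have [l li] : exists l, l != i.
  have /card_gt1P[x [y [_ _ xy]]] := T1.
  by have [exi|xi] := eqVneq x i; [exists y; rewrite -exi eq_sym | exists x].
have nsi : long (n + s *: e i) /\ long (n - s *: e i).
  split; first by rewrite nE subrK.
  (* Here [b] and the vector to subtract are not two roots pairing to 1, so the root is reached
     through a second index [l]. *)
  have -> : n - s *: e i = (n + e l) - (s *: e i + e l) by vec dot.
  apply: longB => //; [by case: (nL l li)|by case: (sL l li)|].
  rewrite !dotE !ne !eG eqxx (negPf li) /=.
  by ring.
have nLi j : long (n + e j) /\ long (n - e j).
  have [->|/nL//] := eqVneq j i.
  case: s1 nsi => -> []; rewrite ?scale1r ?scaleN1r ?opprK; by split.
split=> // -[j|] [m|] //= jm; first exact: eL.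
  case: (nLi j) => Lp Lm; rewrite addrC; split=> //.
  by rewrite -opprB; apply: longN.
Qed.

Lemma Dframe_sign (T : finType) e (s : T -> R) : @Dframe T e ->
  (forall i, s i = 1 \/ s i = -1) -> Dframe (fun i => s i *: e i).
Proof.
move=> [eG eL] s1; split=> [i j|i j ij].
  rewrite !dotE eG; have [->|_] := eqVneq i j; last by rewrite !mulr0.
  by case: (s1 j) => ->; rewrite /=; ring.
have [Lp Lm] := eL i j ij.
case: (s1 i) => ->; case: (s1 j) => ->; rewrite ?scale1r ?scaleN1r ?opprK //.
  split; first by rewrite addrC -opprB; apply: longN.
  by rewrite -opprD; apply: longN.
split; first by rewrite -opprD; apply: longN.
by rewrite addrC -opprB; apply: longN.
Qed.

(* The last three cases are the zero, vector and spin weights of type D. *)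
Lemma D_pattern T e v : @Dframe T e -> (1 < #|T|)%N ->
  (forall a, long a -> a = v \/ a = - v \/ unit_int (dot v a)) ->
  [\/ (exists i j, i != j /\ (v = e i + e j \/ v = e i - e j \/ v = - (e i + e j))),
      (forall i, dot v (e i) = 0),
      (exists i s, (s = 1 \/ s = -1) /\ forall j, dot v (e j) = s * (j == i)%:R)
    | (forall i, dot v (e i) = 1 / 2 \/ dot v (e i) = - (1 / 2))].
Proof.
move=> [eG eL] T1 vL.
have [?|nroot] := pselect (exists i j, i != j /\
  (v = e i + e j \/ v = e i - e j \/ v = - (e i + e j))); first by constructor 1.
have hp i j : i != j -> unit_int (dot v (e i) + dot v (e j)).
  move=> ij; have [/vL h _] := eL i j ij; rewrite -dotDr.
  case: h => [h|[h|//]]; case: nroot; exists i, j; split=> //; first by left.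
  by right; right; rewrite h opprK.
have hm i j : i != j -> unit_int (dot v (e i) - dot v (e j)).
  move=> ij; have [_ /vL h] := eL i j ij; rewrite -dotNr -dotDr.
  case: h => [h|[h|//]]; case: nroot.
    by exists i, j; split=> //; right; left.
  by exists j, i; rewrite eq_sym; split=> //; right; left; rewrite -opprB h opprK.
have other (i : T) : exists j, i != j.
  have /card_gt1P[x [y [_ _ xy]]] := T1.
  by have [->|xi] := eqVneq i x; [exists y | exists x].
have vals i : [\/ dot v (e i) = 0, dot v (e i) = 1 \/ dot v (e i) = -1
    | dot v (e i) = 1 / 2 \/ dot v (e i) = - (1 / 2)].
  have [j ij] := other i.
  case/unit_intP: (hp i j ij) => x; case/unit_intP: (hm i j ij) => y;
    [constructor 2; right|constructor 3; right|constructor 1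
    |constructor 3; right|constructor 1|constructor 3; left
    |constructor 1|constructor 3; left|constructor 2; left]; lra.
have [[i hi]|no1] := pselect (exists i, dot v (e i) = 1 \/ dot v (e i) = -1).
  constructor 3; exists i, (dot v (e i)); split=> // j.
  have [->|ji] := eqVneq j i; rewrite ?mulr1 ?mulr0 //=.
  rewrite eq_sym in ji; case/unit_intP: (hp i j ji) => x;
  case/unit_intP: (hm i j ji) => y; case: hi => hi; lra.
have [[i hi]|no2] := pselect (exists i, dot v (e i) = 1 / 2 \/ dot v (e i) = - (1 / 2)).
  constructor 4 => j; have [->//|ji] := eqVneq j i.
  case: (vals j) => // hj; last by case: no1; exists j.
  rewrite eq_sym in ji; case/unit_intP: (hp i j ji) => x; case: hi => hi; lra.
constructor 2 => i; case: (vals i) => // hi; first by case: no1; exists i.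
by case: no2; exists i.
Qed.

End Frames.

(** * Components with a frame of type D *)

Section TypeDComponents.
Variables (R : realType) (V : vectType R) (dot : {dot V for idfun}).
Local Notation rf := (reflection dot).
Variable Phi : seq V.
Hypotheses (HPhi : root_system dot Phi) (HcPhi : crystallographic dot Phi).
Local Notation long := (long dot Phi).
Local Notation short := (short dot Phi).
Local Notation component := (component dot Phi).
Local Notation Dframe := (Dframe dot Phi).
Local Notation dC := (dotC dot).

Lemma bessel_eq (T : finType) (e : T -> V) v :
  (forall i j, dot (e i) (e j) = (i == j)%:R) ->
  dot (v - \sum_i dot v (e i) *: e i) (v - \sum_i dot v (e i) *: e i)
  = dot v v - \sum_i dot v (e i) * dot v (e i).
Proof.
move=> eG; set u := \sum_i _.
have ue j : dot u (e j) = dot v (e j).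
  rewrite dot_suml (bigD1 j) //= big1 ?addr0 => [|i ij].
    by rewrite dotZl eG eqxx mulr1.
  by rewrite dotZl eG (negPf ij) mulr0.
have uv w : dot u w = \sum_i dot v (e i) * dot w (e i).
  by rewrite dot_suml; apply: eq_bigr => i _; rewrite dotZl (dC (e i) w).
have uu : dot u u = \sum_i dot v (e i) * dot v (e i).
  by rewrite uv; apply: eq_bigr => i _; rewrite ue.
by rewrite !dotE uu (dC v u) uv; ring.
Qed.

Lemma half_norm (T : finType) (e : T -> V) v :
  (forall i j, dot (e i) (e j) = (i == j)%:R) ->
  (forall i, dot v (e i) = 1 / 2 \/ dot v (e i) = - (1 / 2)) ->
  (#|T|%:R / 4 <= dot v v) /\
  (dot v v = #|T|%:R / 4 -> v = \sum_i dot v (e i) *: e i).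
Proof.
move=> eG vh.
have hs : \sum_i dot v (e i) * dot v (e i) = #|T|%:R / 4.
  rewrite (eq_bigr (fun=> 1 / 4)); last by move=> i _; case: (vh i) => ->; field.
  by rewrite sumr_const mul1r mulr_natl.
have := bessel_eq v eG; rewrite hs => h; split.
  by rewrite -subr_ge0 -h dot_ge0.
by move=> e0; apply/eqP; rewrite -subr_eq0 -(dot_eq0 dot) h e0 subrr.
Qed.

Section OneFrame.
Variables (T : finType) (e : T -> V).
Hypotheses (De : Dframe e) (T2 : (2 < #|T|)%N).
Local Notation E := (sframe e).

Let eG i j : dot (e i) (e j) = (i == j)%:R := De.1 i j.

Lemma frame_k i j : dot (e i) (e j) = 1 * (i == j)%:R.
Proof. by rewrite mul1r eG. Qed.

Lemma rootsD_long m : m \in rootsD e -> long m.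
Proof.
case/rootsDP=> -[i b] [[j c] [/= ij ->]]; have [Lp Lm] := De.2 i j ij.
case: b; case: c; rewrite /sframe /= ?opprK //.
- by have := longN HPhi Lm; rewrite opprB addrC.
- by have := longN HPhi Lp; rewrite opprD.
Qed.

Lemma other_index i : exists j : T, i != j.
Proof.
have /card_gt1P[x [y [_ _ xy]]] := ltnW T2.
by have [->|xi] := eqVneq i x; [exists y | exists x].
Qed.

Lemma frame_span v i : (forall a, long a -> dot v a = 0) -> dot v (e i) = 0.
Proof.
move=> vL; have [j ij] := other_index i; have [Lp Lm] := De.2 i j ij.
by move: (vL _ Lp) (vL _ Lm); rewrite !dotE; lra.
Qed.

Lemma rootsB_ortho v m : (forall i, dot v (e i) = 0) -> m \in rootsB e ->
  dot v m = 0.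
Proof.
move=> ve; have vE x : dot v (E x) = 0.
  by rewrite /sframe; case: ifP; rewrite ?dotNr ve ?oppr0.
rewrite mem_cat => /orP[/rootsDP[x [y [_ ->]]]|/mapP[i _ ->]] //.
by rewrite dotDr dotNr !vE subr0.
Qed.

Lemma rootsD_nonempty : rootsD e != [::].
Proof.
have /card_gt1P[i [j [_ _ ij]]] := ltnW T2.
have : E (i, false) - E (j, false) \in rootsD e.
  by apply/rootsDP; exists (i, false), (j, false).
by case: (rootsD e).
Qed.

Lemma frame_root i : e i \in rootsB e.
Proof. by rewrite mem_cat map_f ?orbT // mem_enum. Qed.

Lemma long_frame_cases v : long v -> [\/ v \in rootsD e,
      (forall i, dot v (e i) = 0),
      (exists i s, (s = 1 \/ s = -1) /\ forall j, dot v (e j) = s * (j == i)%:R)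
    | (forall i, dot v (e i) = 1 / 2 \/ dot v (e i) = - (1 / 2))].
Proof.
move=> Lv; have vL a : long a -> a = v \/ a = - v \/ unit_int (dot v a).
  move=> La; case: (long_dot HcPhi La Lv) => [->|->|h]; [by left|by right; left|].
  by right; right; rewrite dC.
case: (D_pattern De (ltnW T2) vL) => [[i [j [ij h]]]|h|h|h];
  [constructor 1|constructor 2|constructor 3|constructor 4] => //.
apply/rootsDP; case: h => [->|[->|->]].
- by exists (i, false), (j, true); rewrite /sframe /= opprK.
- by exists (i, false), (j, false).
- by exists (i, true), (j, false); rewrite /sframe /= opprD.
Qed.

Lemma short_frame_cases d : short d -> [\/ (forall i, dot d (e i) = 0),
      (exists i s, (s = 1 \/ s = -1) /\ d = s *: e i)
    | (forall i, dot d (e i) = 1 / 2 \/ dot d (e i) = - (1 / 2))].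
Proof.
move=> Sd; have [dP dd dL] := Sd.
have vL a : long a -> a = d \/ a = - d \/ unit_int (dot d a).
  by move=> La; right; right; apply: dL.
case: (D_pattern De (ltnW T2) vL) => [[i [j [ij h]]]|h|[i [s [s1 h]]]|h];
  [exfalso|by constructor 1| |by constructor 3].
  have d2 : dot d d = 2.
    case: h => [->|[->|->]]; rewrite !dotE !eG !eqxx (eq_sym j i) (negPf ij) /=; ring.
  by case: dd; rewrite d2; lra.
constructor 2; exists i, s; split=> //.
have ss : s * s = 1 by case: s1 => ->; ring.
have n0 : dot (d - s *: e i) (d - s *: e i) = dot d d - 1.
  rewrite !dotE (dC _ d) !h eG !eqxx /=.
  by transitivity (dot d d - s * s); [ring | rewrite ss].
have d1 : dot d d = 1.
  by case: dd => // d23; have := dot_ge0 dot (d - s *: e i); rewrite n0 d23; lra.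
by apply/eqP; rewrite -subr_eq0 -(dot_eq0 dot) n0 d1 subrr.
Qed.

Hypothesis HL : forall a, long a -> a \in rootsD e \/ forall i, dot a (e i) = 0.

Lemma component_D : (forall d, short d -> forall i, dot d (e i) = 0) ->
  component (rootsD e).
Proof.
move=> HS; apply: (component_intro HPhi HcPhi).
- exact: (ambivalent_D (oner_neq0 _) frame_k).
- exact: rootsD_nonempty.
- by move=> m /rootsD_long Lm; split; [apply: long_neq0 Lm | apply: long_line Lm].
- by move=> m v /rootsD_long Lm vL; apply: vL.
- move=> a /HL[aD|aO]; [by left; apply: mem_on_line|right=> m mD].
  by apply: rootsB_ortho => //; rewrite mem_cat mD.
- move=> d /HS dO; right=> m mD.
  by apply: rootsB_ortho => //; rewrite mem_cat mD.
Qed.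

Lemma on_line_frame i : on_line Phi (e i) -> forall j, on_line Phi (e j).
Proof.
move=> iP j; have [<-//|ij] := eqVneq i j.
have [_ Lm] := De.2 i j ij; have [_ m2] := longP Lm.
rewrite (_ : e j = rf (e i - e j) (e i)).
  by apply: on_line_rf => //; apply: long_line Lm.
rewrite rfE m2 dotDr dotNr !eG eqxx (negPf ij) /= (_ : _ / _ = 1) ?scale1r; last by field.
by vec dot.
Qed.

Lemma component_B i : on_line Phi (e i) ->
  (forall d, short d -> (exists i s, (s = 1 \/ s = -1) /\ d = s *: e i)
      \/ forall i, dot d (e i) = 0) ->
  component (rootsB e).
Proof.
move=> iP HS; have eP := on_line_frame iP.
have e0 j : e j != 0 by rewrite -(dot_eq0 dot) eG eqxx oner_eq0.
have BP m : m \in rootsB e -> m \in rootsD e \/ exists i, m = e i.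
  by rewrite mem_cat => /orP[|/mapP[j _ ->]]; [left | right; exists j].
apply: (component_intro HPhi HcPhi).
- exact: (ambivalent_B (oner_neq0 _) frame_k).
- by have := rootsD_nonempty; rewrite /rootsB; case: (rootsD e).
- move=> m /BP[/rootsD_long Lm|[j ->]]; last by split.
  by split; [apply: long_neq0 Lm | apply: long_line Lm].
- move=> m v /BP[/rootsD_long Lm vL|[j ->] vL]; first exact: vL.
  exact: frame_span.
- move=> a /HL[aD|aO]; [left; apply: mem_on_line|right=> m mB].
    by rewrite mem_cat aD.
  exact: rootsB_ortho.
- move=> d /HS[[j [s [s1 ->]]]|dO]; [left|right=> m mB].
    apply: on_lineZ; first by case: s1 => ->; rewrite ?oppr_eq0 oner_eq0.
    exact/mem_on_line/frame_root.
  exact: rootsB_ortho.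
Qed.

(** The component is of type B if some short vector is a frame vector up to sign, and of type D
    otherwise. *)
Lemma component_no_half :
  (forall d, short d -> ~ forall i, dot d (e i) = 1 / 2 \/ dot d (e i) = - (1 / 2)) ->
  exists M, component M.
Proof.
move=> noh.
have [[d [Sd [i [s [s1 ds]]]]]|nov] := pselect (exists d, short d /\
    exists i s, (s = 1 \/ s = -1) /\ d = s *: e i).
  have s0 : s != 0 by case: s1 => ->; rewrite ?oppr_eq0 oner_eq0.
  exists (rootsB e); apply: (@component_B i).
    by case: Sd => dP _ _; apply: (on_lineVZ s0); rewrite -ds.
  by move=> d' Sd'; case: (short_frame_cases Sd') => [h|h|/noh//]; [right | left].
exists (rootsD e); apply: component_D => d Sd.
case: (short_frame_cases Sd) => [//|h|/noh//].
by case: nov; exists d.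
Qed.

(** The squared norm of [d] is at most 1, so Bessel's inequality allows at most four frame vectors.
    If there were three, reflecting in [d] a long root supported on two of them would give a long
    root that pairs to 0 with these two but not with the third, against [HL]. With four, Bessel's
    inequality is an equality. *)
Lemma half_card d : short d ->
  (forall i, dot d (e i) = 1 / 2 \/ dot d (e i) = - (1 / 2)) ->
  [/\ #|T| = 4%N, dot d d = 1 & d = \sum_i dot d (e i) *: e i].
Proof.
move=> Sd dh; have [dP dd dL] := Sd; have [h1 h2] := half_norm eG dh.
have T4 : (#|T| <= 4)%N.
  rewrite leqNgt; apply/negP => T5.
  have : (5%:R : R) <= #|T|%:R by rewrite ler_nat.
  by case: dd h1 => ->; lra.
have T3 : #|T| != 3%N.
  apply/negP => /eqP T3; rewrite T3 in h1.
  have d1 : dot d d = 1 by case: dd h1 => // ->; lra.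
  have /card_gt2P[i [j [l [_ [ij jl li]]]]] := T2.
  pose s x := 2 * dot d (e x).
  have ss x : s x = 1 \/ s x = -1 by rewrite /s; case: (dh x) => ->; [left|right]; field.
  have La : long (s i *: e i + s j *: e j).
    by have [_ /(_ i j ij)[]] := Dframe_sign HPhi De ss.
  have da : dot d (s i *: e i + s j *: e j) = 1.
    by rewrite !dotE /s; case: (dh i) => ->; case: (dh j) => ->; field.
  case: (short_rf HPhi Sd La da) => -[]; rewrite d1; last by lra.
  move=> _ Lb; set b := _ - _ in Lb.
  have bE x : dot b (e x) = s i * (i == x)%:R + s j * (j == x)%:R - s x.
    by rewrite /b !dotE !eG.
  have T_ijl x : x != l -> x = i \/ x = j.
    move=> xl; have [->|xi] := eqVneq x i; first by left.
    have [->|xj] := eqVneq x j; [by right | exfalso].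
    suff : (3 < #|T|)%N by rewrite T3.
    rewrite (cardD1 i) (cardD1 j) (cardD1 l) (cardD1 x) !inE.
    by rewrite (eq_sym j i) ij (eq_sym l j) jl li xl xi xj.
  have b0 x : x != l -> dot b (e x) = 0.
    case/T_ijl=> ->; rewrite bE eqxx ?(negPf ij) ?(eq_sym j i) ?(negPf ij) /=; ring.
  case: (HL Lb) => [/rootsDP[x [y [xy bxy]]]|/(_ l)]; last first.
    rewrite bE (eq_sym i l) (negPf li) (negPf jl) /=; case: (ss l) => ->; lra.
  have bx z : z = x.1 \/ z = y.1 -> z = l.
    move=> hz; apply/eqP/negPn/negP => /b0; rewrite bxy.
    have eE u v : dot (E u) (e v) = (if u.2 then -1 else 1) * (u.1 == v)%:R.
      by rewrite /sframe; case: u.2; rewrite ?dotNl eG; ring.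
    rewrite dotDl dotNl !eE; case: hz => ->; rewrite eqxx ?(eq_sym y.1 x.1) ?(negPf xy) /=.
      by case: x.2; lra.
    by case: y.2; lra.
  by move: xy; rewrite (bx _ (or_introl erefl)) (bx _ (or_intror erefl)) eqxx.
have e4 : #|T| = 4%N by move: T2 T4 T3; case: #|T| => [|[|[|[|[|]]]]].
rewrite e4 in h1 h2.
have d1 : dot d d = 1 by case: dd h1 => // ->; lra.
by split=> //; apply: h2; rewrite d1; field.
Qed.

End OneFrame.
End TypeDComponents.

(** * Translation between integer vectors and frames *)

Section Dictionary.
Variables (R : realType) (V : vectType R) (dot : {dot V for idfun}).
Variables (T : finType) (e : T -> V).
Implicit Types (l : seq T) (s : T -> Z) (x : seq Z) (a b : T).

(** Halving makes the coordinates of spin weights integral. *)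
Definition half_frame l := [seq (1 / 2) *: e i | i <- l].

Definition pm1 s := forall i, s i = 1%ZZ \/ s i = (-1)%ZZ.

Lemma phi_cat_map s l tl y : phi (half_frame l ++ tl) (map s l ++ y)
  = \sum_(i <- l) (zR R (s i) / 2) *: e i + phi tl y.
Proof.
elim: l => [|a l IHl] /=; first by rewrite big_nil add0r.
by rewrite IHl big_cons addrA scalerA mul1r.
Qed.

Lemma phi_map s l : phi (half_frame l) (map s l) = \sum_(i <- l) (zR R (s i) / 2) *: e i.
Proof.
by have := phi_cat_map s l [::] [::]; rewrite !cats0 addr0.
Qed.

Lemma zsigns_mem s l : pm1 s -> map s l \in zsigns (size l).
Proof.
move=> s1; elim: l => //= a l IHl; rewrite mem_cat.
by case: (s1 a) => ->; rewrite ?(map_f (cons _) IHl) ?orbT.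
Qed.

Lemma zsignsS (n : nat) :
  zsigns n.+1 = map (cons 1%ZZ) (zsigns n) ++ map (cons (-1)%ZZ) (zsigns n).
Proof. by []. Qed.

Lemma zsigns_neg (n : nat) x : x \in zsigns n -> zneg x \in zsigns n.
Proof.
elim: n x => [|n IHn] x /=; first by rewrite !inE => /eqP ->.
rewrite !mem_cat => /orP[]/mapP[y /IHn yn ->] /=.
  by rewrite (map_f (cons (-1)%ZZ)) ?orbT.
by rewrite (map_f (cons 1%ZZ)).
Qed.

Definition upd s a c := fun i => if i == a then c else s i.

Lemma map_upd s a c l : a \notin l -> map (upd s a c) (a :: l) = c :: map s l.
Proof.
move=> al /=; rewrite /upd eqxx; congr (_ :: _); apply/eq_in_map => i il.
by case: eqP => // ia; rewrite -ia il in al.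
Qed.

Lemma zsigns_map l x : uniq l -> x \in zsigns (size l) ->
  exists2 s, pm1 s & x = map s l.
Proof.
elim: l x => [|a l IHl] x /=.
  by rewrite inE => _ /eqP ->; exists (fun=> 1%ZZ) => // i; left.
case/andP=> al ul; rewrite mem_cat => /orP[]/mapP[y /(IHl _ ul)[s s1 ->] ->].
  exists (upd s a 1%ZZ); last by rewrite -[RHS]/(map _ (a :: l)) map_upd.
  by move=> i; rewrite /upd; case: eqP => // _; left.
exists (upd s a (-1)%ZZ); last by rewrite -[RHS]/(map _ (a :: l)) map_upd.
by move=> i; rewrite /upd; case: eqP => // _; right.
Qed.

Lemma zeven_map s l : pm1 s ->
  zeven (map s l) = ~~ odd (count (fun i => Z.eqb (s i) (-1)) l).
Proof.
move=> s1; suff h : foldr Z.mul 1%ZZ (map s l) =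
    (if odd (count (fun i => Z.eqb (s i) (-1)) l) then -1 else 1)%ZZ.
  by rewrite /zeven h; case: odd.
elim: l => //= a l ->; rewrite oddD; case: (s1 a) => -> /=; by case: odd.
Qed.

Definition unit_vec a i : Z := if i == a then 1%ZZ else 0%ZZ.
Definition pair_vec a b (c : Z) i : Z :=
  if i == a then 2%ZZ else if i == b then c else 0%ZZ.

Lemma map_const0 l : nseq (size l) 0%ZZ = map (fun=> 0%ZZ) l.
Proof. by elim: l => //= a l ->. Qed.

Lemma unit_vec_cons a l : a \notin l ->
  map (unit_vec a) (a :: l) = 1%ZZ :: nseq (size l) 0%ZZ.
Proof.
move=> al; rewrite map_const0 -(map_upd _ _ al); apply: eq_map => i.
by rewrite /upd /unit_vec.
Qed.

Lemma zunits_mem l a : uniq l -> a \in l -> map (unit_vec a) l \in zunits (size l).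
Proof.
elim: l => //= h l IHl /andP[hl ul]; rewrite inE => /predU1P[->|al].
  by rewrite -[_ :: map _ _]/(map _ (h :: l)) unit_vec_cons // mem_head.
rewrite inE; apply/orP; right; rewrite (_ : unit_vec a h = 0%ZZ).
  by apply: map_f; apply: IHl.
by rewrite /unit_vec; case: eqP => // ha; rewrite ha al in hl.
Qed.

Lemma zunits_map l x : uniq l -> x \in zunits (size l) ->
  exists2 a, a \in l & x = map (unit_vec a) l.
Proof.
elim: l x => //= h l IHl x /andP[hl ul]; rewrite inE => /predU1P[->|].
  by exists h; rewrite ?mem_head // -[RHS]/(map _ (h :: l)) unit_vec_cons.
case/mapP=> y /(IHl _ ul)[a al ->] ->; exists a; first by rewrite inE al orbT.
rewrite /= (_ : unit_vec a h = 0%ZZ) //.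
by rewrite /unit_vec; case: eqP => // ha; rewrite ha al in hl.
Qed.

Lemma pair_vec_head h b c l : h \notin l -> b != h ->
  map (pair_vec h b c) (h :: l) = 2%ZZ :: map (Z.mul c) (map (unit_vec b) l).
Proof.
move=> hl bh; rewrite -map_comp -(map_upd _ _ hl); apply: eq_map => i.
rewrite /upd /pair_vec /unit_vec /=; case: eqP => // _; case: eqP => _; lia.
Qed.

Lemma zpairsS (n : nat) : zpairs n.+1 =
  [seq 2%ZZ :: map (Z.mul z) u | u <- zunits n, z <- [:: 2; -2]%ZZ]
  ++ map (cons 0%ZZ) (zpairs n).
Proof. by []. Qed.

Lemma zpairs_mem l a b c : uniq l -> a \in l -> b \in l ->
  (index a l < index b l)%N -> c = 2%ZZ \/ c = (-2)%ZZ ->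
  map (pair_vec a b c) l \in zpairs (size l).
Proof.
move=> + + + + c2; elim: l => // h l IHl /andP[hl ul].
rewrite [size _]/= [index a _]/= [index b _]/= zpairsS mem_cat.
have [ha|ha] := eqVneq h a; have [hb|hb] := eqVneq h b => //.
  rewrite -ha !inE (eq_sym b h) (negPf hb) orFb => _ bl _.
  apply/orP; left; rewrite pair_vec_head //; last by rewrite eq_sym.
  apply/allpairsP; exists (map (unit_vec b) l, c); split=> //=.
    exact: zunits_mem.
  by case: c2 => ->; rewrite !inE.
rewrite !inE (eq_sym a h) (negPf ha) (eq_sym b h) (negPf hb) ltnS => /= al bl ab.
apply/orP; right; rewrite (_ : pair_vec a b c h = 0%ZZ).
  by apply: map_f; apply: IHl.
by rewrite /pair_vec (negPf ha) (negPf hb).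
Qed.

Lemma zpairs_map l x : uniq l -> x \in zpairs (size l) ->
  exists a b c, [/\ a != b, a \in l, b \in l, c = 2%ZZ \/ c = (-2)%ZZ
    & x = map (pair_vec a b c) l].
Proof.
elim: l x => // h l IHl x /andP[hl ul]; rewrite zpairsS mem_cat => /orP[].
  case/allpairsP=> -[u c] /= [/(zunits_map ul)[b bl ->] c2 ->].
  have bh : b != h by apply: contraNneq hl => <-.
  exists h, b, c; split; rewrite ?inE ?eqxx ?bl ?orbT //.
  - by rewrite eq_sym.
  - by move: c2; rewrite !inE => /orP[]/eqP ->; [left | right].
  - by rewrite -[RHS]/(map _ (h :: l)) pair_vec_head.
case/mapP=> y /(IHl _ ul)[a [b [c [ab al bl c2 ->]]]] ->.
exists a, b, c; split; rewrite ?inE ?al ?bl ?orbT //=.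
have ha : h != a by apply: contraNneq hl => ->.
have hb : h != b by apply: contraNneq hl => ->.
by rewrite (_ : pair_vec a b c h = 0%ZZ) // /pair_vec (negPf ha) (negPf hb).
Qed.

Lemma zR2h : zR R 2%ZZ / 2 = 1.
Proof. by rewrite (_ : zR R 2%ZZ = 2) // divff // pnatr_eq0. Qed.

Lemma zRN2h : zR R (-2)%ZZ / 2 = -1.
Proof. by rewrite (zRN R 2%ZZ) mulNr zR2h. Qed.

Lemma sum_pair_vec a b c : a != b ->
  \sum_(i <- enum T) (zR R (pair_vec a b c i) / 2) *: e i = e a + (zR R c / 2) *: e b.
Proof.
move=> ab; rewrite big_enum /= (bigD1 a) //= (bigD1 b) 1?eq_sym //= big1.
  rewrite /pair_vec eqxx (eq_sym b a) (negPf ab) eqxx addr0.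
  by rewrite zR2h scale1r.
move=> i /andP[ia ib]; rewrite /pair_vec (negPf ia) (negPf ib).
by rewrite (_ : zR R 0%ZZ / 2 = 0) ?scale0r // mul0r.
Qed.

Lemma sum_unit_vec a :
  \sum_(i <- enum T) (zR R (2 * unit_vec a i)%ZZ / 2) *: e i = e a.
Proof.
rewrite big_enum /= (bigD1 a) //= big1 => [|i ia].
  by rewrite /unit_vec eqxx addr0 (_ : zR R _ / 2 = 1) ?scale1r // divff // pnatr_eq0.
by rewrite /unit_vec (negPf ia) (_ : zR R _ / 2 = 0) ?scale0r // mul0r.
Qed.

Hypothesis eG : forall i j, dot (e i) (e j) = (i == j)%:R.

Lemma ortho_half_frame l w tl : uniq l ->
  (forall i v, v \in tl -> dot (e i) v = 0) -> ortho_fam dot (1 / 4) w tl ->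
  ortho_fam dot (1 / 4) (nseq (size l) 1%ZZ ++ w) (half_frame l ++ tl).
Proof.
move=> + tlO tlw; elim: l => //= a l IHl /andP[al ul]; split; last exact: IHl.
  by rewrite !dotE eG eqxx /= (_ : zR R 1%ZZ = 1) //; field.
move=> v; rewrite mem_cat => /orP[/mapP[i il ->]|vt]; last by rewrite dotZl tlO ?mulr0.
have ai : a != i by apply: contraNneq al => ->.
by rewrite !dotE eG (negPf ai) !mulr0.
Qed.

End Dictionary.


Section Exceptional.
Variables (R : realType) (V : vectType R) (dot : {dot V for idfun}).
Implicit Types (bs : seq V).

Lemma quarter_neq0 : (1 / 4 : R) != 0.
Proof. by rewrite mulf_neq0 ?invr_eq0 ?oner_eq0 ?pnatr_eq0. Qed.

Lemma ambivalent_G2 (k : R) bs : k != 0 -> ortho_fam dot k weightsG2 bs ->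
  ambivalent dot (map (phi bs) rootsG2).
Proof.
move=> k0 ob; have /and3P[cR cB cC] := checkG2.
exact: (ambivalent_check k0 ob cR cB cC).
Qed.

Lemma ambivalent_F4 bs : ortho_fam dot (1 / 4) weightsF4 bs ->
  ambivalent dot (map (phi bs) rootsF4).
Proof.
move=> ob; have /and3P[cR cB cC] := checkF4.
exact: (ambivalent_check quarter_neq0 ob cR cB cC).
Qed.

Lemma ambivalent_E6 bs : ortho_fam dot (1 / 4) weightsE6 bs ->
  ambivalent dot (map (phi bs) rootsE6).
Proof.
move=> ob; have /and3P[cR cB cC] := checkE6.
exact: (ambivalent_check quarter_neq0 ob cR cB cC).
Qed.

Lemma ambivalent_E7 bs : ortho_fam dot (1 / 4) weightsE7 bs ->
  ambivalent dot (map (phi bs) rootsE7).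
Proof.
move=> ob; have /and3P[cR cB cC] := checkE7.
exact: (ambivalent_check quarter_neq0 ob cR cB cC).
Qed.

Lemma ambivalent_E8 bs : ortho_fam dot (1 / 4) weightsE8 bs ->
  ambivalent dot (map (phi bs) rootsE8).
Proof.
move=> ob; have /and3P[cR cB cC] := checkE8.
exact: (ambivalent_check quarter_neq0 ob cR cB cC).
Qed.

End Exceptional.

(** * Type F4 *)

Section F4.
Variables (R : realType) (V : vectType R) (dot : {dot V for idfun}).
Variable Phi : seq V.
Hypotheses (HPhi : root_system dot Phi) (HcPhi : crystallographic dot Phi).
Local Notation long := (long dot Phi).
Local Notation component := (component dot Phi).
Local Notation Dframe := (Dframe dot Phi).
Local Notation dC := (dotC dot).

Lemma on_line_neq0 v : on_line Phi v -> v != 0.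
Proof.
case=> c c0 cv; apply/negP => /eqP v0; move: cv.
by rewrite v0 scaler0 (negPf (root_neq0 HPhi)).
Qed.

Lemma half_signs (T : finType) (e : T -> V) v :
  (forall i, dot v (e i) = 1 / 2 \/ dot v (e i) = - (1 / 2)) ->
  exists2 s : T -> Z, pm1 s & forall i, dot v (e i) = zR R (s i) / 2.
Proof.
move=> vh; pose s i := if dot v (e i) == 1 / 2 then 1%ZZ else (-1)%ZZ.
exists s => i; rewrite /s; first by case: ifP; [left | right].
have [->|n] := eqVneq (dot v (e i)) (1 / 2); first by [].
by case: (vh i) => h; [rewrite h eqxx in n | rewrite h mulNr].
Qed.

(** The long roots form a D4. A short vector is orthogonal to the frame, a frame vector up to sign
    or, by [half_card], a half sum with signs; the last two kinds lie on lines of the list. *)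
Lemma component_F4 (T : finType) (e : T -> V) : Dframe e -> #|T| = 4%N ->
  (forall a, long a -> a \in rootsD e \/ forall i, dot a (e i) = 0) ->
  (forall i, on_line Phi (e i)) ->
  (forall s : T -> Z, pm1 s -> on_line Phi (\sum_i (zR R (s i) / 2) *: e i)) ->
  exists M, component M.
Proof.
move=> De T4 HL eP hP; have eG := De.1; have T2 : (2 < #|T|)%N by rewrite T4.
pose bs := half_frame e (enum T); have sT : size (enum T) = 4%N by rewrite -cardE.
have ob : ortho_fam dot (1 / 4) weightsF4 bs.
  have := @ortho_half_frame R V dot T e eG (enum T) [::] [::] (enum_uniq _).
  by rewrite sT /= cats0; apply.
have ambM := ambivalent_F4 ob.
pose M := map (phi bs) rootsF4.
have phiE s : phi bs (map s (enum T)) = \sum_i (zR R (s i) / 2) *: e i.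
  by rewrite phi_map big_enum.
have Mpair a b c : a != b -> c = 2%ZZ \/ c = (-2)%ZZ ->
    (index a (enum T) < index b (enum T))%N -> e a + (zR R c / 2) *: e b \in M.
  move=> ab c2 iab; rewrite -(sum_pair_vec e c ab) -phi_map; apply: map_f.
  by rewrite mem_cat -sT zpairs_mem ?mem_enum ?enum_uniq.
have Mhalf s : pm1 s -> on_line M (\sum_i (zR R (s i) / 2) *: e i).
  move=> s1; rewrite -phiE; have := zsigns_mem (enum T) s1; rewrite sT.
  rewrite zsignsS mem_cat => /orP[h|/mapP[x xs h]].
    by apply/mem_on_line/map_f; rewrite !mem_cat h !orbT.
  (* The list contains only the half sums whose first sign is 1; the others are their opposites. *)
  rewrite h -[_ :: x]znegK phi_neg; apply/on_lineN/mem_on_line/map_f.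
  rewrite !mem_cat; apply/orP; right; apply/orP; right; apply: (map_f (cons 1%ZZ)).
  exact: zsigns_neg.
have Munit a : e a \in M.
  rewrite -(sum_unit_vec e a) big_enum -phiE; apply: map_f.
  rewrite !mem_cat; apply/orP; right; apply/orP; left.
  rewrite (map_comp (Z.mul 2)); apply: (map_f (map (Z.mul 2))).
  by rewrite -sT zunits_mem ?mem_enum ?enum_uniq.
have Mcases m : m \in M -> [\/ m \in rootsD e, exists i, m = e i
    | exists2 s : T -> Z, pm1 s & m = \sum_i (zR R (s i) / 2) *: e i].
  case/mapP=> x + ->; rewrite /rootsF4 -sT !mem_cat => /or3P[].
  - case/(zpairs_map (enum_uniq _))=> a [b [c [ab _ _ c2 ->]]]; constructor 1.
    rewrite (_ : phi _ _ = e a + (zR R c / 2) *: e b); last first.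
      by rewrite phi_map; apply: sum_pair_vec.
    apply/rootsDP.
    case: c2 => ->; rewrite ?zR2h ?zRN2h ?scaleN1r ?scale1r.
      by exists (a, false), (b, true); rewrite /sframe /= opprK.
    by exists (a, false), (b, false).
  - case/mapP=> y /(zunits_map (enum_uniq _))[a _ ->] ->; constructor 2; exists a.
    by rewrite -map_comp phi_map -[RHS](sum_unit_vec e).
  - move=> h; constructor 3.
    have : x \in zsigns (size (enum T)) by rewrite sT zsignsS mem_cat h.
    by case/(zsigns_map (enum_uniq _))=> s s1 ->; exists s; rewrite ?phiE.
have Mortho v m : (forall i, dot v (e i) = 0) -> m \in M -> dot v m = 0.
  move=> ve /Mcases[mD|[i ->]|[s _ ->]] //.
    by apply: (rootsB_ortho ve); rewrite mem_cat mD.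
  by rewrite dC dot_suml big1 // => i _; rewrite dotZl dC ve mulr0.
have MPhi m : m \in M -> on_line Phi m.
  by case/Mcases=> [/(rootsD_long HPhi De)/long_line|[i ->]|[s s1 ->]] //; apply: hP.
exists M; apply: (component_intro HPhi HcPhi).
- exact: ambM.
- by rewrite /M /rootsF4; case: (zpairs 4) (erefl (size (zpairs 4))).
- by move=> m /MPhi h; split=> //; apply: on_line_neq0.
- move=> m v mM vL; apply: Mortho mM => i.
  by apply: (frame_span De).
- move=> a /HL[/rootsDP[x [y [xy ->]]]|aO]; [left | by right=> m; apply: Mortho].
  wlog ixy : x y xy / (index x.1 (enum T) < index y.1 (enum T))%N.
    move=> IH; have := xy.
    rewrite -(inj_in_eq (@index_inj _ x.1 (enum T))) ?inE ?mem_enum //.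
    rewrite neq_ltn => /orP[|lt]; first exact: IH.
    by rewrite -opprB; apply: on_lineN; apply: IH; rewrite // eq_sym.
  have := Mpair x.1 y.1 2%ZZ xy (or_introl erefl) ixy.
  have := Mpair x.1 y.1 (-2)%ZZ xy (or_intror erefl) ixy.
  rewrite zR2h zRN2h scaleN1r scale1r => m1 m2.
  rewrite /sframe; case: x.2; case: y.2; rewrite ?opprK.
  + by rewrite addrC -opprB; apply/on_lineN/mem_on_line.
  + by rewrite -opprD; apply/on_lineN/mem_on_line.
  + exact: mem_on_line.
  + exact: mem_on_line.
- move=> d Sd; case: (short_frame_cases De T2 Sd) => [dO|[i [s [s1 ->]]]|dh].
  + by right=> m; apply: Mortho.
  + left; apply: on_lineZ; first by case: s1 => ->; rewrite ?oppr_eq0 oner_eq0.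
    exact: mem_on_line.
  + left; have [_ _ ->] := half_card HPhi De T2 HL Sd dh.
    have [s s1 sE] := half_signs dh; under eq_bigr do rewrite sE.
    exact: Mhalf.
Qed.

End F4.

(** * Triality of D4 *)

Section Triality.
Variables (R : realType) (V : vectType R) (dot : {dot V for idfun}).
Local Notation rf := (reflection dot).
Variable Phi : seq V.
Hypotheses (HPhi : root_system dot Phi) (HcPhi : crystallographic dot Phi).
Local Notation long := (long dot Phi).
Local Notation short := (short dot Phi).
Local Notation component := (component dot Phi).
Local Notation Dframe := (Dframe dot Phi).

Lemma rootsD_sqr (T : finType) (e : T -> V) a : Dframe e -> a \in rootsD e ->
  \sum_i dot a (e i) * dot a (e i) = 2.
Proof.
move=> De /rootsDP[x [y [xy ->]]]; have eG := De.1.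
have eE u i : dot (sframe e u) (e i) = (if u.2 then -1 else 1) * (u.1 == i)%:R.
  by rewrite /sframe; case: u.2; rewrite ?dotNl eG; ring.
rewrite (bigD1 x.1) // (bigD1 y.1) /=; last by rewrite eq_sym.
rewrite big1 ?addr0.
  rewrite !dotDl !dotNl !eE !eqxx (eq_sym y.1 x.1) (negPf xy).
  by case: x.2; case: y.2; rewrite /=; ring.
move=> i /andP[ix iy]; rewrite !dotDl !dotNl !eE (eq_sym x.1 i) (eq_sym y.1 i).
by rewrite (negPf ix) (negPf iy) /=; ring.
Qed.

(** The sum of squares is 0, 1 or 4/4 = 1 for the zero, vector and spin patterns, so the value 2
    singles out the roots of D4. It does not change between [g] and [trial], which makes it a
    convenient test when frames are exchanged. *)
Lemma sqr_rootsD (T : finType) (e : T -> V) a : Dframe e -> #|T| = 4%N -> long a ->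
  \sum_i dot a (e i) * dot a (e i) = 2 -> a \in rootsD e.
Proof.
move=> De T4 La a2; have T2 : (2 < #|T|)%N by rewrite T4.
case: (long_frame_cases HcPhi De T2 La) => // h; exfalso; move: a2.
- by rewrite big1 => [|i _]; [lra | rewrite h mul0r].
- case: h => i [s [s1 h]]; rewrite (bigD1 i) //= big1 => [|j ji].
    by rewrite h eqxx; case: s1 => ->; rewrite /=; lra.
  by rewrite h (negPf ji) !mulr0.
- rewrite (eq_bigr (fun=> 1 / 4)); last by move=> i _; case: (h i) => ->; field.
  by rewrite sumr_const T4; lra.
Qed.

Local Notation Q := (bool * bool)%type.

Lemma sum_Q (F : Q -> R) : \sum_x F x =
  F (false, false) + F (false, true) + F (true, false) + F (true, true).
Proof.
rewrite (eq_bigr (fun p => F (p.1, p.2))); last by case.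
rewrite -(pair_bigA _ (fun x y => F (x, y))) /= !big_bool /=.
by ring.
Qed.

Lemma sum_QV (F : Q -> V) : \sum_x F x =
  F (false, false) + F (false, true) + F (true, false) + F (true, true).
Proof.
rewrite (eq_bigr (fun p => F (p.1, p.2))); last by case.
rewrite -(pair_bigA _ (fun x y => F (x, y))) /= !big_bool /=.
by vec dot.
Qed.

Lemma card_Q : #|{: Q}| = 4%N.
Proof. by rewrite card_prod card_bool. Qed.

Section QFrame.
Variable g : Q -> V.
Hypotheses (Dg : Dframe g)
  (HL : forall a, long a -> a \in rootsD g \/ forall i, dot a (g i) = 0).
Local Notation g0 := (g (false, false)).
Local Notation g1 := (g (false, true)).
Local Notation g2 := (g (true, false)).
Local Notation g3 := (g (true, true)).
Let d := (1 / 2) *: (g0 + g1 + g2 + g3).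
Hypothesis Sd : short d.

Let T2 : (2 < #|{: Q}|)%N. Proof. by rewrite card_Q. Qed.
Let gG := Dg.1.

Lemma flip_half i (F : Q -> R) : on_line Phi (g i) -> on_line Phi (\sum_x F x *: g x) ->
  on_line Phi (\sum_x (if x == i then - F x else F x) *: g x).
Proof.
move=> gP fP; rewrite (_ : \sum_x _ = rf (g i) (\sum_x F x *: g x)).
  exact: on_line_rf.
have fi : dot (\sum_x F x *: g x) (g i) = F i.
  rewrite dot_suml (bigD1 i) //= big1 ?addr0 => [|j ji]; rewrite dotZl gG.
    by rewrite eqxx mulr1.
  by rewrite (negPf ji) mulr0.
rewrite rfE fi gG eqxx [LHS](bigD1 i) //= [in RHS](bigD1 i) //= eqxx.
rewrite (eq_bigr (fun x => F x *: g x)); last by move=> x /negPf ->.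
by vec dot.
Qed.

(** Reflections in the frame vectors change signs of coordinates one at a time and carry [d] to
    every half sum with signs. *)
Lemma F4_case i : on_line Phi (g i) -> exists M, component M.
Proof.
move=> gP; have gP' := on_line_frame HPhi Dg gP.
apply: (component_F4 HPhi HcPhi Dg card_Q HL gP') => s s1.
have key (l : seq Q) : uniq l ->
    on_line Phi (\sum_x (if x \in l then zR R (s x) / 2 else 1 / 2) *: g x).
  elim: l => [_|i0 l IHl /andP[il /IHl h]].
    by case: Sd => dP _ _; move: dP; rewrite /d sum_QV -!scalerDr.
  case: (s1 i0) => e0.
    rewrite (eq_bigr (fun x => (if x \in l then zR R (s x) / 2 else 1 / 2) *: g x)) //.
    move=> x _; rewrite inE; have [->|//] := eqVneq x i0.
    by rewrite (negPf il) e0.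
  have := flip_half (gP' i0) h; congr (on_line Phi _); apply: eq_bigr => x _.
  rewrite inE; have [->|//] := eqVneq x i0.
  by rewrite (negPf il) e0 /=; congr (_ *: _); rewrite (zRN R 1%ZZ) mulNr.
have := key (enum {: Q}) (enum_uniq _); congr (on_line Phi _).
by apply: eq_bigr => x _; rewrite mem_enum.
Qed.

(* Triality: a second frame with the same roots of type D4, which exchanges the
   vector weights with half-spin weights. *)
Definition trial (x : Q) : V := (1 / 2) *:
  match x with
  | (false, false) => g0 + g1 + g2 + g3
  | (false, true) => g0 + g1 - g2 - g3
  | (true, false) => g0 - g1 + g2 - g3
  | (true, true) => g0 - g1 - g2 + g3
  end.

Lemma trial_Dframe : Dframe trial.
Proof.
split=> [[[] []] [[] []]|].
1-16: by rewrite /trial !dotE !gG /=; field.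
have gp i j : i != j -> long (g i + g j) by case/(Dg.2 i j).
have gm i j : i != j -> long (g i - g j) by case/(Dg.2 i j).
have sym i j : long (trial i + trial j) -> long (trial i - trial j) ->
    long (trial j + trial i) /\ long (trial j - trial i).
  by move=> h1 h2; rewrite addrC; split=> //; rewrite -opprB; apply: longN.
have e01 : trial (false, false) + trial (false, true) = g0 + g1 by rewrite /trial; vec dot.
have m01 : trial (false, false) - trial (false, true) = g2 + g3 by rewrite /trial; vec dot.
have e02 : trial (false, false) + trial (true, false) = g0 + g2 by rewrite /trial; vec dot.
have m02 : trial (false, false) - trial (true, false) = g1 + g3 by rewrite /trial; vec dot.
have e03 : trial (false, false) + trial (true, true) = g0 + g3 by rewrite /trial; vec dot.
have m03 : trial (false, false) - trial (true, true) = g1 + g2 by rewrite /trial; vec dot.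
have e12 : trial (false, true) + trial (true, false) = g0 - g3 by rewrite /trial; vec dot.
have m12 : trial (false, true) - trial (true, false) = g1 - g2 by rewrite /trial; vec dot.
have e13 : trial (false, true) + trial (true, true) = g0 - g2 by rewrite /trial; vec dot.
have m13 : trial (false, true) - trial (true, true) = g1 - g3 by rewrite /trial; vec dot.
have e23 : trial (true, false) + trial (true, true) = g0 - g1 by rewrite /trial; vec dot.
have m23 : trial (true, false) - trial (true, true) = g2 - g3 by rewrite /trial; vec dot.
move=> [[] []] [[] []] // _; first [by split; rewrite ?(e01, e02, e03, e12, e13, e23)
  ?(m01, m02, m03, m12, m13, m23); first [exact: gp | exact: gm]
  | by apply: sym; rewrite ?(e01, e02, e03, e12, e13, e23)
  ?(m01, m02, m03, m12, m13, m23); first [exact: gp | exact: gm]].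
Qed.

Lemma dot_trial v x : dot v (trial x) = 1 / 2 *
  match x with
  | (false, false) => dot v g0 + dot v g1 + dot v g2 + dot v g3
  | (false, true) => dot v g0 + dot v g1 - dot v g2 - dot v g3
  | (true, false) => dot v g0 - dot v g1 + dot v g2 - dot v g3
  | (true, true) => dot v g0 - dot v g1 - dot v g2 + dot v g3
  end.
Proof. by rewrite /trial; case: x => [[] []]; rewrite !dotE. Qed.

(** If no frame vector is on a root line, the frame is replaced by [trial], in which [d] is a vector
    weight, and no short vector is a spin weight any more. Indeed such a vector would be a half sum
    in the frame [g]: with an even number of minus signs it pairs integrally with [trial], and with
    an odd number [odd_case] puts a frame vector on a root line. *)
Lemma trial_case : exists M, component M.
Proof.
have [[i gP]|nog] := pselect (exists i, on_line Phi (g i)); first exact: F4_case gP.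
have DT := trial_Dframe.
apply: (component_no_half HPhi HcPhi DT T2).
  move=> a La; case: (HL La) => [aD|aO].
    left; apply: (sqr_rootsD DT card_Q La); rewrite -(rootsD_sqr Dg aD) !sum_Q.
    by rewrite !dot_trial; field.
  by right=> i; rewrite dot_trial; case: i => [[] []]; rewrite !aO; ring.
move=> d' Sd' h; case: (short_frame_cases Dg T2 Sd') => [dO|[i [s [s1 ds]]]|dh].
- by case: (h (false, false)); rewrite dot_trial !dO; lra.
- case: nog; exists i; case: Sd' => dP _ _; move: dP; rewrite ds.
  by apply: on_lineVZ; case: s1 => ->; rewrite ?oppr_eq0 oner_eq0.
have [_ d'1 d'E] := half_card HPhi Dg T2 HL Sd' dh.
have [dP _ _] := Sd; have [d'P _ _] := Sd'.
(* A half sum with an odd number of minus signs is [d - g i] or its opposite, and the reflection in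
   [d] carries [d - g i] to [- g i]. *)
have odd_case i (u : V) : on_line Phi u -> u = d - g i -> on_line Phi (g i).
  move=> uP uE; apply: (@on_lineVZ _ _ _ (-1)); first by rewrite oppr_eq0 oner_eq0.
  rewrite (_ : -1 *: g i = rf d u); first exact: on_line_rf.
  have d1 : dot d d = 1 by rewrite /d !dotE !gG /=; field.
  have dgi : dot (g i) d = 1 / 2.
    by rewrite /d; case: i {uE} => [[] []]; rewrite !dotE !gG /=; field.
  rewrite rfE uE dotDl dotNl d1 dgi (_ : 2 * (1 - 1 / 2) / 1 = 1); last by field.
  by rewrite scale1r scaleN1r; vec dot.
have odd_case' i (u : V) : on_line Phi u -> u = - (d - g i) -> on_line Phi (g i).
  by move=> /on_lineN uP uE; apply: (odd_case i (- u)); rewrite // uE opprK.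
have hE x : dot d' (trial x) = 1 / 2 \/ dot d' (trial x) = - (1 / 2) := h x.
move: d'E (hE (false, false)); rewrite sum_QV dot_trial.
have fin i : on_line Phi (g i) -> False by move=> gi; apply: nog; exists i.
case: (dh (false, false)) => ->; case: (dh (false, true)) => ->;
  case: (dh (true, false)) => ->; case: (dh (true, true)) => -> d'E hx;
  first [by exfalso; case: hx; lra
  | by apply: (fin (false, false)); apply: (odd_case _ _ d'P); rewrite d'E /d; vec dot
  | by apply: (fin (false, false)); apply: (odd_case' _ _ d'P); rewrite d'E /d; vec dot
  | by apply: (fin (false, true)); apply: (odd_case _ _ d'P); rewrite d'E /d; vec dot
  | by apply: (fin (false, true)); apply: (odd_case' _ _ d'P); rewrite d'E /d; vec dot
  | by apply: (fin (true, false)); apply: (odd_case _ _ d'P); rewrite d'E /d; vec dot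
  | by apply: (fin (true, false)); apply: (odd_case' _ _ d'P); rewrite d'E /d; vec dot
  | by apply: (fin (true, true)); apply: (odd_case _ _ d'P); rewrite d'E /d; vec dot
  | by apply: (fin (true, true)); apply: (odd_case' _ _ d'P); rewrite d'E /d; vec dot].
Qed.

End QFrame.

(** Absorbing signs into the frame turns [c] into a plain half sum, and indexing by pairs of
    booleans makes the triality frame explicit. *)
Lemma component_half (T : finType) (e : T -> V) c : Dframe e -> (2 < #|T|)%N ->
  (forall a, long a -> a \in rootsD e \/ forall i, dot a (e i) = 0) -> short c ->
  (forall i, dot c (e i) = 1 / 2 \/ dot c (e i) = - (1 / 2)) ->
  exists M, component M.
Proof.
move=> De T2 HL Sc ch; have [T4 c1 cE] := half_card HPhi De T2 HL Sc ch.
pose s i := 2 * dot c (e i).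
have s1 i : s i = 1 \/ s i = -1.
  by rewrite /s; case: (ch i) => ->; [left | right]; field.
have ss i : s i * s i = 1 by case: (s1 i) => ->; ring.
have eqc : #|{: Q}| = #|T| by rewrite card_Q T4.
pose h (x : Q) := enum_val (cast_ord eqc (enum_rank x)).
have h_inj : injective h by move=> x y /enum_val_inj/cast_ord_inj/enum_rank_inj.
have h_bij : bijective h by apply: inj_card_bij => //; rewrite eqc.
have [De1 De2] := Dframe_sign HPhi De s1.
pose g x := s (h x) *: e (h x).
have Dg : Dframe g.
  split=> [x y|x y xy]; first by rewrite De1 (inj_eq h_inj).
  by apply: De2; rewrite (inj_eq h_inj).
apply: (@trial_case g Dg).
  move=> a La; case: (HL a La) => [aD|aO]; last first.
    by right=> x; rewrite /g dotZr aO mulr0.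
  left; apply: (sqr_rootsD Dg card_Q La); rewrite -(rootsD_sqr De aD).
  rewrite [RHS](reindex h) /=; last exact: onW_bij.
  apply: eq_bigr => x _; rewrite /g !dotZr mulrACA ss mul1r //.
rewrite (_ : _ *: _ = c) // [RHS]cE (reindex h) /=; last exact: onW_bij.
by rewrite sum_QV /g /s; vec dot.
Qed.

Lemma component_Dfinal (T : finType) (e : T -> V) : Dframe e -> (2 < #|T|)%N ->
  (forall a, long a -> a \in rootsD e \/ forall i, dot a (e i) = 0) ->
  exists M, component M.
Proof.
move=> De T2 HL.
have [[c [Sc ch]]|no] := pselect (exists c, short c /\
    forall i, dot c (e i) = 1 / 2 \/ dot c (e i) = - (1 / 2)).
  exact: (component_half De T2 HL Sc ch).
apply: (component_no_half HPhi HcPhi De T2 HL) => d Sd dh.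
by apply: no; exists d.
Qed.

End Triality.

(** * Spin weights among the long roots *)

Section Spin.
Variables (R : realType) (V : vectType R) (dot : {dot V for idfun}).
Variable Phi : seq V.
Hypotheses (HPhi : root_system dot Phi) (HcPhi : crystallographic dot Phi).
Local Notation long := (long dot Phi).
Local Notation short := (short dot Phi).
Local Notation Dframe := (Dframe dot Phi).
Local Notation dC := (dotC dot).

Variable T : finType.
Hypothesis T4 : (3 < #|T|)%N.
Hypothesis Tmax : forall (T' : finType) (e' : T' -> V), Dframe e' -> (#|T'| <= #|T|)%N.
Implicit Types (e : T -> V) (S A : {set T}) (a v : V).

Let T2 : (2 < #|T|)%N. Proof. exact: ltnW. Qed.

Lemma no_vector e v i s : Dframe e -> long v -> s = 1 \/ s = -1 ->
  (forall j, dot v (e j) = s * (j == i)%:R) -> False.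
Proof.
move=> De Lv s1 vE.
have [T' [e' [De' eT]]] := Dframe_ext HPhi De (ltnW T2) Lv s1 vE.
by have := Tmax De'; rewrite eT ltnn.
Qed.

(* Up to sign changes of the frame, every root pairing to 1/2 or -1/2 with all of
   [e] has this form; [flipped e v S] is its image under the sign change on [S]. *)
Definition spin e v := [/\ Dframe e, long v & forall i, dot v (e i) = 1 / 2].

Definition flipped (e : T -> V) v S := v - \sum_(i in S) e i.

Lemma dot_flipped e v S u : dot (flipped e v S) u = dot v u - \sum_(i in S) dot (e i) u.
Proof. by rewrite dotDl dotNl dot_suml. Qed.

Lemma flipped_frame e v S i : spin e v ->
  dot (flipped e v S) (e i) = 1 / 2 - (i \in S)%:R.
Proof.
move=> [[eG _] _ vh]; rewrite dot_flipped vh; congr (_ - _).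
have [iS|iS] := boolP (i \in S).
  rewrite (bigD1 i) //= big1 ?addr0 ?eG ?eqxx // => j /andP[_ ji].
  by rewrite eG (negPf ji).
rewrite big1 // => j jS; rewrite eG; case: eqP => // ji.
by rewrite -ji jS in iS.
Qed.

(** The members of [S] are removed in pairs: subtracting [e i + e j] from a long root that pairs to
    1/2 with both leaves a long root. *)
Lemma flipped_long e v S : spin e v -> ~~ odd #|S| -> long (flipped e v S).
Proof.
move=> sv; have [De Lv vh] := sv.
have [n] := ubnP #|S|; elim: n S => // n IHn S Sn S_even.
have [->|/set0Pn[i iS]] := eqVneq S set0.
  by rewrite /flipped big_set0 subr0.
have : (1 < #|S|)%N.
  by move: S_even; rewrite (cardsD1 i) iS add1n /= negbK; case: #|_|.
case/card_gt1P=> {iS}i [j [iS jS ij]].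
have jSi : j \in S :\ i by rewrite !inE eq_sym ij jS.
have cS : #|S| = #|S :\ i :\ j|.+2 by rewrite (cardsD1 i) iS (cardsD1 j) jSi.
have -> : flipped e v S = flipped e v (S :\ i :\ j) - (e i + e j).
  rewrite /flipped (big_setD1 i) //= (big_setD1 j) //=; vec dot.
apply: (longB HPhi); last by rewrite dotDr !flipped_frame // !inE !eqxx andbF /=; lra.
  by apply: IHn; move: Sn S_even; rewrite cS //= ?negbK // => /ltnW.
by have [] := De.2 i j ij.
Qed.

Lemma dot_flipped_r e v S u : dot u (flipped e v S) = dot u v - \sum_(i in S) dot u (e i).
Proof.
rewrite dC dot_flipped (dC v u); congr (_ - _).
by apply: eq_bigr => i _; apply: dC.
Qed.

Lemma dot_flipped_half e v S u : (forall i, dot u (e i) = 1 / 2) ->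
  dot u (flipped e v S) = dot u v - #|S|%:R / 2.
Proof.
move=> uh; rewrite dot_flipped_r; congr (_ - _).
rewrite (eq_bigr (fun=> 1 / 2)) // sumr_const mul1r mulr_natl //.
Qed.

Lemma long_bounds a b : long a -> long b ->
  [\/ a = b, a = - b | -1 <= dot a b <= 1].
Proof.
move=> La Lb; case: (long_dot HcPhi La Lb) => h; [constructor 1|constructor 2|constructor 3] => //.
by case/unit_intP: h => ->; apply/andP; split; lra.
Qed.

(* Compare [a] with the flips of [v]: the pairings have to stay in [[-1, 1]]. *)
Lemma same_signs e v a : spin e v -> spin e a -> a != v ->
  [/\ #|T| != 5%N, #|T| != 8%N & #|T| = 6%N -> a = \sum_i e i - v].
Proof.
move=> sv sa av; have [De Lv vh] := sv; have [_ La ah] := sa.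
have [i0 _] : exists i0 : T, i0 \in T by apply/card_gt0P; case: #|T| T4.
have hz : -1 <= dot a v <= 1.
  case: (long_bounds La Lv) => // h; first by rewrite h eqxx in av.
  by have := ah i0; rewrite h dotNl vh; lra.
have cmp S : ~~ odd #|S| -> S != set0 -> [\/ a = - flipped e v S
    | -1 <= dot a v - #|S|%:R / 2 <= 1].
  move=> So /set0Pn[i iS]; rewrite -(dot_flipped_half _ _ ah).
  case: (long_bounds La (flipped_long sv So)) => h; [exfalso|by left|by right].
  by have := ah i; rewrite h flipped_frame // iS /=; lra.
have T0 : [set: T] != set0 by apply/set0Pn; exists i0; rewrite inE.
split.
(* Flipping four signs lowers the pairing by 2, which forces [dot a v = 1]. Then [a] plus the
   flipped root is long and is a vector weight at [i0], against maximality. *)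
- apply/negP => /eqP T5.
  have c4 : #|[set~ i0]| = 4%N by rewrite cardsC1 T5.
  have D0 : [set~ i0] != set0 by rewrite -card_gt0 c4.
  have Lb : long (flipped e v [set~ i0]) by apply: flipped_long; rewrite ?c4.
  have [||h|] := cmp [set~ i0]; rewrite ?c4 //.
    by have := ah i0; rewrite h dotNl flipped_frame // !inE eqxx /=; lra.
  move=> h; have e1 : dot a v = 1 by lra.
  apply: (@no_vector e (a + flipped e v [set~ i0]) i0 1) => //; last 2 first.
  - by left.
  - move=> j; rewrite dotDl ah flipped_frame // !inE; case: eqP => _ /=; lra.
  apply: longD => //; rewrite dot_flipped_half // c4 e1; lra.
(* Flipping all eight signs lowers the pairing by 4, so [a] is the opposite of the flipped root.
   Then [dot a v = 2], too large for distinct long roots. *)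
- apply/negP => /eqP T8.
  have c8 : #|[set: T]| = 8%N by rewrite cardsT.
  have [||h|] := cmp [set: T]; rewrite ?c8 //; last by lra.
  have [_ v2] := longP Lv.
  have := dot_flipped_half v [set: T] vh; rewrite c8 v2 => hv.
  move: hz; rewrite h dotNl (dC _ v) hv; lra.
- move=> T6; have c6 : #|[set: T]| = 6%N by rewrite cardsT.
  have [||h|] := cmp [set: T]; rewrite ?c6 //; last by move=> h; exfalso; lra.
  rewrite h /flipped opprB; congr (_ - _); apply: eq_bigl => i; by rewrite inE.
Qed.

(** With four members the triality frame makes [v] a vector weight, against maximality. With seven,
    [v] plus its flip outside one index is a vector weight. With nine or more, [v] and a flip of
    eight signs pair to 2 - 4 = -2, so they are opposite, which fails at an index that is not
    flipped. *)
Lemma spin_card e v : spin e v -> [\/ #|T| = 5%N, #|T| = 6%N | #|T| = 8%N].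
Proof.
move=> sv; have [De Lv vh] := sv; have [_ v2] := longP Lv.
have [i0 _] : exists i0 : T, i0 \in T by apply/card_gt0P; case: #|T| T4.
have n4 : #|T| != 4%N.
  apply/negP => /eqP cT; have eqc : #|{: bool * bool}| = #|T| by rewrite card_Q cT.
  pose h x := enum_val (cast_ord eqc (enum_rank x)).
  have h_inj : injective h by move=> x y /enum_val_inj/cast_ord_inj/enum_rank_inj.
  pose g x := e (h x).
  have Dg : Dframe g.
    split=> [x y|x y xy]; first by rewrite De.1 (inj_eq h_inj).
    by apply: De.2; rewrite (inj_eq h_inj).
  have := Dframe_ext HPhi (trial_Dframe HPhi Dg) _ Lv (or_introl erefl).
  move=> /(_ (false, false)); rewrite card_Q; case=> // [|T' [e' [De' cT']]].
    by move=> [[] []]; rewrite dot_trial /g !vh /=; lra.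
  by have := Tmax De'; rewrite cT' cT.
have n7 : #|T| != 7%N.
  apply/negP => /eqP cT.
  have c6 : #|[set~ i0]| = 6%N by rewrite cardsC1 cT.
  have Lb : long (flipped e v [set~ i0]) by apply: flipped_long; rewrite ?c6.
  apply: (@no_vector e (v + flipped e v [set~ i0]) i0 1) => //; last 2 first.
  - by left.
  - move=> j; rewrite dotDl vh flipped_frame // !inE; case: eqP => _ /=; lra.
  apply: longD => //; rewrite dot_flipped_half // c6 v2; lra.
have n9 : (#|T| < 9)%N.
  rewrite ltnNge; apply/negP => cT.
  have : (8 <= #|[set~ i0]|)%N by rewrite cardsC1; case: #|T| cT.
  case/card_geqP=> l [ul sl lT].
  have c8 : #|[set x in l]| = 8%N by rewrite cardsE (card_uniqP ul) sl.
  have Lb : long (flipped e v [set x in l]) by apply: flipped_long; rewrite ?c8.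
  have i0l : i0 \notin [set x in l].
    by rewrite inE; apply/negP => /lT; rewrite !inE eqxx.
  case: (long_bounds Lv Lb); rewrite ?dot_flipped_half // ?c8 ?v2; last by lra.
    move=> h; have [i il] : exists i, i \in [set x in l].
      by apply/card_gt0P; rewrite c8.
    by have := vh i; rewrite h flipped_frame // il /=; lra.
  move=> h; have := vh i0; rewrite h dotNl flipped_frame // (negPf i0l) /=; lra.
move: T4 n4 n7 n9; case: #|T| => [|[|[|[|[|[|[|[|[|n]]]]]]]]] // _ _ _ _;
  by [constructor 1 | constructor 2 | constructor 3].
Qed.

Definition resign e S i := (if i \in S then -1 else 1) *: e i.

Lemma spin_resign e v S : spin e v -> ~~ odd #|S| -> spin (resign e S) (flipped e v S).
Proof.
move=> sv So; have [De Lv vh] := sv; split.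
- by apply: (Dframe_sign HPhi De) => i; case: ifP; [right | left].
- exact: flipped_long.
- move=> i; rewrite /resign dotZr flipped_frame //.
  by case: (i \in S) => /=; lra.
Qed.

Lemma sum_resign e S : \sum_i resign e S i = \sum_(i in ~: S) e i - \sum_(i in S) e i.
Proof.
rewrite (bigID (mem S)) /= addrC -sumrN; congr (_ + _); last first.
  by apply: eq_bigr => i iS; rewrite /resign iS scaleN1r.
by apply: eq_big => i; rewrite ?inE // => iS; rewrite /resign (negPf iS) scale1r.
Qed.

(** Changing the signs of the frame on [A] makes both [a] and [flipped e v A] pair to 1/2 with every
    member, and [same_signs] applies. *)
Lemma even_spin e v a A : spin e v -> long a -> ~~ odd #|A| ->
  (forall i, dot a (e i) = 1 / 2 - (i \in A)%:R) ->
  a = flipped e v A \/ (#|T| = 6%N /\ a = - flipped e v (~: A)).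
Proof.
move=> sv La Ao aE; have sv' := spin_resign sv Ao.
have sa : spin (resign e A) a.
  have [De' _ _] := sv'; split=> // i; rewrite /resign dotZr aE.
  by case: (i \in A) => /=; lra.
have [->|ne] := eqVneq a (flipped e v A); [by left | right].
have [n5 n8 h6] := same_signs sv' sa ne.
case: (spin_card sv) => [c|c|c]; [by rewrite c in n5| |by rewrite c in n8].
by split=> //; rewrite (h6 c) sum_resign /flipped; vec dot.
Qed.

(** After an even change of signs, [a] has a single negative pairing, at [i]. Its pairings with [v']
    and with the full flip of [v'] differ by [#|T| / 2 - 1]. For eight members this is 3, too much
    for two numbers in [-1, 1]; for six it is 2, so [dot a v' = 1] and [a - v'] is a vector weight,
    against maximality. *)
Lemma odd_spin e v a A : spin e v -> long a -> odd #|A| ->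
  (forall i, dot a (e i) = 1 / 2 - (i \in A)%:R) -> #|T| = 5%N.
Proof.
move=> sv La Ao aE; case: (spin_card sv) => // cT; exfalso.
all: have [i iA] : exists i, i \in A by apply/card_gt0P; case: #|A| Ao.
all: have A'o : ~~ odd #|A :\ i| by move: Ao; rewrite (cardsD1 i) iA.
all: have sv' := spin_resign sv A'o; have [De' Lv' v'h] := sv'.
all: set e' := resign e _ in sv' De' v'h; set v' := flipped e v _ in sv' Lv' v'h.
all: have ae' j : dot a (e' j) = 1 / 2 - (j == i)%:R
  by rewrite /e' /resign dotZr aE !inE; case: eqP => [->|_] /=; rewrite ?iA /=;
     [lra | case: (j \in A) => /=; lra].
all: have Lb : long (flipped e' v' [set: T]) by apply: flipped_long; rewrite // cardsT cT.
all: have sE : \sum_(j in [set: T]) dot a (e' j) = #|T|%:R / 2 - 1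
  by rewrite (eq_bigl xpredT) => [|j]; rewrite ?inE // (eq_bigr (fun j => 1 / 2 - (j == i)%:R)) //
     sumrB sumr_const mul1r mulr_natl (bigD1 i) //= big1 ?eqxx ?addr0 // => j /negPf ->.
all: have [j ji] := other_index (T2 : (2 < #|T|)%N) i; rewrite eq_sym in ji.
all: have h1 : -1 <= dot a v' <= 1
  by case: (long_bounds La Lv') => // h; exfalso;
     [have := ae' i; rewrite h v'h eqxx /=; lra
     |have := ae' j; rewrite h dotNl v'h (negPf ji) /=; lra].
all: have h2 : -1 <= dot a v' - (#|T|%:R / 2 - 1) <= 1
  by rewrite -sE -dot_flipped_r; case: (long_bounds La Lb) => // h; exfalso;
     [have := ae' j; rewrite h flipped_frame // inE (negPf ji) /=; lra
     |have := ae' i; rewrite h dotNl flipped_frame // inE eqxx /=; lra].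
all: rewrite cT in h2.
- have e1 : dot a v' = 1 by lra.
  apply: (@no_vector e' (a - v') i (-1)) => //; first exact: longB.
    by right.
  by move=> x; rewrite dotDl dotNl ae' v'h; case: eqP => _ /=; lra.
- by clear -h1 h2; lra.
Qed.

Lemma odd_setC A : odd #|~: A| = odd #|T| (+) odd #|A|.
Proof. by rewrite -(cardsC A) oddD addbAC addbb. Qed.

Lemma half_set e a : (forall i, dot a (e i) = 1 / 2 \/ dot a (e i) = - (1 / 2)) ->
  exists A, forall i, dot a (e i) = 1 / 2 - (i \in A)%:R.
Proof.
move=> ah; exists [set i | dot a (e i) == - (1 / 2)] => i; rewrite inE.
by case: (ah i) => ->; case: eqP => h /=; lra.
Qed.

Lemma spin_long_cases e v a : spin e v -> long a ->
  [\/ a \in rootsD e,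
      exists2 S : {set T}, ~~ odd #|S| & a = flipped e v S \/ a = - flipped e v S
    | (forall i, dot a (e i) = 0) /\ (dot a v = 0 \/ (#|T| = 6%N /\
        (a = 2 *: v - \sum_i e i \/ a = - (2 *: v - \sum_i e i))))].
Proof.
move=> sv La; have [De Lv vh] := sv; have [_ v2] := longP Lv.
case: (long_frame_cases HcPhi De T2 La) => [aD|a0|[i [s [s1 aE]]]|ah].
- by constructor 1.
- constructor 3; split=> //.
  (* If [b] is orthogonal to the frame and pairs to 1 with [v], then [v - b] is a second long root
     with all pairings 1/2. *)
  have spinB b : long b -> (forall i, dot b (e i) = 0) -> dot v b = 1 ->
      #|T| = 6%N /\ b = 2 *: v - \sum_i e i.
    move=> Lb b0 vb; have La' := longB HPhi Lv Lb vb.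
    have sa : spin e (v - b) by split=> // i; rewrite dotDl dotNl vh b0 subr0.
    have ne : v - b != v.
      by rewrite -subr_eq0 addrAC subrr add0r oppr_eq0 (long_neq0 HPhi Lb).
    have [n5 n8 h6] := same_signs sv sa ne.
    case: (spin_card sv) => [c|c|c]; [by rewrite c in n5| |by rewrite c in n8].
    split=> //; have := h6 c => eb.
    by rewrite (_ : b = v - (v - b)); [rewrite eb; vec dot | vec dot].
  case: (long_dot HcPhi La Lv) => [e0|e0|/unit_intP[e0|e0|e0]].
  + have [i _] : exists i0 : T, i0 \in T by apply/card_gt0P; case: #|T| T4.
    by exfalso; have := vh i; rewrite -e0 a0 => h; clear e0; lra.
  + have [i _] : exists i0 : T, i0 \in T by apply/card_gt0P; case: #|T| T4.
    by exfalso; have := a0 i; rewrite e0 dotNl vh => h; clear e0; lra.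
  + right; have [||c ea] := spinB (- a) (longN HPhi La).
    * by move=> i; rewrite dotNl a0 oppr0.
    * by rewrite dotNr dC e0 opprK.
    * by split=> //; right; rewrite -ea opprK.
  + by left.
  + right; have [||c ea] := spinB a La => //; first by rewrite dC.
    by split=> //; left.
- by case: (no_vector De La s1 aE).
- have [A aE] := half_set ah; constructor 2.
  have [Ao|Ao] := boolP (odd #|A|); last first.
    case: (even_spin sv La Ao aE) => [->|[c ->]]; first by exists A => //; left.
    exists (~: A); last by right.
    by rewrite odd_setC c (negPf Ao).
  have cT := odd_spin sv La Ao aE.
  have CA : ~~ odd #|~: A|.
    by rewrite odd_setC cT Ao.
  case: (@even_spin e v (- a) (~: A) sv (longN HPhi La) CA) => [i|h|[c6 _]].
  + by rewrite dotNl aE inE; case: (i \in A) => /=; lra.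
  + by exists (~: A) => //; right; rewrite -h opprK.
  + by rewrite cT in c6.
Qed.

(** Type E has no second length. A short vector orthogonal to the frame but not to [v] yields, by
    reflection, another root with all pairings 1/2. This requires six members and squared norm 2 for
    the double or triple of the vector, which actually has 4 or 6. A frame vector would pair to 1/2
    with [v], and a spin weight would have norm at least 5/4. *)
Lemma spin_short e v d : spin e v -> short d ->
  (forall i, dot d (e i) = 0) /\ dot d v = 0.
Proof.
move=> sv Sd; have [De Lv vh] := sv; have [_ v2] := longP Lv; have eG := De.1.
have [dP dd dL] := Sd.
case: (short_frame_cases De T2 Sd) => [d0|[i [s [s1 de]]]|dh].
- split=> //.
  have spinB b : short b -> (forall i, dot b (e i) = 0) -> dot b v = 1 -> False.
    move=> Sb b0 bv.
    have key c : c != 0 -> long (v - c *: b) -> c * c * dot b b = 2.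
      move=> c0 La'.
      have sa : spin e (v - c *: b).
        by split=> // i; rewrite dotDl dotNl dotZl vh b0 mulr0 subr0.
      have ne : v - c *: b != v.
        rewrite -subr_eq0 addrAC subrr add0r oppr_eq0 scaler_eq0 (negPf c0) /=.
        exact: (short_neq0 Sb).
      have [n5 n8 h6] := same_signs sv sa ne.
      case: (spin_card sv) => [cT|cT|cT]; [by rewrite cT in n5| |by rewrite cT in n8].
      have cb : c *: b = 2 *: v - \sum_i e i.
        by rewrite (_ : c *: b = v - (v - c *: b)); [rewrite (h6 cT); vec dot | vec dot].
      have sv1 : dot (\sum_i e i) v = 3.
        rewrite dot_suml (eq_bigr (fun=> 1 / 2)) => [|i _]; last by rewrite dC vh.
        by rewrite sumr_const cT; lra.
      have se i : dot (\sum_i e i) (e i) = 1.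
        rewrite dot_suml (bigD1 i) //= big1 ?addr0 ?eG ?eqxx // => j /negPf ji.
        by rewrite eG ji.
      have ss : dot (\sum_i e i) (\sum_i e i) = 6.
        rewrite dot_suml (eq_bigr (fun=> 1)) => [|i _]; last by rewrite dC se.
        by rewrite sumr_const cT.
      transitivity (dot (c *: b) (c *: b)); first by rewrite !dotE; ring.
      by rewrite cb !dotE v2 ss (dC v) sv1; ring.
    have vb : dot v b = 1 by rewrite dC.
    case: (short_rf HPhi Sb Lv bv) => -[bb /key]; rewrite bb pnatr_eq0 => /(_ isT);
      lra.
  case/unit_intP: (dL v Lv) => // h; exfalso.
    apply: (spinB (- d)).
    + split; first exact: on_lineN.
        by rewrite dotNl dotNr opprK.
      by move=> a La; rewrite dotNl unit_intN dL.
    + by move=> i; rewrite dotNl d0 oppr0.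
    + by rewrite dotNl h opprK.
  exact: (spinB d).
- exfalso; case/unit_intP: (dL v Lv); rewrite de dotZl dC vh;
    case: s1 => ->; lra.
- exfalso; have [h _] := half_norm eG dh.
  have : (5 <= #|T|)%N by case: (spin_card sv) => ->.
  rewrite -(ler_nat R) => h5; case: dd => hd; rewrite hd in h; lra.
Qed.

End Spin.

(** * Types E6, E7 and E8 *)

Section TypeE.
Variables (R : realType) (V : vectType R) (dot : {dot V for idfun}).
Variable Phi : seq V.
Hypotheses (HPhi : root_system dot Phi) (HcPhi : crystallographic dot Phi).
Local Notation long := (long dot Phi).
Local Notation component := (component dot Phi).
Local Notation Dframe := (Dframe dot Phi).
Local Notation spin := (spin dot Phi).
Local Notation dC := (dotC dot).
Variables (T : finType) (e : T -> V) (v : V).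
Hypothesis T4 : (3 < #|T|)%N.
Hypothesis Tmax : forall (T' : finType) (e' : T' -> V), Dframe e' -> (#|T'| <= #|T|)%N.
Hypothesis sv : spin e v.
Implicit Types (S : {set T}) (s : T -> Z).

Let De : Dframe e. Proof. by case: sv. Qed.
Let eG := De.1.
Let Lv : long v. Proof. by case: sv. Qed.
Let vh : forall i, dot v (e i) = 1 / 2. Proof. by case: sv. Qed.
Let T2 : (2 < #|T|)%N. Proof. exact: ltnW. Qed.
(** Twice the part of [v] orthogonal to the frame; with six members, the root of E7 orthogonal to
    its D6. *)
Let P := 2 *: v - \sum_i e i.

Lemma spin_pole_long : #|T| = 6%N -> long P.
Proof.
move=> cT; have c6 : #|[set: T]| = 6%N by rewrite cardsT.
have [_ v2] := longP Lv.
rewrite (_ : P = v + flipped e v [set: T]); last first.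
  rewrite /flipped (eq_bigl xpredT) => [|i]; last by rewrite inE.
  by rewrite /P; vec dot.
apply: longD => //; first by apply: flipped_long; rewrite ?c6.
by rewrite dot_flipped_half // c6 v2; lra.
Qed.

Lemma component_spin M : ambivalent dot M -> M != [::] ->
  (forall m, m \in M -> [\/ m \in rootsD e,
     exists2 S : {set T}, ~~ odd #|S| & m = flipped e v S | #|T| = 6%N /\ m = P]) ->
  (forall a, a \in rootsD e -> on_line M a) ->
  (forall S, ~~ odd #|S| -> on_line M (flipped e v S)) ->
  (#|T| = 6%N -> on_line M P) -> component M.
Proof.
move=> ambM M0 Mc MD Mf MP.
have ML m : m \in M -> long m.
  case/Mc=> [/(rootsD_long HPhi De)//|[S So ->]|[cT ->]]; first exact: flipped_long.
  exact: spin_pole_long.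
have Mortho u m : (forall i, dot u (e i) = 0) -> dot u v = 0 -> m \in M -> dot u m = 0.
  move=> ue uv /Mc[mD|[S So ->]|[cT ->]].
  - by apply: (rootsB_ortho ue); rewrite mem_cat mD.
  - by rewrite dot_flipped_r uv big1 ?subrr // => i _; rewrite ue.
  - rewrite dotDr dotNr dotZr uv mulr0 sub0r (dC u) dot_suml big1 ?oppr0 // => i _.
    by rewrite dC ue.
apply: (component_intro HPhi HcPhi) => //.
- by move=> m /ML Lm; split; [apply: long_neq0 Lm | apply: long_line Lm].
- by move=> m u /ML Lm; apply.
- move=> a La; case: (spin_long_cases HPhi HcPhi T4 Tmax sv La).
  + by move=> /MD; left.
  + by case=> S So [->|->]; left; [apply: Mf | apply/on_lineN/Mf].
  + case=> ae [av|[cT [->|->]]]; [right=> m | left | left]; first exact: Mortho.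
      exact: MP.
    exact/on_lineN/MP.
- move=> d Sd; right=> m.
  by have [de dv] := spin_short HPhi HcPhi T4 Tmax sv Sd; apply: Mortho.
Qed.

Definition neg_set s : {set T} := [set i | Z.eqb (s i) (-1)].

Lemma odd_neg_set s : pm1 s -> odd #|neg_set s| = ~~ zeven (map s (enum T)).
Proof.
move=> s1; rewrite zeven_map // negbK; congr odd.
by rewrite enumT /neg_set cardsE cardE /enum_mem size_filter.
Qed.

Lemma sum_signs s : pm1 s ->
  \sum_i (zR R (s i) / 2) *: e i + (v - (1 / 2) *: \sum_i e i) = flipped e v (neg_set s).
Proof.
move=> s1; rewrite /flipped [X in _ = _ - X]big_mkcond /=.
rewrite (eq_bigr (fun i => (1 / 2) *: e i - (if i \in neg_set s then e i else 0))).
  by rewrite sumrB -scaler_sumr; vec dot.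
move=> i _; rewrite inE; case: (s1 i) => -> /=; first by rewrite subr0.
by rewrite (zRN R 1%ZZ) mulNr; vec dot.
Qed.

Lemma signs_of_set S : exists2 s, pm1 s & neg_set s = S.
Proof.
exists (fun i => if i \in S then (-1)%ZZ else 1%ZZ) => [i|].
  by case: ifP; [right | left].
by apply/setP => i; rewrite inE; case: (i \in S).
Qed.

Section Lists.
Variables (tl : seq V) (y0 : seq Z).
Hypothesis tl0 : phi tl y0 = 0.
Local Notation bs := (half_frame e (enum T) ++ tl).

Lemma zpairs_rootsD x : x \in zpairs #|T| -> phi bs (x ++ y0) \in rootsD e.
Proof.
rewrite cardE => /(zpairs_map (enum_uniq _))[a [b [c [ab _ _ c2 ->]]]].
rewrite (_ : phi _ _ = e a + (zR R c / 2) *: e b); last first.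
  by rewrite phi_cat_map tl0 addr0; apply: sum_pair_vec.
apply/rootsDP; case: c2 => ->; rewrite ?zR2h ?zRN2h ?scaleN1r ?scale1r.
  by exists (a, false), (b, true); rewrite /sframe /= opprK.
by exists (a, false), (b, false).
Qed.

Lemma rootsD_zpairs (M : seq V) a :
  (forall x, x \in zpairs #|T| -> phi bs (x ++ y0) \in M) ->
  a \in rootsD e -> on_line M a.
Proof.
move=> Mpair /rootsDP[x [y [xy ->]]].
have pairM i j c : i != j -> c = 2%ZZ \/ c = (-2)%ZZ ->
    (index i (enum T) < index j (enum T))%N -> e i + (zR R c / 2) *: e j \in M.
  move=> ij c2 lt.
  have -> : e i + (zR R c / 2) *: e j = phi bs (map (pair_vec i j c) (enum T) ++ y0).
    by rewrite phi_cat_map tl0 addr0 sum_pair_vec.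
  by apply: Mpair; rewrite cardE zpairs_mem ?mem_enum ?enum_uniq.
wlog ixy : x y xy / (index x.1 (enum T) < index y.1 (enum T))%N.
  move=> IH; have := xy.
  rewrite -(inj_in_eq (@index_inj _ x.1 (enum T))) ?inE ?mem_enum //.
  rewrite neq_ltn => /orP[|lt]; first exact: IH.
  by rewrite -opprB; apply: on_lineN; apply: IH; rewrite // eq_sym.
have := pairM x.1 y.1 2%ZZ xy (or_introl erefl) ixy.
have := pairM x.1 y.1 (-2)%ZZ xy (or_intror erefl) ixy.
rewrite zR2h zRN2h scaleN1r scale1r => m1 m2.
rewrite /sframe; case: x.2; case: y.2; rewrite ?opprK.
- by rewrite addrC -opprB; apply/on_lineN/mem_on_line.
- by rewrite -opprD; apply/on_lineN/mem_on_line.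
- exact: mem_on_line.
- exact: mem_on_line.
Qed.

End Lists.

(** Removing from [v] its projection to the frame leaves squared norm [2 - #|T| / 4], from which the
    weights 3 and 2 of the extra axis in E6 and E7 are obtained. *)
Lemma ortho_pole (c : Z) : 2 - #|T|%:R / 4 = zR R c / 4 ->
  ortho_fam dot (1 / 4) (nseq #|T| 1%ZZ ++ [:: c])
    (half_frame e (enum T) ++ [:: v - (1 / 2) *: \sum_i e i]).
Proof.
move=> hc; have [_ v2] := longP Lv; rewrite [#|T|]cardE; apply: (ortho_half_frame eG).
- exact: enum_uniq.
- move=> i u; rewrite inE => /eqP ->; rewrite dotDr dotNr dotZr (dC _ v) vh (dC (e i)).
  rewrite dot_suml (bigD1 i) //= big1 ?eG ?eqxx ?addr0 /=; first by ring.
  by move=> j /negPf ji; rewrite eG ji.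
- split=> //=; have := bessel_eq v eG.
  rewrite (eq_bigr (fun i => (1 / 2) *: e i)) => [|i _]; last by rewrite vh.
  rewrite [X in _ = _ - X](eq_bigr (fun=> 1 / 4)) => [|i _]; last by rewrite vh; field.
  rewrite -scaler_sumr => ->; rewrite v2 sumr_const -[_ *+ #|T|]mulr_natl.
  by move: hc; set n := _%:R; set z := zR R c; lra.
Qed.

Lemma component_E6 : #|T| = 5%N -> exists M, component M.
Proof.
move=> cT; pose p := v - (1 / 2) *: \sum_i e i.
pose bs := half_frame e (enum T) ++ [:: p].
have sT : size (enum T) = 5%N by rewrite -cardE.
have ob : ortho_fam dot (1 / 4) weightsE6 bs.
  have := @ortho_pole 3%ZZ; rewrite cT; apply.
  by rewrite (_ : zR R 3%ZZ = 3) //; field.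
have p0 : phi [:: p] [:: 0%ZZ] = 0 by rewrite /= scale0r addr0.
pose M := map (phi bs) rootsE6.
have Mpair x : x \in zpairs #|T| -> phi bs (x ++ [:: 0%ZZ]) \in M.
  rewrite cT => xp; apply: map_f; rewrite mem_cat (cats1 x).
  by rewrite (map_f (rcons^~ 0%ZZ)).
have spinE s : pm1 s -> phi bs (rcons (map s (enum T)) 1%ZZ) = flipped e v (neg_set s).
  move=> s1; rewrite -cats1 phi_cat_map -(sum_signs s1) big_enum /= scale1r addr0.
  by [].
exists M; apply: component_spin; last by rewrite cT.
- exact: ambivalent_E6.
- by rewrite -size_eq0 size_map.
- move=> m /mapP[x + ->]; rewrite mem_cat => /orP[]/mapP[z zP ->].
    by constructor 1; rewrite -cats1; apply: zpairs_rootsD; rewrite ?cT.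
  constructor 2; move: zP; rewrite mem_filter -sT => /andP[ze].
  case/(zsigns_map (enum_uniq _))=> s s1 zE; exists (neg_set s).
    by rewrite odd_neg_set // -zE ze.
  by rewrite zE spinE.
- by move=> a; apply: (rootsD_zpairs p0 Mpair).
- move=> S So; have [s s1 sS] := signs_of_set S; rewrite -sS -spinE //.
  apply/mem_on_line/map_f; rewrite mem_cat (map_f (rcons^~ 1%ZZ)) ?orbT //.
  rewrite mem_filter -sT zsigns_mem // andbT.
  by move: So; rewrite -sS odd_neg_set // negbK.
Qed.

Lemma component_E7 : #|T| = 6%N -> exists M, component M.
Proof.
move=> cT; pose p := v - (1 / 2) *: \sum_i e i.
pose bs := half_frame e (enum T) ++ [:: p].
have sT : size (enum T) = 6%N by rewrite -cardE.
have ob : ortho_fam dot (1 / 4) weightsE7 bs.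
  have := @ortho_pole 2%ZZ; rewrite cT; apply.
  by rewrite (_ : zR R 2%ZZ = 2) //; field.
have p0 : phi [:: p] [:: 0%ZZ] = 0 by rewrite /= scale0r addr0.
pose M := map (phi bs) rootsE7.
have Mpair x : x \in zpairs #|T| -> phi bs (x ++ [:: 0%ZZ]) \in M.
  rewrite cT => xp; apply: map_f; rewrite mem_cat (cats1 x).
  by rewrite (map_f (rcons^~ 0%ZZ)).
have spinE s : pm1 s -> phi bs (rcons (map s (enum T)) 1%ZZ) = flipped e v (neg_set s).
  move=> s1; rewrite -cats1 phi_cat_map -(sum_signs s1) big_enum /= scale1r addr0.
  by [].
have poleE : phi bs (rcons (nseq 6 0%ZZ) 2%ZZ) = P.
  rewrite -cats1 -sT map_const0 phi_cat_map big1 => [|i _]; last first.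
    by rewrite (_ : zR R 0%ZZ / 2 = 0) ?scale0r // mul0r.
  by rewrite /= (_ : zR R 2%ZZ = 2) // /P /p; vec dot.
exists M; apply: component_spin.
- exact: ambivalent_E7.
- by rewrite -size_eq0 size_map.
- move=> m /mapP[x + ->]; rewrite mem_cat => /orP[/mapP[z zP ->]|].
    by constructor 1; rewrite -cats1; apply: zpairs_rootsD; rewrite ?cT.
  rewrite mem_cat mem_seq1 => /orP[/mapP[z zP ->]|/eqP ->]; last by constructor 3.
  constructor 2; move: zP; rewrite mem_filter -sT => /andP[ze].
  case/(zsigns_map (enum_uniq _))=> s s1 zE; exists (neg_set s).
    by rewrite odd_neg_set // -zE ze.
  by rewrite zE spinE.
- by move=> a; apply: (rootsD_zpairs p0 Mpair).
- move=> S So; have [s s1 sS] := signs_of_set S; rewrite -sS -spinE //.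
  apply/mem_on_line/map_f; rewrite !mem_cat (map_f (rcons^~ 1%ZZ)) ?orbT //.
  rewrite mem_filter -sT zsigns_mem // andbT.
  by move: So; rewrite -sS odd_neg_set // negbK.
- move=> _; rewrite -poleE; apply/mem_on_line/map_f.
  by rewrite !mem_cat mem_seq1 eqxx !orbT.
Qed.

Lemma component_E8 : #|T| = 8%N -> exists M, component M.
Proof.
move=> cT; pose bs := half_frame e (enum T) ++ [::].
have sT : size (enum T) = 8%N by rewrite -cardE.
have ob : ortho_fam dot (1 / 4) weightsE8 bs.
  have := @ortho_half_frame R V dot T e eG (enum T) [::] [::] (enum_uniq _).
  by rewrite sT; apply.
have p0 : phi [::] [::] = 0 :> V by [].
have [_ v2] := longP Lv.
(* With eight members the projection has squared norm 8/4 = 2, so it is all of [v]. *)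
have pE : v - (1 / 2) *: \sum_i e i = 0.
  have [_ hv] := half_norm eG (fun i => or_introl (vh i)).
  rewrite {1}hv; last by rewrite v2 cT; field.
  by under eq_bigr do rewrite vh; rewrite -scaler_sumr subrr.
pose M := map (phi bs) rootsE8.
have Mpair x : x \in zpairs #|T| -> phi bs (x ++ [::]) \in M.
  by rewrite cT cats0 => xp; apply: map_f; rewrite mem_cat xp.
have spinE s : pm1 s -> phi bs (map s (enum T)) = flipped e v (neg_set s).
  by move=> s1; rewrite /bs cats0 phi_map -(sum_signs s1) pE addr0 big_enum.
have zeven1 (z : seq Z) : zeven (1%ZZ :: z) = zeven z.
  by rewrite /zeven -[foldr _ _ (_ :: _)]/(Z.mul 1%ZZ (foldr Z.mul 1%ZZ z)) Z.mul_1_l.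
exists M; apply: component_spin; last by rewrite cT.
- exact: ambivalent_E8.
- by rewrite -size_eq0 size_map.
- move=> m /mapP[x + ->]; rewrite mem_cat => /orP[zP|/mapP[z + ->]].
    by constructor 1; rewrite -[x]cats0; apply: zpairs_rootsD; rewrite ?cT.
  rewrite mem_filter => /andP[ze zP]; constructor 2.
  have : 1%ZZ :: z \in zsigns (size (enum T)).
    by rewrite sT zsignsS mem_cat (map_f (cons 1%ZZ)).
  case/(zsigns_map (enum_uniq _))=> s s1 zE; exists (neg_set s).
    by rewrite odd_neg_set // -zE negbK zeven1.
  by rewrite zE spinE.
- by move=> a; apply: (rootsD_zpairs p0 Mpair).
- have head1 s z : pm1 s -> ~~ odd #|neg_set s| -> map s (enum T) = 1%ZZ :: z ->
      on_line M (phi bs (map s (enum T))).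
    move=> s1 So sz; apply/mem_on_line/map_f; rewrite mem_cat; apply/orP; right.
    have : map s (enum T) \in zsigns 8 by rewrite -sT zsigns_mem.
    rewrite sz zsignsS mem_cat => /orP[/mapP[z' z'P [ez]]|/mapP[z' _ []//]].
    apply: map_f; rewrite mem_filter ez z'P andbT -ez.
    by move: So; rewrite odd_neg_set // negbK sz zeven1.
  move=> S So; have [s s1 sS] := signs_of_set S; rewrite -sS -spinE //.
  have := zsigns_mem (enum T) s1; rewrite sT zsignsS mem_cat.
  case/orP=> /mapP[z _ sz]; first by apply: (head1 s z) => //; rewrite sS.
  (* The list fixes the first sign to be 1. Negating all eight signs repairs the first one and
     preserves the parity. *)
  pose s' i := Z.opp (s i).
  have s'E : map s' (enum T) = zneg (map s (enum T)) by rewrite /zneg -map_comp.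
  have s'1 : pm1 s' by move=> i; rewrite /s'; case: (s1 i) => ->; [right | left].
  rewrite -[map s _]znegK -s'E phi_neg; apply/on_lineN/(head1 s' (zneg z)) => //.
    rewrite (_ : neg_set s' = ~: S) ?odd_setC ?cT //.
    by apply/setP => i; rewrite -sS !inE /s'; case: (s1 i) => ->.
  by rewrite s'E sz.
Qed.

Lemma component_spin_frame : exists M, component M.
Proof.
case: (spin_card HPhi HcPhi T4 Tmax sv) => cT.
- exact: component_E6.
- exact: component_E7.
- exact: component_E8.
Qed.

End TypeE.

(** * Components with a frame of type A *)

Section Parity.
Variables (R : realType) (x : R) (a b c d : bool).

(** In these lemmas the booleans record coincidences of indices in products of differences, and [x]
    is a pairing with a short vector. As [x] is -1, 0 or 1, the factor 2 or 3 determines which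
    indices coincide. *)
Lemma parity2 : unit_int x -> 2 * x = 1 - (a%:R - b%:R) -> a (+) b.
Proof. by case/unit_intP=> ->; case: a; case: b => //=; lra. Qed.

Lemma parity2N : unit_int x -> 2 * x = -1 - (a%:R - b%:R) -> a (+) b.
Proof. by case/unit_intP=> ->; case: a; case: b => //=; lra. Qed.

Lemma parity3 : unit_int x -> 3 * x = 1 - (a%:R - b%:R) -> a && ~~ b.
Proof. by case/unit_intP=> ->; case: a; case: b => //=; lra. Qed.

Lemma parity3N : unit_int x -> 3 * x = -1 - (a%:R - b%:R) -> ~~ a && b.
Proof. by case/unit_intP=> ->; case: a; case: b => //=; lra. Qed.

Lemma no_pair0 : a%:R - b%:R - c%:R + d%:R = 0 :> R -> ~~ (a && c) -> ~~ (b && d) ->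
  ~~ (a && b) -> ~~ (c && d) -> [|| a, b, c | d] -> False.
Proof. by case: a; case: b; case: c; case: d => //=; lra. Qed.

Lemma no_pair2 : a%:R - b%:R - c%:R + d%:R = 0 :> R -> ~~ (a && b) -> ~~ (c && d) ->
  a (+) c -> b (+) d -> False.
Proof. by case: a; case: b; case: c; case: d => //=; lra. Qed.

Lemma no_pair3 : a%:R - b%:R - c%:R + d%:R = -1 :> R -> a && ~~ c -> ~~ b && d -> False.
Proof. by case: a; case: b; case: c; case: d => //=; lra. Qed.

Lemma pair1 : a%:R - b%:R - c%:R + d%:R = -1 :> R -> ~~ (a && c) -> ~~ (b && d) ->
  ~~ (a && b) -> ~~ (c && d) -> [&& b, ~~ c & ~~ d] || [&& c, ~~ a & ~~ b].
Proof. by case: a; case: b; case: c; case: d => //=; lra. Qed.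

End Parity.

Section Classification.
Variables (R : realType) (V : vectType R) (dot : {dot V for idfun}).
Local Notation rf := (reflection dot).
Variable Phi : seq V.
Hypotheses (HPhi : root_system dot Phi) (HcPhi : crystallographic dot Phi).
Local Notation long := (long dot Phi).
Local Notation short := (short dot Phi).
Local Notation component := (component dot Phi).
Local Notation Dframe := (Dframe dot Phi).
Local Notation Aframe := (Aframe dot Phi).
Local Notation dC := (dotC dot).

Lemma component_Dphase (T0 : finType) (e0 : T0 -> V) : Dframe e0 -> (3 < #|T0|)%N ->
  exists M, component M.
Proof.
move=> D0 T04.
have [T [e [De Tmax]]] := @max_frame R V (fun T e => Dframe e) _ _ _ (@Dframe_bound _ _ _ _) D0.
have T4 : (3 < #|T|)%N by apply: leq_trans T04 (Tmax _ _ D0).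
have T2 := ltnW T4.
have [[v [Lv vh]]|no] := pselect (exists v, long v /\
    forall i, dot v (e i) = 1 / 2 \/ dot v (e i) = - (1 / 2)).
  pose s i := 2 * dot v (e i).
  have s1 i : s i = 1 \/ s i = -1 by rewrite /s; case: (vh i) => ->; [left | right]; field.
  apply: (@component_spin_frame _ _ _ _ HPhi HcPhi _ (fun i => s i *: e i) v T4 Tmax).
  split=> //; first exact: Dframe_sign.
  by move=> i; rewrite dotZr /s; case: (vh i) => ->; field.
apply: (component_Dfinal HPhi HcPhi De T2) => a La.
case: (long_frame_cases HcPhi De T2 La) => [aD|a0|[i [s [s1 aE]]]|ah].
- by left.
- by right.
- by case: (no_vector HPhi T4 Tmax De La s1 aE).
- by case: no; exists a.
Qed.

Lemma long_unit a b c : long a -> long b -> c = dot a b -> a != b -> a != - b -> unit_int c.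
Proof. by move=> La Lb ->; case: (long_dot HcPhi La Lb) => [->|->|] //; rewrite eqxx. Qed.

Section AFrames.
Variables (T : finType) (f : T -> V).
Hypotheses (Af : Aframe f) (T2 : (2 < #|T|)%N).
Let fG := Af.1.

Lemma A_dotB b i j : dot b (f i) - dot b (f j) = dot b (f i - f j).
Proof. by rewrite dotDr dotNr. Qed.

(** If [b] is not a difference, its pairings with the members of [f] take at most two values, one
    apart. The cases are: a single value; one of the two values taken only once, which extends the
    frame; both values taken at least twice. *)
Lemma A_cases b : long b ->
  [\/ exists i j, i != j /\ b = f i - f j,
      forall i j, dot b (f i - f j) = 0,
      (exists i, forall l, l != i -> dot b (f i - f l) = 1) \/
      (exists i, forall l, l != i -> dot (- b) (f i - f l) = 1)
    | exists i i' j j', [/\ i != i', j != j', dot b (f i - f j) = 1,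
        dot b (f i - f i') = 0 & dot b (f j - f j') = 0]].
Proof.
move=> Lb.
have [?|nroot] := pselect (exists i j, i != j /\ b = f i - f j); first by constructor 1.
have bu i j : unit_int (dot b (f i - f j)).
  have [->|ij] := eqVneq i j; first by rewrite subrr dot0r; apply/unit_intP; constructor 2.
  apply: (long_unit Lb (Af.2 i j ij) erefl); apply/negP => /eqP h; apply: nroot.
    by exists i, j.
  by exists j, i; rewrite eq_sym h opprB.
have [[i [j bij]]|no1] := pselect (exists i j, dot b (f i - f j) = 1); last first.
  constructor 2 => i j; case/unit_intP: (bu i j) => // h; exfalso; apply: no1.
    by exists j, i; rewrite -opprB dotNr h opprK.
  by exists i, j.
have ij : i != j by apply/negP => /eqP h; move: bij; rewrite h subrr dot0r; lra.
have [[i' [ii' bii']]|noi] := pselect (exists i', i != i' /\ dot b (f i - f i') = 0).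
  have [[j' [jj' bjj']]|noj] := pselect (exists j', j != j' /\ dot b (f j - f j') = 0).
    by constructor 4; exists i, i', j, j'.
  constructor 3; right; exists j => l lj; rewrite dotNl.
  case/unit_intP: (bu j l) => h; first by rewrite h opprK.
    by case: noj; exists l; rewrite eq_sym.
  by case/unit_intP: (bu i l); rewrite -A_dotB; move: h bij; rewrite -!A_dotB; lra.
constructor 3; left; exists i => l li.
case/unit_intP: (bu i l) => h //; last by case: noi; exists l; rewrite eq_sym.
by case/unit_intP: (bu l j); rewrite -A_dotB; move: h bij; rewrite -!A_dotB; lra.
Qed.

(* A3 = D3: four members of a frame of type A give a frame of type D with three. *)
Definition D3_of (i i' j j' : T) (o : option bool) : V := (1 / 2) *:
  match o with
  | None => (f i - f j') + (f i' - f j') - (f j - f j')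
  | Some true => (f i - f j') - (f i' - f j') + (f j - f j')
  | Some false => (f i - f j') - (f i' - f j') - (f j - f j')
  end.

Section D3.
Variables (i i' j j' : T).
Hypotheses (h1 : i != i') (h2 : i != j) (h3 : i != j') (h4 : i' != j) (h5 : i' != j')
  (h6 : j != j').
Let u := f i - f j'.
Let v := f i' - f j'.
Let w := f j - f j'.

Lemma D3_gram : [/\ dot u u = 2, dot v v = 2, dot w w = 2
  & [/\ dot u v = 1, dot u w = 1 & dot v w = 1]].
Proof.
rewrite /u /v /w !fG !eqxx ?(eq_sym j' i) ?(eq_sym j' i') ?(eq_sym j' j).
rewrite (negPf h1) (negPf h2) (negPf h3) (negPf h4) (negPf h5) (negPf h6) /=.
by split; first [ring | split; ring].
Qed.

Lemma D3_Dframe : Dframe (D3_of i i' j j').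
Proof.
have [uu vv ww [uv uw vw]] := D3_gram.
have Lu : long u by apply: Af.2.
have Lv : long v by apply: Af.2.
have Lw : long w by apply: Af.2.
have e1 : D3_of i i' j j' None = (1 / 2) *: (u + v - w) by [].
have e2 : D3_of i i' j j' (Some true) = (1 / 2) *: (u - v + w) by [].
have e3 : D3_of i i' j j' (Some false) = (1 / 2) *: (u - v - w) by [].
have Luv : long (u - v) by apply: longB.
have Luw : long (u - w) by apply: longB.
have Lvw : long (v - w) by apply: longB.
move: (D3_of i i' j j') e1 e2 e3 uu vv ww uv uw vw Lu Lv Lw Luv Luw Lvw.
move: u v w => u0 v0 w0 e e1 e2 e3 uu vv ww uv uw vw Lu Lv Lw Luv Luw Lvw.
split=> [[[]|] [[]|]|].
1-9: by rewrite ?e1 ?e2 ?e3 !dotE uu vv ww ?(dC v0 u0) ?(dC w0 u0) ?(dC w0 v0) uv uw vw /=; field.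
have p12 : e None + e (Some true) = u0 by rewrite e1 e2; vec dot.
have m12 : e None - e (Some true) = v0 - w0 by rewrite e1 e2; vec dot.
have p13 : e None + e (Some false) = u0 - w0 by rewrite e1 e3; vec dot.
have m13 : e None - e (Some false) = v0 by rewrite e1 e3; vec dot.
have p23 : e (Some true) + e (Some false) = u0 - v0 by rewrite e2 e3; vec dot.
have m23 : e (Some true) - e (Some false) = w0 by rewrite e2 e3; vec dot.
have sym a b : long (a + b) -> long (a - b) -> long (b + a) /\ long (b - a).
  by move=> k1 k2; rewrite addrC; split=> //; rewrite -opprB; apply: longN.
by move=> [[]|] [[]|] // _; first [by rewrite ?p12 ?m12 ?p13 ?m13 ?p23 ?m23 |
  by apply: sym; rewrite ?p12 ?m12 ?p13 ?m13 ?p23 ?m23].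
Qed.

End D3.

Lemma card_option_bool : #|{: option bool}| = 3%N.
Proof. by rewrite card_option card_bool. Qed.

(** Two indices of each value give a D3 frame on which [b] is a vector weight: it pairs to 1 with
    the member [None] and to 0 with the others. So [b] extends it to a D4 frame. *)
Lemma A_Dtype b i i' j j' : long b -> i != i' -> j != j' -> dot b (f i - f j) = 1 ->
  dot b (f i - f i') = 0 -> dot b (f j - f j') = 0 -> exists M, component M.
Proof.
move=> Lb ii' jj' bij bii' bjj'.
have neq x y : dot b (f x - f y) != 0 -> x != y.
  by apply: contraNneq => ->; rewrite subrr dot0r.
have ij : i != j by apply: neq; rewrite bij oner_eq0.
have bij' : dot b (f i - f j') = 1.
  by move: bij bjj'; rewrite -!A_dotB; lra.
have bi'j : dot b (f i' - f j) = 1 by move: bij bii'; rewrite -!A_dotB; lra.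
have bi'j' : dot b (f i' - f j') = 1 by move: bij' bii'; rewrite -!A_dotB; lra.
have ij' : i != j' by apply: neq; rewrite bij' oner_eq0.
have i'j : i' != j by apply: neq; rewrite bi'j oner_eq0.
have i'j' : i' != j' by apply: neq; rewrite bi'j' oner_eq0.
have De := D3_Dframe ii' ij ij' i'j i'j' jj'.
have [||T' [e' [De' cT']]] := @Dframe_ext _ _ _ _ HPhi _ _ b None 1 De _ Lb (or_introl erefl).
- by rewrite card_option_bool.
- by move=> [[]|]; rewrite /D3_of dotZr dotDr ?[dot b (- _)]dotNr !dotDr ?dotNr
    -?A_dotB; move: bij' bi'j' bjj'; rewrite -!A_dotB /=; lra.
by apply: (component_Dphase De'); rewrite cT' card_option_bool.
Qed.

Hypothesis HL : forall b, long b ->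
  (exists i j, i != j /\ b = f i - f j) \/ forall i j, dot b (f i - f j) = 0.

Lemma avoid_seq (s : seq T) : (size s < #|T|)%N -> exists t, t \notin s.
Proof.
move=> sT; apply/existsP; rewrite -negb_forall; apply/negP => /forallP h.
have := leq_ltn_trans (card_size s) sT; rewrite ltnNge => /negP; apply.
by apply: subset_leq_card; apply/subsetP => x _; apply: h.
Qed.

Lemma uniq_card (s : seq T) : uniq s -> (size s <= #|T|)%N.
Proof. by move=> /card_uniqP <-; apply: max_card. Qed.

Lemma excl_l (k l : T) : k != l -> forall x, ~~ ((x == k) && (x == l)).
Proof. by move=> kl x; apply/negP => /andP[/eqP -> /eqP e]; rewrite e eqxx in kl. Qed.

Lemma excl_r (i j : T) : i != j -> forall x, ~~ ((i == x) && (j == x)).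
Proof. by move=> ij x; apply/negP => /andP[/eqP e /eqP e']; rewrite e e' eqxx in ij. Qed.

(** Reflecting [f i - f j] in [d] gives a long root, which by [HL] expresses [2 *: d] or [3 *: d] by
    differences of [f]. Integrality of the pairings rules out the factor 2 and leaves the factor 3
    only for three members, the situation of G2. Four members are excluded since A3 = D3 occurs
    inside B3. *)
Lemma A_short d i j : #|T| != 4%N -> short d -> dot d (f i - f j) = 1 ->
  #|T| = 3%N /\ exists x y z, [/\ x != y, y != z & x != z] /\
    (3 *: d = (f x - f y) + (f x - f z) \/ 3 *: d = - ((f x - f y) + (f x - f z))).
Proof.
move=> T4 Sd dij; have [_ dd dL] := Sd.
have ij : i != j by apply/negP => /eqP h; move: dij; rewrite h subrr dot0r; lra.
have du x y : unit_int (dot d (f x - f y)).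
  have [->|xy] := eqVneq x y; first by rewrite subrr dot0r; apply/unit_intP; constructor 2.
  exact/dL/Af.2.
have [l0] := @avoid_seq [:: i; j] T2; rewrite !inE negb_or => /andP[l0i l0j].
have fij : dot (f i - f j) (f i - f j) = 2.
  by rewrite fG !eqxx (eq_sym j i) (negPf ij) /=; ring.
have dji : dot (f i - f j) d = 1 by rewrite dC.
have small : (4 < #|T|)%N \/ #|T| = 3%N.
  by move: T2 T4; case: #|T| => [|[|[|[|[|n]]]]] //; [right | left].
case: (short_rf HPhi Sd (Af.2 i j ij) dij) => -[dn Lb].
- exfalso; case: (HL Lb) => [[k [l [kl bE]]]|b0]; last first.
    have := b0 i l0; rewrite dotDl dotNl dotZl fG eqxx !(eq_sym _ l0) (negPf l0i) (negPf l0j).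
    rewrite (eq_sym j i) (negPf ij) /=.
    by case/unit_intP: (du i l0) => ->; lra.
  have bij : dot (f k - f l) (f i - f j) = 0.
    by rewrite -bE dotDl dotNl dotZl fij dij; ring.
  case: small => [T5|T3].
    (* A fifth index [t] contributes nothing to the products with [f i - f j] and [f k - f l], so
       pairing with [f i - f t] and [f j - f t] isolates the coincidences at [i] and at [j]. *)
    have [t] := @avoid_seq [:: i; j; k; l] T5; rewrite !inE !negb_or => /and4P[ti tj tk tl].
    have dE x y : 2 * dot d (f x - f y) = dot (f i - f j) (f x - f y) - dot (f k - f l) (f x - f y).
      by rewrite -bE !dotDl !dotNl !dotZl; ring.
    have ab : (i == k) (+) (i == l).
      have := dE i t; rewrite !fG !eqxx !(eq_sym _ t) (negPf ti) (negPf tj) (negPf tk) (negPf tl).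
      rewrite (eq_sym j i) (negPf ij) (eq_sym k i) (eq_sym l i) /= => h.
      by apply: (parity2 (du i t)); rewrite h; ring.
    have cd : (j == k) (+) (j == l).
      have := dE j t; rewrite !fG !eqxx !(eq_sym _ t) (negPf ti) (negPf tj) (negPf tk) (negPf tl).
      rewrite (negPf ij) (eq_sym k j) (eq_sym l j) /= => h.
      by apply: (parity2N (du j t)); rewrite h; ring.
    move: bij; rewrite fG (eq_sym k i) (eq_sym k j) (eq_sym l i) (eq_sym l j) => bij.
    exact: (no_pair2 bij (excl_r ij k) (excl_r ij l) ab cd).
  have ki : (k == i) || (k == j) || (l == i) || (l == j).
    apply/negPn/negP; rewrite !negb_or => /andP[/andP[/andP[ki kj] li] lj].
    have := @uniq_card [:: i; j; k; l]; rewrite /= !inE !negb_or ij kl T3.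
    by rewrite (eq_sym i k) ki (eq_sym i l) li (eq_sym j k) kj (eq_sym j l) lj => /(_ isT).
  move: bij ki; rewrite fG (eq_sym k i) (eq_sym k j) (eq_sym l i) (eq_sym l j) -!orbA => bij.
  exact: (no_pair0 bij (excl_l kl i) (excl_l kl j) (excl_r ij k) (excl_r ij l)).
- have bij : dot (f i - f j - 3 *: d) (f i - f j) = -1.
    by rewrite dotDl dotNl dotZl fij dij; ring.
  case: (HL Lb) => [[k [l [kl bE]]]|b0]; last by exfalso; move: bij; rewrite b0; lra.
  rewrite bE in bij.
  have d3 : 3 *: d = (f i - f j) - (f k - f l) by rewrite -bE; vec dot.
  case: small => [T5|T3].
    exfalso.
    have [t] := @avoid_seq [:: i; j; k; l] T5; rewrite !inE !negb_or => /and4P[ti tj tk tl].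
    have dE x y : 3 * dot d (f x - f y) = dot (f i - f j) (f x - f y) - dot (f k - f l) (f x - f y).
      by rewrite -bE !dotDl !dotNl !dotZl; ring.
    have ab : (i == k) && ~~ (i == l).
      have := dE i t; rewrite !fG !eqxx !(eq_sym _ t) (negPf ti) (negPf tj) (negPf tk) (negPf tl).
      rewrite (eq_sym j i) (negPf ij) (eq_sym k i) (eq_sym l i) /= => h.
      by apply: (parity3 (du i t)); rewrite h; ring.
    have cd : ~~ (j == k) && (j == l).
      have := dE j t; rewrite !fG !eqxx !(eq_sym _ t) (negPf ti) (negPf tj) (negPf tk) (negPf tl).
      rewrite (negPf ij) (eq_sym k j) (eq_sym l j) /= => h.
      by apply: (parity3N (du j t)); rewrite h; ring.
    move: bij; rewrite fG (eq_sym k i) (eq_sym k j) (eq_sym l i) (eq_sym l j) => bij.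
    exact: (no_pair3 bij ab cd).
  split=> //.
  have : [&& j == k, i != l & j != l] || [&& i == l, i != k & j != k].
    move: bij; rewrite fG (eq_sym k i) (eq_sym k j) (eq_sym l i) (eq_sym l j) => bij.
    exact: (pair1 bij (excl_l kl i) (excl_l kl j) (excl_r ij k) (excl_r ij l)).
  case/orP=> /and3P[/eqP e1 n1 n2].
    exists j, i, l; split; first by split; rewrite // eq_sym.
    by right; rewrite d3 -e1; vec dot.
  exists i, j, k; split; first by split.
  by left; rewrite d3 -e1; vec dot.
Qed.

(* Orthogonal projection of [f i] to the span of the differences. *)
Definition centered i := f i - (#|T|%:R)^-1 *: \sum_l f l.

Lemma centeredB i j : centered i - centered j = f i - f j.
Proof. by rewrite /centered; vec dot. Qed.

Lemma centeredP i j l : dot (centered i) (centered j - centered l)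
  = 1 * ((i == j)%:R - (i == l)%:R).
Proof.
have n0 : #|T|%:R != 0 :> R by rewrite pnatr_eq0 -lt0n; apply: leq_trans T2.
have -> : centered i = (#|T|%:R)^-1 *: \sum_m (f i - f m).
  by rewrite sumrB sumr_const scalerBr -[f i *+ _]scaler_nat scalerA mulVf ?scale1r.
rewrite centeredB dotZl dot_suml (eq_bigr (fun m => (i == j)%:R - (i == l)%:R
  - (m == j)%:R + (m == l)%:R)) => [|m _]; last by rewrite fG.
rewrite big_split sumrB /= sumr_const.
rewrite [X in _ - X + _](bigD1 j) //= [X in _ + X](bigD1 l) //= !eqxx !big1;
  [|by move=> ? /negPf ->|by move=> ? /negPf ->].
by rewrite -[(_ - _) *+ _]mulr_natl; field.
Qed.

Lemma component_A : (forall d, short d -> forall i j, dot d (f i - f j) = 0) ->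
  component (diffs centered).
Proof.
move=> HS.
have DP m : m \in diffs centered -> exists i j, i != j /\ m = f i - f j.
  by case/diffsP=> i [j [ij ->]]; exists i, j; rewrite centeredB.
have Dm i j : i != j -> f i - f j \in diffs centered.
  by move=> ij; apply/diffsP; exists i, j; rewrite centeredB.
apply: (component_intro HPhi HcPhi).
- exact: (ambivalent_diffs (oner_neq0 _) centeredP).
- have /card_gt1P[i [j [_ _ ij]]] := ltnW T2.
  by have := Dm i j ij; case: (diffs _).
- move=> m /DP[i [j [ij ->]]]; have Lm := Af.2 i j ij.
  by split; [apply: long_neq0 Lm | apply: long_line Lm].
- by move=> m v /DP[i [j [ij ->]]] vL; apply/vL/Af.2.
- move=> a /HL[[i [j [ij ->]]]|a0]; [left|right=> m /DP[i [j [_ ->]]]] => //.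
  exact/mem_on_line/Dm.
- by move=> d /HS d0; right=> m /DP[i [j [_ ->]]].
Qed.

(** The family is rewritten as a D3 frame, so that the short vectors of types B3 and C3 are covered
    by the treatment of type D. *)
Lemma component_A3 : #|T| = 4%N -> exists M, component M.
Proof.
move=> T4; have : (3 < #|T|)%N by rewrite T4.
case/card_geqP=> s [us ss _]; case: s us ss => [|i [|i' [|j [|j' []]]]] //=.
rewrite !inE !negb_or => /and4P[/and3P[h1 h2 h3] /andP[h4 h5] h6 _] _.
have De := D3_Dframe h1 h2 h3 h4 h5 h6.
have all4 x : [\/ x = i, x = i', x = j | x = j'].
  have [->|n1] := eqVneq x i; first by constructor 1.
  have [->|n2] := eqVneq x i'; first by constructor 2.
  have [->|n3] := eqVneq x j; first by constructor 3.
  have [->|n4] := eqVneq x j'; first by constructor 4.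
  have := @uniq_card [:: x; i; i'; j; j']; rewrite /= !inE !negb_or.
  by rewrite n1 n2 n3 n4 h1 h2 h3 h4 h5 h6 T4 => /(_ isT).
apply: (component_Dfinal HPhi HcPhi De); first by rewrite card_option_bool.
move=> a La; case: (HL La) => [[x [y [xy aE]]]|a0]; last first.
  by right=> -[[]|]; rewrite /D3_of dotZr !(dotDr, dotNr);
     move: (a0 i j') (a0 i' j') (a0 j j'); rewrite -!A_dotB; lra.
left; pose e := D3_of i i' j j'.
pose u := f i - f j'; pose v := f i' - f j'; pose w := f j - f j'.
have p12 : e None + e (Some true) = u by rewrite /e /D3_of; vec dot.
have m12 : e None - e (Some true) = v - w by rewrite /e /D3_of; vec dot.
have p13 : e None + e (Some false) = u - w by rewrite /e /D3_of; vec dot.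
have m13 : e None - e (Some false) = v by rewrite /e /D3_of; vec dot.
have p23 : e (Some true) + e (Some false) = u - v by rewrite /e /D3_of; vec dot.
have m23 : e (Some true) - e (Some false) = w by rewrite /e /D3_of; vec dot.
have addP o o' : o != o' -> e o + e o' \in rootsD e /\ - (e o + e o') \in rootsD e.
  move=> oo'; split; apply/rootsDP.
    by exists (o, false), (o', true); rewrite /sframe /= opprK.
  by exists (o, true), (o', false); rewrite /sframe /= opprD.
have subP o o' : o != o' -> e o - e o' \in rootsD e /\ - (e o - e o') \in rootsD e.
  move=> oo'; split; apply/rootsDP; first by exists (o, false), (o', false).
  by exists (o', false), (o, false); rewrite eq_sym opprB.
have [Pu Nu] : u \in rootsD e /\ - u \in rootsD e by rewrite -p12; apply: addP.
have [Pvw Nvw] : v - w \in rootsD e /\ - (v - w) \in rootsD e by rewrite -m12; apply: subP.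
have [Puw Nuw] : u - w \in rootsD e /\ - (u - w) \in rootsD e by rewrite -p13; apply: addP.
have [Pv Nv] : v \in rootsD e /\ - v \in rootsD e by rewrite -m13; apply: subP.
have [Puv Nuv] : u - v \in rootsD e /\ - (u - v) \in rootsD e by rewrite -p23; apply: addP.
have [Pw Nw] : w \in rootsD e /\ - w \in rootsD e by rewrite -m23; apply: subP.
have eqv b : b \in rootsD e -> a = b -> a \in rootsD e by move=> ? ->.
case: (all4 x) aE xy => ->; case: (all4 y) => -> aE; rewrite ?eqxx // => _.
- by apply: (eqv _ Puv); rewrite aE /u /v; vec dot.
- by apply: (eqv _ Puw); rewrite aE /u /w; vec dot.
- by apply: (eqv _ Pu); rewrite aE.
- by apply: (eqv _ Nuv); rewrite aE /u /v; vec dot.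
- by apply: (eqv _ Pvw); rewrite aE /v /w; vec dot.
- by apply: (eqv _ Pv); rewrite aE.
- by apply: (eqv _ Nuw); rewrite aE /u /w; vec dot.
- by apply: (eqv _ Nvw); rewrite aE /v /w; vec dot.
- by apply: (eqv _ Pw); rewrite aE.
- by apply: (eqv _ Nu); rewrite aE /u; vec dot.
- by apply: (eqv _ Nv); rewrite aE /v; vec dot.
- by apply: (eqv _ Nw); rewrite aE /w; vec dot.
Qed.

(** The short vectors enter through their triples [S a b c]. These are longer than the differences
    of [f], so the system appears in its dual form, with the same lines. *)
Lemma component_G2 x y z : [/\ x != y, y != z & x != z] -> #|T| = 3%N ->
  on_line Phi ((f x - f y) + (f x - f z)) -> exists M, component M.
Proof.
case=> xy yz xz T3 SxP.
pose S a b c := (f a - f b) + (f a - f c).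
(* Orthogonal axes of squared norms 1/2 and 3/2, in the ratio 1 : 3 prescribed by [weightsG2]. *)
pose b1 := (1 / 2) *: (f x - f y); pose b2 := (1 / 2) *: ((f x - f z) + (f y - f z)).
have ob : ortho_fam dot (1 / 2) weightsG2 [:: b1; b2].
  have z1 : zR R 1%ZZ = 1 by [].
  have z3 : zR R 3%ZZ = 3 by [].
  have eqs := (negPf xy, negPf yz, negPf xz, eq_sym y x, eq_sym z x, eq_sym z y).
  split=> [|b|].
  - by rewrite z1 /b1 !dotZl !dotZr fG !eqs !eqxx /=; field.
  - rewrite inE => /eqP ->; rewrite /b1 /b2 dotZl dotZr (dotDr dot (f x - f z)) !fG !eqs !eqxx /=.
    by field.
  - split=> //; rewrite z3 /b2 dotZl dotZr (dotDl dot (f x - f z)) !(dotDr dot (f x - f z)).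
    rewrite !fG !eqs !eqxx /=.
    by field.
pose M := map (phi [:: b1; b2]) rootsG2.
have ME : M = [:: f x - f y; f x - f z; f z - f y; - S z x y; S x y z; - S y x z].
  have z0 : zR R 0%ZZ = 0 by [].
  have z1 : zR R 1%ZZ = 1 by [].
  have z2 : zR R 2%ZZ = 2 by [].
  have z3 : zR R 3%ZZ = 3 by [].
  have zN1 : zR R (-1)%ZZ = -1 by [].
  rewrite /M /rootsG2 /= z0 z1 z2 z3 zN1 /b1 /b2 /S.
  by do 6?[congr (_ :: _)]; vec dot.
have all3 t : [\/ t = x, t = y | t = z].
  have [->|n1] := eqVneq t x; first by constructor 1.
  have [->|n2] := eqVneq t y; first by constructor 2.
  have [->|n3] := eqVneq t z; first by constructor 3.
  have := @uniq_card [:: t; x; y; z]; rewrite /= !inE !negb_or.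
  by rewrite n1 n2 n3 xy yz xz T3 => /(_ isT).
have SC a b c : S a b c = S a c b by rewrite /S addrC.
have Srf a b c : a != b -> b != c -> a != c -> rf (f a - f b) (S a b c) = S b a c.
  move=> ab bc ac; rewrite rfE /S (dotDl dot (f a - f b)) !fG.
  rewrite !eqxx (eq_sym b a) (eq_sym c a) (eq_sym c b) (negPf ab) (negPf bc) (negPf ac) /=.
  rewrite (_ : 2 * _ / _ = 3); last by field.
  by vec dot.
have SP a b c : a != b -> b != c -> a != c -> on_line Phi (S a b c) -> on_line Phi (S b a c).
  move=> ab bc ac Sa; rewrite -(Srf a b c) //; apply: on_line_rf => //.
  exact: (long_line (Af.2 a b ab)).
have SyP : on_line Phi (S y x z) by apply: SP.
have SzP : on_line Phi (S z x y) by apply: SP; rewrite // 1?eq_sym // SC.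
have Mc m : m \in M -> [\/ exists i j, i != j /\ m = f i - f j,
    m = - S z x y, m = S x y z | m = - S y x z].
  rewrite ME !inE => /orP[/eqP ->|/orP[/eqP ->|/orP[/eqP ->|/orP[/eqP ->|/orP[]/eqP ->]]]].
  - by constructor 1; exists x, y.
  - by constructor 1; exists x, z.
  - by constructor 1; exists z, y; rewrite eq_sym.
  - by constructor 2.
  - by constructor 3.
  - by constructor 4.
have Mortho v m : (forall i j, dot v (f i - f j) = 0) -> m \in M -> dot v m = 0.
  move=> v0; have S0 a b c : dot v (S a b c) = 0.
    by rewrite /S (dotDr dot (f a - f b)) !v0 addr0.
  by case/Mc=> [[i [j [_ ->]]]|->|->|->]; rewrite ?v0 ?(dotNr dot (S _ _ _)) ?S0 ?oppr0.
have ML (m : V) : m \in [:: f x - f y; f x - f z; f z - f y; - S z x y; S x y z; - S y x z] ->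
    on_line M m by rewrite -ME => /mem_on_line.
have MS a b c : a != b -> b != c -> a != c -> on_line M (S a b c).
  have Mx : on_line M (S x y z) by apply: ML; rewrite !inE eqxx !orbT.
  have My : on_line M (S y x z).
    by rewrite -[S y x z]opprK; apply/on_lineN/ML; rewrite !inE eqxx !orbT.
  have Mz : on_line M (S z x y).
    by rewrite -[S z x y]opprK; apply/on_lineN/ML; rewrite !inE eqxx !orbT.
  by case: (all3 a) => ->; case: (all3 b) => ->; case: (all3 c) => ->;
    rewrite ?eqxx // => _ _ _; rewrite // SC.
exists M; apply: (component_intro HPhi HcPhi).
- apply: (@ambivalent_G2 _ _ _ (1 / 2)) => //.
  by rewrite mulf_neq0 ?invr_eq0 ?oner_eq0 ?pnatr_eq0.
- by rewrite -size_eq0 size_map.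
- move=> m mM; have mP : on_line Phi m.
    case: (Mc m mM) => [[i [j [ij ->]]]|->|->|->] //; try exact: on_lineN.
    exact: (long_line (Af.2 i j ij)).
  by split=> //; apply: (on_line_neq0 HPhi).
- move=> m v mM vL; apply: Mortho mM => i j.
  have [->|ij] := eqVneq i j; first by rewrite subrr dot0r.
  exact/vL/Af.2.
- move=> a La; case: (HL La) => [[i [j [ij ->]]]|a0]; [left | by right=> m; apply: Mortho].
  have flip u v : on_line M (f u - f v) -> on_line M (f v - f u).
    by move=> /on_lineN; rewrite opprB.
  have M1 : on_line M (f x - f y) by apply: ML; rewrite !inE eqxx.
  have M2 : on_line M (f x - f z) by apply: ML; rewrite !inE eqxx !orbT.
  have M3 : on_line M (f z - f y) by apply: ML; rewrite !inE eqxx !orbT.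
  by move: ij; case: (all3 i) => ->; case: (all3 j) => ->; rewrite ?eqxx // => _; apply: flip.
- move=> d Sd; have [d0|] := pselect (forall i j, dot d (f i - f j) = 0).
    by right=> m; apply: Mortho.
  move=> nd; left.
  have [i [j dij]] : exists i j, dot d (f i - f j) = 1.
    apply: contrapT => no; apply: nd => i j.
    have [->|ij] := eqVneq i j; first by rewrite subrr dot0r.
    have [_ _ dL] := Sd; case/unit_intP: (dL _ (Af.2 i j ij)) => // h; exfalso; apply: no.
      by exists j, i; rewrite -opprB dotNr h opprK.
    by exists i, j.
  have T4 : #|T| != 4%N by rewrite T3.
  have [_ [x' [y' [z' [[h1 h2 h3] h]]]]] := A_short T4 Sd dij.
  have three0 : (3 : R) != 0 by rewrite pnatr_eq0.
  apply: (on_lineVZ three0); case: h => ->; first exact: MS.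
  exact/on_lineN/MS.
Qed.

Lemma component_Afinal : exists M, component M.
Proof.
have [/component_A3//|T4] := eqVneq #|T| 4%N.
have [[d [i [j [Sd dij]]]]|no] := pselect (exists d i j, short d /\ dot d (f i - f j) = 1).
  have [T3 [x [y [z [xyz h]]]]] := A_short T4 Sd dij.
  apply: (component_G2 xyz T3); have [dP _ _] := Sd.
  have three0 : (3 : R) != 0 by rewrite pnatr_eq0.
  have := on_lineZ three0 dP; case: h => -> // /on_lineN.
  by rewrite opprK.
exists (diffs centered); apply: component_A => d Sd i j.
have [->|ij] := eqVneq i j; first by rewrite subrr dot0r.
have [_ _ dL] := Sd; case/unit_intP: (dL _ (Af.2 i j ij)) => // h; exfalso; apply: no.
  by exists d, j, i; split=> //; rewrite -opprB dotNr h opprK.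
by exists d, i, j.
Qed.

End AFrames.

Lemma component_long_pair a b : long a -> long b -> a != b -> a != - b -> dot a b != 0 ->
  exists M, component M.
Proof.
move=> La Lb ab aNb ab0; have [_ a2] := longP La.
wlog ab1 : b Lb ab aNb ab0 / dot b a = 1.
  move=> IH; case/unit_intP: (long_unit La Lb erefl ab aNb) => h.
  - apply: (IH (- b)); rewrite ?opprK //; first exact: longN.
      by rewrite dotNr oppr_eq0.
    by rewrite dotNl dC h opprK.
  - by rewrite h eqxx in ab0.
  - by apply: (IH b); rewrite // dC.
(* The members 0 and [a] form a frame of type A1, which [b] extends to one of type A2; a maximal
   frame thus has at least three members. *)
pose f0 (c : bool) := if c then a else 0.
have A0 : Aframe f0.
  split=> [i j l m|[] [] //= _]; last 2 first.
  - by rewrite subr0.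
  - by rewrite sub0r longN.
  case: i; case: j; case: l; case: m; rewrite /f0 /= ?subrr ?subr0 ?sub0r ?dotE ?a2 //; by ring.
have [T1 [f1 [A1 c1]]] : exists (T' : finType) f', @Aframe T' f' /\ #|T'| = #|{: bool}|.+1.
  apply: (@Aframe_ext _ _ _ _ HPhi _ _ b true A0 Lb) => -[] // _.
  by rewrite /f0 subr0.
have [T [f [Af Tmax]]] := @max_frame R V (fun T f => Aframe f) _ _ _ (@Aframe_bound _ _ _ _) A1.
have T2 : (2 < #|T|)%N by have := Tmax _ _ A1; rewrite c1 card_bool.
have noext c i : long c -> (forall l, l != i -> dot c (f i - f l) = 1) -> False.
  move=> Lc ci; have [T' [f' [A' c']]] := Aframe_ext HPhi Af Lc ci.
  by have := Tmax _ _ A'; rewrite c' ltnn.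
have [[c [i [i' [j [j' [Lc [h1 h2 h3 h4 h5]]]]]]]|noD] := pselect (exists c i i' j j', long c /\
    [/\ i != i', j != j', dot c (f i - f j) = 1, dot c (f i - f i') = 0
      & dot c (f j - f j') = 0]).
  exact: (A_Dtype Af Lc h1 h2 h3 h4 h5).
apply: (@component_Afinal _ f Af T2) => c Lc.
case: (A_cases Af Lc) => [h|h|[[i h]|[i h]]|[i [i' [j [j' h]]]]].
- by left.
- by right.
- by case: (noext c i Lc h).
- by case: (noext (- c) i (longN HPhi Lc) h).
- by case: noD; exists c, i, i', j, j'.
Qed.

End Classification.

(** * Reduction to one component *)

Section SmallRank.
Variables (R : realType) (V : vectType R) (dot : {dot V for idfun}).
Local Notation rf := (reflection dot).
Variable Phi : seq V.
Hypotheses (HPhi : root_system dot Phi) (HcPhi : crystallographic dot Phi).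
Local Notation dC := (dotC dot).
Implicit Types (a b c x y m : V).

Lemma root_cauchy x y : x \in Phi -> y \in Phi -> x != y -> x != - y ->
  dot x y * dot x y < dot x x * dot y y.
Proof.
move=> xP yP xy xNy; have y0 := root_norm HPhi yP.
have y_gt : 0 < dot y y by rewrite lt_def y0 dot_ge0.
have h : dot (dot y y *: x - dot x y *: y) (dot y y *: x - dot x y *: y)
    = dot y y * (dot x x * dot y y - dot x y * dot x y).
  by rewrite !dotE (dC y x); ring.
have := dot_ge0 dot (dot y y *: x - dot x y *: y); rewrite h pmulr_rge0 // subr_ge0.
rewrite le_eqVlt => /predU1P[e|//].
have /eqP : dot y y *: x - dot x y *: y = 0.
  by apply/eqP; rewrite -(dot_eq0 dot) h e; apply/eqP; ring.
rewrite subr_eq0 => /eqP e2.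
have ex : x = (dot x y / dot y y) *: y.
  by rewrite mulrC -scalerA -e2 scalerA mulVf ?scale1r.
have := root_reduced HPhi (dot x y / dot y y) yP; rewrite -ex xP.
by move=> /esym/orP[]/eqP ek; move: xy xNy; rewrite ex ek ?scale1r ?scaleN1r eqxx.
Qed.

Lemma root_ratio x y : x \in Phi -> y \in Phi -> x != y -> x != - y ->
  dot x y != 0 -> dot y y <= dot x x ->
  exists k s : R, [/\ [\/ k = 1, k = 2 | k = 3], s = 1 \/ s = -1,
    dot x x = k * dot y y & 2 * dot x y = s * dot x x].
Proof.
move=> xP yP xy xNy xy0 le_yx.
have x_gt : 0 < dot x x by rewrite lt_def (root_norm HPhi xP) dot_ge0.
have y_gt : 0 < dot y y by rewrite lt_def (root_norm HPhi yP) dot_ge0.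
have /intrP[z ez] : 2 * dot x y / dot y y \is a Num.int by apply: HcPhi.
have /intrP[z' ez'] : 2 * dot x y / dot x x \is a Num.int by rewrite dC; apply: HcPhi.
have hz : z%:~R * dot y y = 2 * dot x y by rewrite -ez divfK // gt_eqF.
have hz' : z'%:~R * dot x x = 2 * dot x y by rewrite -ez' divfK // gt_eqF.
have C := root_cauchy xP yP xy xNy.
have q_gt : 0 < dot x y * dot x y by rewrite lt_def mulf_neq0 //= -expr2 sqr_ge0.
have p_gt : 0 < dot x x * dot y y by apply: mulr_gt0.
have zzE : (z * z')%:~R = 4 * (dot x y * dot x y) / (dot x x * dot y y) :> R.
  by rewrite intrM -ez -ez'; field; rewrite !gt_eqF.
have zz1 : 0 < z * z' by rewrite -(ltr0z R) zzE; apply: divr_gt0 => //; apply: mulr_gt0.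
have zz2 : z * z' < 4.
  rewrite -(ltr_int R) zzE ltr_pdivrMr // (_ : 4%:~R = 4 :> R) //.
  by rewrite ltr_pM2l.
have z'0 : z'%:~R != 0 :> R.
  by apply: contraNneq xy0 => e; move: hz'; rewrite e mul0r => /esym/eqP;
    rewrite mulf_eq0 pnatr_eq0.
have fin (n : int) : [\/ n%:~R = 1 :> R, n%:~R = 2 :> R | n%:~R = 3 :> R] -> z = n * z' ->
    exists k s : R, [/\ [\/ k = 1, k = 2 | k = 3], s = 1 \/ s = -1,
    dot x x = k * dot y y & 2 * dot x y = s * dot x x].
  move=> hn en; exists n%:~R, z'%:~R; split=> //.
  - have : unit_int (z'%:~R : R).
      apply: sqr_int; first by rewrite intr_int.
      apply: le_lt_trans (_ : (z * z')%:~R < 4); last by rewrite -[4]/(4%:~R) ltr_int.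
      rewrite en !intrM -mulrA; have := sqr_ge0 (z'%:~R : R); rewrite expr2.
      by set u := _ * _ => u0; case: hn => ->; lra.
    by case/unit_intP=> e; [right|rewrite e eqxx in z'0|left].
  - apply: (mulfI z'0); rewrite hz' -hz en intrM; ring.
case: (small_int_pairs zz1 zz2) => [e|[e|[e|[e|e]]]].
- by apply: (fin 1); [constructor 1|rewrite mul1r].
- have : dot y y = 2 * dot x x; last by lra.
  have z0 : z%:~R != 0 :> R by move: z'0; rewrite e intrM mulf_eq0 negb_or => /andP[].
  by apply: (mulfI z0); rewrite hz -hz' e intrM; ring.
- by apply: (fin 2) => //; constructor 2.
- have : dot y y = 3 * dot x x; last by lra.
  have z0 : z%:~R != 0 :> R by move: z'0; rewrite e intrM mulf_eq0 negb_or => /andP[].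
  by apply: (mulfI z0); rewrite hz -hz' e intrM; ring.
- by apply: (fin 3) => //; constructor 3.
Qed.

Hypothesis iso_ortho : forall x y, x \in Phi -> y \in Phi -> dot x x = dot y y ->
  x != y -> x != - y -> dot x y = 0.

Lemma root_ratio2 x y : x \in Phi -> y \in Phi -> x != y -> x != - y ->
  dot x y != 0 -> dot y y <= dot x x ->
  dot x x = 2 * dot y y /\ (dot x y = dot y y \/ dot x y = - dot y y).
Proof.
move=> xP yP xy xNy xy0 le_yx.
have y_gt : 0 < dot y y by rewrite lt_def (root_norm HPhi yP) dot_ge0.
have [k [s [hk hs xx exy]]] := root_ratio xP yP xy xNy xy0 le_yx.
case: hk => ek.
- by move: xy0; rewrite iso_ortho ?eqxx // xx ek mul1r.
- split; first by rewrite xx ek.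
  by case: hs => es; [left|right]; move: exy xx; rewrite es ek;
    set u := dot x y; set v := dot y y; lra.
(* [y] and its reflection have the same norm but are neither parallel nor
   orthogonal. *)
- have e : dot y (rf x y) = - (dot y y / 2).
    rewrite rfE dotDr dotNr dotZr (dC y x) exy mulfK ?(root_norm HPhi) //.
    by case: hs => es; move: exy xx; rewrite es ek; set u := dot x y; set v := dot y y; lra.
  have rP : rf x y \in Phi by apply: (root_reflection HPhi).
  have ne1 : y != rf x y.
    by apply/eqP => h; move: e; rewrite -h; clear -y_gt; set v := dot y y in y_gt *; lra.
  have ne2 : y != - rf x y.
    apply/eqP => h; have := dotNr dot (rf x y) y; rewrite -h e.
    by clear -y_gt; set v := dot y y in y_gt *; lra.
  move: e; rewrite iso_ortho ?dot_rf //.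
  by clear -y_gt; set v := dot y y in y_gt *; lra.
Qed.

Lemma root_ortho c m : c \in Phi -> m \in Phi -> c != m -> c != - m ->
  dot c c != 2 * dot m m -> dot m m != 2 * dot c c -> dot c m = 0.
Proof.
move=> cP mP cm cNm n1 n2; apply/eqP/negPn/negP => cm0.
case/orP: (le_total (dot m m) (dot c c)) => le.
  by case: (root_ratio2 cP mP cm cNm cm0 le) n1 => ->; rewrite eqxx.
have mc : m != c by rewrite eq_sym.
have mNc : m != - c by apply: contraNneq cNm => ->; rewrite opprK.
rewrite dC in cm0.
by case: (root_ratio2 mP cP mc mNc cm0 le) n2 => ->; rewrite eqxx.
Qed.

(** An isolated root is a frame of type B with one member, for which [rootsD] is empty. *)
Lemma component_B1 a : a \in Phi ->
  (forall b, b \in Phi -> b = a \/ b = - a \/ dot b a = 0) ->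
  exists M, component dot Phi M.
Proof.
move=> aP h; pose e (_ : unit) := a; exists (rootsB e).
have eP i j : dot (e i) (e j) = dot a a * (i == j)%:R.
  by case: i; case: j; rewrite eqxx mulr1.
have ME m : m \in rootsB e -> m = a.
  by rewrite mem_cat => /orP[/rootsDP[[[] s] [[[] t] [/eqP]]]|/mapP[[] _ ->]].
have aM : a \in rootsB e.
  by rewrite mem_cat (map_f e (mem_enum _ tt)) orbT.
split.
- exact: (ambivalent_B (root_norm HPhi aP) eP).
- by apply: contraTneq aM => ->.
- by move=> m /ME ->; split; [apply: (root_nz HPhi) | apply: mem_on_line].
- move=> b bP; case: (h b bP) => [->|[->|b0]].
  + by left; apply: mem_on_line.
  + by left; apply/on_lineN/mem_on_line.
  + by right=> m /ME ->.
Qed.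

(** The vectors [b] and [a - b] are orthogonal of equal norm, with sum [a] and difference
    [b - (a - b)]: a frame of type B with two members. *)
Lemma component_B2 a b : a \in Phi -> b \in Phi -> dot a a = 2 * dot b b ->
  dot a b = dot b b -> exists M, component dot Phi M.
Proof.
move=> aP bP aa ab.
have b0 := root_norm HPhi bP.
have b_gt : 0 < dot b b by rewrite lt_def b0 dot_ge0.
have e2P : a - b \in Phi.
  have := root_opp HPhi (root_reflection HPhi aP bP); rewrite rfE aa (dC b a) ab.
  by rewrite divff ?mulf_neq0 ?pnatr_eq0 // scale1r opprB.
have fP : b - (a - b) \in Phi.
  have := root_opp HPhi (root_reflection HPhi bP aP); rewrite rfE ab mulfK //.
  by rewrite (_ : - _ = b - (a - b)) //; vec dot.
have ee2 : dot (a - b) (a - b) = dot b b by rewrite !dotE (dC b a) aa ab; ring.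
have ff : dot (b - (a - b)) (b - (a - b)) = 2 * dot b b by rewrite !dotE (dC b a) aa ab; ring.
pose e (i : bool) := if i then b else a - b; exists (rootsB e).
have eP i j : dot (e i) (e j) = dot b b * (i == j)%:R.
  case: i; case: j; rewrite /e ?ee2 ?mulr1 ?mulr0 // !dotE ?(dC b a) ab; ring.
have MD m : m \in rootsB e -> [\/ m = b, m = a - b, m = a \/ m = - a
    | m = b - (a - b) \/ m = - (b - (a - b))].
  rewrite mem_cat => /orP[/rootsDP[[i s] [[j t] []]]|/mapP[[] _ ->]]; last 2 first.
  - by constructor 1.
  - by constructor 2.
  case: i; case: j => // _ ->; case: s; case: t; rewrite /sframe /e /=;
    by [constructor 3; left; vec dot | constructor 3; right; vec dot
      | constructor 4; left; vec dot | constructor 4; right; vec dot].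
have Mb : b \in rootsB e by rewrite mem_cat (map_f e (mem_enum _ true)) orbT.
have Me2 : a - b \in rootsB e by rewrite mem_cat (map_f e (mem_enum _ false)) orbT.
have Ma : on_line (rootsB e) a.
  apply/mem_on_line; rewrite mem_cat; apply/orP; left; apply/rootsDP.
  by exists (true, false), (false, true); split=> //; rewrite /sframe /=; vec dot.
have Mf : on_line (rootsB e) (b - (a - b)).
  apply/mem_on_line; rewrite mem_cat; apply/orP; left; apply/rootsDP.
  by exists (true, false), (false, false).
split.
- exact: (ambivalent_B b0 eP).
- by apply: contraTneq Mb => ->.
- move=> m /MD mE; have mP : m \in Phi.
    by case: mE => [->|->|[]->|[]->] //; apply: (root_opp HPhi).
  by split; [apply: (root_nz HPhi) | apply: mem_on_line].
- move=> c cP.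
  have pm m : on_line (rootsB e) m -> (c == m) || (c == - m) -> on_line (rootsB e) c.
    by move=> mM /orP[]/eqP -> //; apply: on_lineN.
  have [/pm|] := boolP ((c == b) || (c == - b)); first by left; auto using mem_on_line.
  have [/pm|] := boolP ((c == a - b) || (c == - (a - b))); first by left; auto using mem_on_line.
  have [/pm|] := boolP ((c == a) || (c == - a)); first by left; auto.
  have [/pm|] := boolP ((c == b - (a - b)) || (c == - (b - (a - b)))); first by left; auto.
  rewrite !negb_or => /andP[f1 f2] /andP[a1 a2] /andP[e1 e2] /andP[b1 b2]; right.
  suff [cb ca] : dot c b = 0 /\ dot c a = 0.
    by move=> m /MD[->|->|[]->|[]->]; rewrite ?dotE ?ca ?cb; ring.
  have short0 : dot c b = 0 -> dot c (a - b) = 0 -> dot c b = 0 /\ dot c a = 0.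
    by move=> cb; rewrite !dotE cb => ca; split=> //; lra.
  have long0 : dot c a = 0 -> dot c (b - (a - b)) = 0 -> dot c b = 0 /\ dot c a = 0.
    by move=> ca; rewrite !dotE ca => cb; split=> //; lra.
  (* A remaining root [c] is orthogonal to the shorter pair or to the longer pair, whichever is not
     in length ratio 2 with it; either pair spans the plane. *)
  have [cc|n1] := eqVneq (dot c c) (dot b b).
    by apply: short0; apply: iso_ortho; rewrite // ee2.
  have [cc|n2] := eqVneq (dot c c) (2 * dot b b).
    by apply: long0; apply: iso_ortho; rewrite // ?aa ?ff.
  have [cc|n3] := eqVneq (dot b b) (2 * dot c c).
    by apply: long0; apply: root_ortho; rewrite // ?aa ?ff; apply/eqP; lra.
  by apply: short0; apply: root_ortho; rewrite // ?ee2.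
Qed.

Lemma component_iso_ortho : Phi != [::] -> exists M, component dot Phi M.
Proof.
have [[x [y [xP yP [xy xNy xy0]]]]|no] := pselect (exists x y, [/\ x \in Phi, y \in Phi
    & [/\ x != y, x != - y & dot x y != 0]]); last first.
  case EPhi : Phi => [//|a s] _; have aP : a \in Phi by rewrite EPhi mem_head.
  rewrite -EPhi; apply: (component_B1 aP) => b bP.
  have [|ne1] := eqVneq b a; first by left.
  have [|ne2] := eqVneq b (- a); first by right; left.
  right; right; apply/eqP/negPn/negP => ab; apply: no.
  by exists b, a.
move=> _; wlog le_yx : x y xP yP xy xNy xy0 / dot y y <= dot x x.
  case/orP: (le_total (dot y y) (dot x x)) => le IH.
    exact: (IH x y).
  apply: (IH y x) => //; [by rewrite eq_sym| |by rewrite dC].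
  by apply: contraNneq xNy => ->; rewrite opprK.
have [xx [h|h]] := root_ratio2 xP yP xy xNy xy0 le_yx.
  exact: (component_B2 xP yP).
apply: (component_B2 xP (root_opp HPhi yP)); rewrite !dotE ?opprK //.
by rewrite h opprK.
Qed.

End SmallRank.

(** * Rescaling a root system *)

Section Rescaling.
Variables (R : realType) (V : vectType R) (dot : {dot V for idfun}) (Phi : seq V) (k : R).
Hypothesis k0 : k != 0.
Implicit Types (a b m : V).

Let mem_scale a : (k *: a \in map ( *:%R k) Phi) = (a \in Phi).
Proof. by rewrite mem_map //; apply: scalerI. Qed.

Lemma root_system_scale : root_system dot Phi -> root_system dot (map ( *:%R k) Phi).
Proof.
move=> HPhi; split.
- by rewrite -[0](scaler0 _ k) mem_scale (root_neq0 HPhi).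
- move=> _ c /mapP[a aP ->]; rewrite scalerA mulrC -scalerA mem_scale.
  exact: root_reduced HPhi _ _ aP.
- move=> _ _ /mapP[a aP ->] /mapP[b bP ->]; rewrite rfZ // linearZ mem_scale.
  exact: (root_reflection HPhi).
Qed.

Lemma crystallographic_scale : crystallographic dot Phi ->
  crystallographic dot (map ( *:%R k) Phi).
Proof.
move=> HcPhi _ _ /mapP[a aP ->] /mapP[b bP ->].
rewrite (_ : cartan_number _ _ _ = cartan_number dot b a); first exact: HcPhi.
rewrite /cartan_number !dotE.
have [->|aa] := eqVneq (dot a a) 0; first by rewrite !mulr0 invr0 !mulr0.
by field; rewrite aa k0.
Qed.

Lemma component_scale M : component dot (map ( *:%R k) Phi) M -> component dot Phi M.
Proof.
case=> ambM M0 MP PM; split=> // [m /MP[m0 [c c0 /mapP[a aP e]]]|a].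
  split=> //; exists (k^-1 * c); first by rewrite mulf_neq0 ?invr_eq0.
  by rewrite -scalerA e scalerA mulVf ?scale1r.
rewrite -mem_scale => /PM[/(on_lineVZ k0)|h]; [by left | right=> m /h/eqP].
by rewrite dotZl mulf_eq0 (negPf k0) => /eqP.
Qed.

End Rescaling.

(** * Induction over components *)

Section Main.
Variables (R : realType) (V : vectType R) (dot : {dot V for idfun}).
Implicit Types (Phi M : seq V).

Theorem root_component Phi : root_system dot Phi -> crystallographic dot Phi ->
  Phi != [::] -> exists M, component dot Phi M.
Proof.
move=> HPhi HcPhi Phi0.
have [[x [y [xP yP [xxyy xy xNy xy0]]]]|no] := pselect (exists x y, [/\ x \in Phi, y \in Phi
    & [/\ dot x x = dot y y, x != y, x != - y & dot x y != 0]]); last first.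
  apply: component_iso_ortho => // x y xP yP xx xy xNy.
  by apply/eqP/negPn/negP => xy0; apply: no; exists x, y.
have x_gt : 0 < dot x x by rewrite lt_def (root_norm HPhi xP) dot_ge0.
(* Chosen so that the common squared norm of [x] and [y] becomes 2. *)
pose k := Num.sqrt (2 / dot x x).
have kk : k * k = 2 / dot x x by rewrite -expr2 sqr_sqrtr // divr_ge0 // ltW.
have k0 : k != 0.
  by apply: contraTneq (divr_gt0 (ltr0Sn R 1) x_gt) => e; rewrite -kk e mul0r ltxx.
have norm z : z \in Phi -> dot z z = dot x x -> long dot (map ( *:%R k) Phi) (k *: z).
  move=> zP zz; rewrite /long map_f //= !dotE mulrA kk zz divfK ?eqxx //.
  by rewrite gt_eqF.
have [M cM] : exists M, component dot (map ( *:%R k) Phi) M.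
  apply: (component_long_pair (root_system_scale k0 HPhi) (crystallographic_scale k0 HcPhi)
    (norm x xP erefl) (norm y yP (esym xxyy))).
  - by apply: contraNneq xy => /(scalerI k0) ->.
  - by apply: contraNneq xNy; rewrite -scalerN => /(scalerI k0) ->.
  - by rewrite !dotE !mulf_neq0.
by exists M; apply: component_scale cM.
Qed.

Lemma root_system_perp M Phi : root_system dot Phi -> root_system dot (perp dot M Phi).
Proof.
move=> HPhi; split.
- by rewrite mem_filter negb_and (root_neq0 HPhi) orbT.
- move=> a c; rewrite !mem_filter => /andP[aM aP]; rewrite (root_reduced HPhi _ aP).
  apply: andb_idl => _; apply/allP => m /(allP aM) /eqP am.
  by rewrite dotZl am mulr0.
- move=> a b; rewrite !mem_filter => /andP[aM aP] /andP[bM bP].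
  rewrite (root_reflection HPhi) // andbT; apply/allP => m mM.
  by rewrite rfE !dotE (eqP (allP aM m mM)) (eqP (allP bM m mM)) mulr0 subr0.
Qed.

Lemma crystallographic_perp M Phi : crystallographic dot Phi ->
  crystallographic dot (perp dot M Phi).
Proof.
by move=> HcPhi a b; rewrite !mem_filter => /andP[_ aP] /andP[_ bP]; apply: HcPhi.
Qed.

Theorem root_system_ambivalent Phi : root_system dot Phi -> crystallographic dot Phi ->
  ambivalent dot Phi.
Proof.
have [n] := ubnP (size Phi); elim: n Phi => // n IHn Phi szP HPhi HcPhi.
have [->|Phi0] := eqVneq Phi [::].
  move=> s s0; exists [::] => // v; case: s s0 => [|a s /(_ a)]; rewrite ?word_nil //.
  by rewrite mem_head => /(_ isT).
have [M [ambM M0 MP PM]] := root_component HPhi HcPhi Phi0.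
apply: (ambivalent_perp (root_neq0 HPhi) _ PM ambM) => [m /MP[]//|].
apply: IHn; [|exact: root_system_perp|exact: crystallographic_perp].
rewrite ltnS in szP; apply: leq_trans szP.
(* The orthogonal roots are fewer: a root on the line of a member [m] of [M] is not orthogonal to
   [m]. *)
rewrite ltn_neqAle size_filter count_size andbT -all_count.
case: M M0 MP {ambM PM} => // m M _ /(_ m (mem_head _ _))[m0 [c c0 cP]].
apply/allPn; exists (c *: m) => //=.
by rewrite dotZl mulf_eq0 negb_and negb_or c0 dot_eq0 m0.
Qed.
End Main.

Theorem corollary1p2 (R : realType) (V : vectType R) (dot : {dot V for idfun})
    (Phi : seq V) (HPhi : root_system dot Phi)
    (HcPhi : crystallographic dot Phi) (w : 'End(V)) (Hw : weyl_group dot Phi w) :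
  exists g : 'End(V),
    weyl_group dot Phi g /\ (g \o w \o g^-1)%VF = (w^-1)%VF.
Proof.
have Phi0 := root_neq0 HPhi.
have [s sP ->] : exists2 s, {subset s <= Phi} & w = word dot s by apply/weyl_wordP.
have [g gP sgs] := root_system_ambivalent HPhi HcPhi sP.
have s0 := subs_notin0 Phi0 sP; have g0 := subs_notin0 Phi0 gP.
exists (word dot g); split; first by apply/weyl_wordP => //; exists g.
rewrite !word_inv //; apply/lfunP => v; rewrite !comp_lfunE.
(* Multiplying [w g w = g] by [w^-1] on the left and [g^-1] on the right gives [g w g^-1 = w^-1]. *)
by rewrite -(word_revK dot (word dot g _) s0) sgs word_revKV.
Qed.
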